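(* Let $f:\mathbb{R}\to\mathbb{R}$ be a $C^1$ function such that $f(x)>0$ and $f(x)\ge xf'(x)$ for every $x>0$. Then the overdetermined elliptic problem (OEP) for $f$ on the standard sphere $M=\mathbb{S}^2$, $$\begin{cases}\Delta u+f(u)=0 & \text{in }\Omega\subset\mathbb{S}^2,\\ u>0 & \text{in }\Omega,\\ u=0 & \text{on }\partial\Omega,\\ \langle\nabla u,\vec\eta\rangle=\alpha & \text{on }\partial\Omega,\end{cases}$$ admits a family of candidate solutions.
   Context: Notation: $\mathbb{R}_+=[0,+\infty)$; $M=\mathbb{S}^2$ is the standard round unit sphere with metric $\langle\cdot,\cdot\rangle$; $\vec\eta$ is the unit outward normal; $\nabla$ is the Levi-Civita connection (also the gradient) and $\nabla^2$ the Hessian; $S^2M$ is the bundle of symmetric $2$-forms on $M$. A domain in $M$ is a connected open subset of $M$ with a (nonempty) $C^2$ boundary. Continuous family of domains: given a manifold $N$ (possibly with boundary), a family $(\Omega_p)_{p\in N}$ of domains of $M$ is continuous if for any $p_0\in N$, any closed subset $F$ of $M$ contained in $\Omega_{p_0}$ and any open set $U$ with $\overline\Omega_{p_0}\subset U$, one has $F\subset\Omega_p\subset U$ for all $p$ close to $p_0$. Smooth family of $C^3$ functions: given such a continuous family, let $A=\{(p,q)\in N\times M : q\in\overline\Omega_p\}$. A smooth family of $C^3$ functions on $(\Omega_p)_{p\in N}$ is a map $V:A\to\mathbb{R}$ such that (i) each $v_p:\overline\Omega_p\to\mathbb{R}$, $q\mapsto V(p,q)$, is $C^3$; (ii) there is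 an open neighborhood $B$ of $A$ in $N\times M$ such that $V$ extends to $B$ and the map $\Phi:B\to\mathbb{R}\times TM\oplus S^2M$, $(p,q)\mapsto (v_p(q),(q,\nabla v_p(q),\nabla^2v_p(q)))$, is $C^1$ on $A$. One writes $(v_p)_{p\in N}$ for the family. Family of candidate solutions: let $N=(TM\times\mathbb{R}_+)\setminus\{(q,0,0): q\in M\}$, whose elements are written $(q,w,a)$ with $q\in M$, $w\in T_qM$, $a\ge0$, $(w,a)\neq(0,0)$. The OEP (for $f$ on $M$) admits a family of candidate solutions if there is a smooth family of $C^3$ functions $(v_{q,w,a})_{(q,w,a)\in N}$, $v_{q,w,a}$ being defined on $\overline\Omega_{q,w,a}$ with $\Omega_{q,w,a}\subset M$ a domain with $C^2$ boundary, such that $\Delta v_{q,w,a}+f(v_{q,w,a})=0$ and $v_{q,w,a}>0$ in $\Omega_{q,w,a}$, $v_{q,w,a}=0$ on $\partial\Omega_{q,w,a}$, $\langle\nabla v_{q,w,a},\vec\eta\rangle$ is a negative constant on $\partial\Omega_{q,w,a}$ (the constant may depend on $(q,w,a)$ and need not be a prescribed $\alpha$), and: (a) $q\in\overline\Omega_{q,w,a}$; (b) $v_{q,w,a}(q)=a$; (c) $\nabla v_{q,w,a}(q)=w$; (d) for any $(q_0,w_0,a_0)\in N$, writing $\Omega_0=\Omega_{q_0,w_0,a_0}$ and $v_0=v_{q_0,w_0,a_0}$, for every $q\in\overline\Omega_0$ one has $\Omega_{q,\nabla v_0(q),v_0(q)}=\Omega_0$ and $v_{q,\nabla v_0(q),v_0(q)}=v_0$.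 *)

(* Defs.v *)
From HB Require Import structures.
From mathcomp Require Import all_boot all_order all_algebra.
From mathcomp Require Import all_classical all_reals all_analysis.
Set Implicit Arguments.
Unset Strict Implicit.
Unset Printing Implicit Defensive.
Import Order.TTheory GRing.Theory Num.Theory.
Import numFieldNormedType.Exports.
Local Open Scope classical_set_scope.
Local Open Scope ring_scope.

(** The unit sphere, its tangent bundle and its bundle of
    symmetric 2-forms are embedded in [R^3], [R^3 x R^3] and
    [R^3 x 'M_3]; maps on subsets of the sphere are total maps on ['rV_3] of
    which only the values on the sphere matter. *)

Section Regularity.
Variable R : realType.

Definition relopen (T : topologicalType) (X A : set T) : Prop :=
  exists2 O : set T, open O & A = O `&` X.

(** [g] is of class C^k on the open set [U], for finite-dimensional [V]:
    there, C^(k+1) means differentiable with all directional derivatives C^k. *)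
Fixpoint Ck (V W : normedModType R) (k : nat) (U : set V) (g : V -> W) : Prop :=
  if k is k'.+1 then
    (forall x, U x -> differentiable g x) /\
    (forall v : V, Ck k' U (fun x => 'D_v g x))
  else forall x, U x -> {for x, continuous g}.

(** [F], a map on the subset [X] of a Euclidean space, is C^k near [x]: it is
    locally the restriction of a C^k map of the ambient space. For [X] an
    embedded manifold, possibly with boundary, this is the usual notion. *)
Definition Ck_near (V W : normedModType R) (k : nat) (X : set V)
    (F : V -> W) (x : V) : Prop :=
  exists (U : set V) (G : V -> W),
    [/\ open U, U x, Ck k U G & forall y, U y -> X y -> G y = F y].

End Regularity.

Section Sphere.
Variable R : realType.
Notation E3 := 'rV[R]_3.

Definition dot (x y : E3) : R := \sum_(i < 3) x 0 i * y 0 i.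

Definition enorm (x : E3) : R := Num.sqrt (dot x x).

Definition S2 : set E3 := [set x | dot x x = 1].

Definition TS2 : set (E3 * E3) := [set z | S2 z.1 /\ dot z.1 z.2 = 0].

Definition tproj (q x : E3) : E3 := x - dot x q *: q.

(** Radial extension of a map on the sphere. For [q] on the sphere and [X]
    tangent at [q], ['D_X (radial F) q] is the derivative of [F] along [X], and
    [F] is differentiable at [q] as a map on the sphere iff [radial F] is
    differentiable at [q]. *)
Definition radial (T : Type) (F : E3 -> T) (x : E3) : T :=
  F ((enorm x)^-1 *: x).

(** The vector of T_q S^2 such that [dot (grad u q) X] is the derivative
    of [u] along [X], for every tangent [X]. *)
Definition grad (u : E3 -> R) (q : E3) : E3 :=
  \row_(i < 3) 'D_(tproj q (delta_mx 0 i)) (radial u : E3 -> R^o) q.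

(** Levi-Civita connection of the induced metric: tangential part of the
    Euclidean derivative. *)
Definition covd (Y : E3 -> E3) (q X : E3) : E3 :=
  tproj q ('D_X (radial Y) q).

(** A bilinear form [h] on T_q S^2 is encoded by the 3 x 3 matrix of its pullback
    to [R^3] by the orthogonal projection [tproj q]; its trace is the matrix
    trace. *)
Definition hess (u : E3 -> R) (q : E3) : 'M[R]_3 :=
  \matrix_(i < 3, j < 3)
    dot (covd (grad u) q (tproj q (delta_mx 0 i))) (tproj q (delta_mx 0 j)).

Definition lap (u : E3 -> R) (q : E3) : R := \tr (hess u q).

(** Boundary in S^2 of an open subset of S^2. *)
Definition bdry (Om : set E3) : set E3 := closure Om `\` Om.

Definition defining_function (Om : set E3) (q : E3) (rho : E3 -> R) : Prop :=
  [/\ Ck_near 2 S2 (rho : E3 -> R^o) q,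
      grad rho q != 0
    & \forall x \near within S2 (nbhs q), Om x <-> rho x < 0].

Definition C2_boundary (Om : set E3) : Prop :=
  forall q, bdry Om q -> exists rho, defining_function Om q rho.

Definition domain (Om : set E3) : Prop :=
  [/\ relopen S2 Om, connected Om, bdry Om !=set0 & C2_boundary Om].

Definition outward_normal (Om : set E3) (q eta : E3) : Prop :=
  exists2 rho, defining_function Om q rho
             & eta = (enorm (grad rho q))^-1 *: grad rho q.

Definition OEP (f : R -> R) (alpha : R) (Om : set E3) (u : E3 -> R) : Prop :=
  [/\ forall q, Om q -> lap u q + f (u q) = 0,
      forall q, Om q -> 0 < u q,
      forall q, bdry Om q -> u q = 0
    & forall q eta, bdry Om q -> outward_normal Om q eta ->
        dot (grad u q) eta = alpha].

Section Families.
(** The parameter manifold [N] is a subset of a Euclidean space [T]. *)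
Variables (T : normedModType R) (N : set T).

Definition continuous_family (Om : T -> set E3) : Prop :=
  forall p0, N p0 ->
  forall F U : set E3,
    closed F -> F `<=` S2 -> F `<=` Om p0 ->
    relopen S2 U -> closure (Om p0) `<=` U ->
    \forall p \near within N (nbhs p0), F `<=` Om p /\ Om p `<=` U.

Definition total_closure (Om : T -> set E3) : set (T * E3) :=
  [set z | N z.1 /\ closure (Om z.1) z.2].

Definition jet2 (V : T -> E3 -> R) (z : T * E3) :
    R^o * (E3 * E3 * 'M[R]_3) :=
  (V z.1 z.2, (z.2, grad (V z.1) z.2, hess (V z.1) z.2)).

(** [V] is the map already extended to the neighbourhood [B] of
    [total_closure Om]; its values outside [B] are irrelevant. *)
Definition smooth_family (Om : T -> set E3) (V : T -> E3 -> R) : Prop :=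
  (forall p q, N p -> closure (Om p) q ->
     Ck_near 3 (closure (Om p)) (V p : E3 -> R^o) q) /\
  exists B : set (T * E3),
    [/\ relopen (N `*` S2) B,
        total_closure Om `<=` B,
        forall p q, B (p, q) ->
          differentiable (radial (V p) : E3 -> R^o) q /\
          differentiable (radial (grad (V p))) q
      & forall z, total_closure Om z -> Ck_near 1 B (jet2 V) z].

End Families.

Definition paramN : set (E3 * E3 * R^o) :=
  [set p | [/\ TS2 p.1, 0 <= p.2 & (p.1.2, p.2) != (0, 0)]].

Definition admits_candidate_solutions (f : R -> R) : Prop :=
  exists (Om : E3 * E3 * R^o -> set E3) (V : E3 * E3 * R^o -> E3 -> R),
  [/\ forall p, paramN p -> domain (Om p),
      continuous_family paramN Om,
      smooth_family paramN Om V,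
      forall p, paramN p -> exists2 alpha, alpha < 0 & OEP f alpha (Om p) (V p)
    & (forall q w a, paramN (q, w, a) ->
        [/\ closure (Om (q, w, a)) q,
            V (q, w, a) q = a
          & grad (V (q, w, a)) q = w]) /\
      (forall p0, paramN p0 -> forall q, closure (Om p0) q ->
        let p := (q, grad (V p0) q, V p0 q) in
        Om p = Om p0 /\
        (forall x, closure (Om p0) x -> V p x = V p0 x))].

End Sphere.

(* Main.v *)
Require Import Defs.
From HB Require Import structures.
From mathcomp Require Import all_boot all_order all_algebra.
From mathcomp Require Import all_classical all_reals all_analysis.
From mathcomp Require Import ring lra.
Set Implicit Arguments.
Unset Strict Implicit.
Unset Printing Implicit Defensive.
Import Order.TTheory GRing.Theory Num.Theory.
Import numFieldNormedType.Exports.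
Local Open Scope classical_set_scope.
Local Open Scope ring_scope.

(** The candidates are radial. In the variable [s = 1 - dot c x] a function
    [u x = y s] solves [lap u + f u = 0] iff [(s (2 - s) y')' = - f y]; let
    [Y h] be the solution with [Y h 0 = h]. As [x f'(x) <= f x], the
    Wronskian of [Y h] and [Z = d(Y h)/dh] shows that [Z > 0] as long as
    [Y h > 0]. Hence, with [W = d(Y h)/ds] and [V = dW/dh],
    [J = s (2 - s) V W + (1 - s) W Z + f (Y h) Z] is positive, because
    [s (2 - s) J^2] is nondecreasing; and [2 J] is the derivative in [h] of
    [s (2 - s) W^2], the squared length of the gradient, along a level set of
    [Y]. Together with the limits [h -> a] and [h -> oo], this shows that each
    value [a >= 0] and squared gradient [b >= 0], not both zero, are taken at
    exactly one [(h, s)], which depends on [(a, b)] in a C^1 way since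
    [J <> 0]. The pole [c] is then determined by [q] and [w], and uniqueness
    of [(h, s)] and [c] gives the compatibility condition (d). *)

(** * One-variable calculus *)

(** Three obstacles shape the proof. The equation is singular at both poles. At [s = 0] it is
    integrated once, which writes [W] as minus an average of [f (Y h)] divided by [2 - s]. Near
    [s = 2] the coefficient [1 / (2 - s)] is truncated; its integral diverges logarithmically, so
    each solution of positive height vanishes before a fine enough truncation is felt. Next, [f] is
    not globally Lipschitz and its hypotheses concern positive arguments only, so it is cut off as
    well; one index governs both truncations, and Gronwall's inequality shows that the results do
    not depend on it. Last, [f] is only C^1, so the second derivative [Q] in [s] is only known to be
    continuous at [s = 0], while the Hessian has to be C^1 there: [Q] enters it multiplied by
    coordinates that vanish at the pole, and these products are C^1. Positivity of [J] rests on
    [s (2 - s) J' + (1 - s) J = - W Z], where [- W Z >= 0] up to the first zero of [Y h]. As to the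
    limits in [h], a small drop [h - a] leaves no room for a large gradient, while [Y h >= h Y 1]
    for [h >= 1] as long as [Y 1 > 0], a consequence of [x f'(x) <= f x], forces tall solutions to
    be steep. *)

Section OneVariable.
Variable R : realType.

Lemma neq0_near (s : R) : s != 0 -> \forall t \near s, t != 0.
Proof.
by move=> s0; apply: open_nbhs_nbhs; split => //; exact: open_neq.
Qed.

Implicit Types (f g k : R -> R) (a b s t x y : R).

Lemma is_derive_continuous f x (l : R) : is_derive x 1 f l -> {for x, continuous f}.
Proof.
by move=> fl; apply/differentiable_continuous/derivable1_diffP; exact: ex_derive.
Qed.

Lemma mvt f (df : R -> R) a b : a < b ->
  (forall x, a <= x <= b -> is_derive x 1 f (df x)) ->
  exists2 c, a < c < b & f b - f a = df c * (b - a).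
Proof.
move=> ab fd; have [||c] := @MVT _ f df a b ab.
- by move=> x; rewrite in_itv /= => /andP[ax xb]; apply: fd; rewrite !ltW.
- apply: derivable_within_continuous => x; rewrite in_itv /= => xab.
  by have := fd x xab => ?; exact: ex_derive.
by rewrite in_itv /=; exists c.
Qed.

Lemma deriv_ge0_le f (df : R -> R) a b : a <= b ->
  (forall x, a <= x <= b -> is_derive x 1 f (df x)) ->
  (forall x, a < x < b -> 0 <= df x) -> f a <= f b.
Proof.
rewrite le_eqVlt => /predU1P[->//|ab] fd df0.
have [c cab e] := mvt ab fd.
by rewrite -subr_ge0 e mulr_ge0 ?df0// subr_ge0 ltW.
Qed.

Lemma deriv_le0_ge f (df : R -> R) a b : a <= b ->
  (forall x, a <= x <= b -> is_derive x 1 f (df x)) ->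
  (forall x, a < x < b -> df x <= 0) -> f b <= f a.
Proof.
rewrite le_eqVlt => /predU1P[->//|ab] fd df0.
have [c cab e] := mvt ab fd.
by rewrite -subr_le0 e mulr_le0_ge0 ?df0// subr_ge0 ltW.
Qed.

Lemma deriv_lt0_gt f (df : R -> R) a b : a < b ->
  (forall x, a <= x <= b -> is_derive x 1 f (df x)) ->
  (forall x, a < x < b -> df x < 0) -> f b < f a.
Proof.
move=> ab fd df0; have [c cab e] := mvt ab fd.
by rewrite -subr_lt0 e nmulr_rlt0 ?df0// subr_gt0.
Qed.

(* Restates the goal at a point of [R] rather than at a point of the
   underlying [nbhsType], as the lemmas below need to be applicable. *)
Lemma contR (f : R -> R) : (forall s : R, {for s, continuous f}) -> continuous f.
Proof. by []. Qed.

Lemma contM (T : topologicalType) (f g : T -> R) (x : T) :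
  {for x, continuous f} -> {for x, continuous g} ->
  {for x, continuous (fun t : T => f t * g t)}.
Proof. by move=> fc gc; exact: (@continuousM R T). Qed.

Lemma contD (T : topologicalType) (f g : T -> R) (x : T) :
  {for x, continuous f} -> {for x, continuous g} ->
  {for x, continuous (fun t : T => f t + g t)}.
Proof. by move=> fc gc; exact: (@continuousD R R T). Qed.

Lemma contB (T : topologicalType) (f g : T -> R) (x : T) :
  {for x, continuous f} -> {for x, continuous g} ->
  {for x, continuous (fun t : T => f t - g t)}.
Proof. by move=> fc gc; exact: (@continuousB R R T). Qed.

Lemma contN (T : topologicalType) (f : T -> R) (x : T) :
  {for x, continuous f} -> {for x, continuous (fun t : T => - f t)}.
Proof. by move=> fc; exact: (@continuousN R R T). Qed.

Lemma contC (T : topologicalType) (c : R) (x : T) :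
  {for x, continuous (fun _ : T => c)}.
Proof. exact: cst_continuous. Qed.

Lemma contV (T : topologicalType) (f : T -> R) (x : T) : f x != 0 ->
  {for x, continuous f} -> {for x, continuous (fun t : T => (f t)^-1)}.
Proof. by move=> f0 fc; exact: (@continuousV R T). Qed.

Lemma cont_comp (T U V : topologicalType) (f : U -> V) (g : T -> U) (x : T) :
  {for g x, continuous f} -> {for x, continuous g} ->
  {for x, continuous (fun t : T => f (g t))}.
Proof. by move=> fc gc; exact: continuous_comp. Qed.

Lemma der_unique f x (a b : R) : is_derive x 1 f a -> is_derive x 1 f b -> a = b.
Proof. by move=> [_ <-] [_ <-]. Qed.

Lemma derC (c : R) x : is_derive x 1 (fun=> c) 0.
Proof. exact: is_derive_cst. Qed.

Lemma derI x : is_derive x 1 (fun t : R => t) 1.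
Proof. exact: is_derive_id. Qed.

Lemma derD f g x (a b : R) : is_derive x 1 f a -> is_derive x 1 g b ->
  is_derive x 1 (fun t => f t + g t) (a + b).
Proof. by move=> fa gb; exact: is_deriveD. Qed.

Lemma derB f g x (a b : R) : is_derive x 1 f a -> is_derive x 1 g b ->
  is_derive x 1 (fun t => f t - g t) (a - b).
Proof. by move=> fa gb; exact: is_deriveB. Qed.

Lemma derN f x (a : R) : is_derive x 1 f a -> is_derive x 1 (fun t => - f t) (- a).
Proof. by move=> fa; exact: is_deriveN. Qed.

Lemma derM f g x (a b : R) : is_derive x 1 f a -> is_derive x 1 g b ->
  is_derive x 1 (fun t => f t * g t) (a * g x + f x * b).
Proof.
move=> fa gb; apply: (@is_derive_eq _ _ _ (f * g) x 1 _ _ (is_deriveM fa gb)).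
by rewrite /GRing.scale /=; ring.
Qed.

Lemma derV f x (a : R) : f x != 0 -> is_derive x 1 f a ->
  is_derive x 1 (fun t => (f t)^-1) (- a / f x ^+ 2).
Proof.
move=> f0 fa; apply: (is_derive_eq (is_deriveV f0 fa)).
by rewrite /GRing.scale /= !mulNr mulrC.
Qed.

Lemma der_comp f g x (a b : R) : is_derive (g x) 1 f a -> is_derive x 1 g b ->
  is_derive x 1 (fun t => f (g t)) (a * b).
Proof. by move=> fa gb; apply: is_derive1_comp. Qed.

(* [xi * x] with [0 <= xi <= 1] is a point between 0 and [x], whatever the
   sign of [x]. *)
Lemma mvt0 f (df : R -> R) x :
  (forall xi : R, 0 <= xi <= 1 -> is_derive (xi * x) 1 f (df (xi * x))) ->
  exists2 xi : R, 0 <= xi <= 1 & f x - f 0 = df (xi * x) * x.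
Proof.
move=> fd.
have [|c /andP[c0 c1] /=] := @mvt (fun t => f (t * x))
    (fun t => df (t * x) * (1 * x + t * 0)) 0 1 ltr01.
  move=> t t01; apply: der_comp; first exact: fd.
  by apply: derM; do ?[exact: derI|exact: derC].
rewrite mulr0 addr0 !mul1r mul0r subr0 mulr1 => e; exists c; last exact: e.
by rewrite !ltW.
Qed.

(** * Primitives and averages of continuous functions *)

Lemma antiderivative_exists k : continuous k ->
  exists F : R -> R, F 0 = 0 /\ forall x, is_derive x 1 F (k x).
Proof.
move=> kc.
have loc (n : nat) : exists F : R -> R,
    F 0 = 0 /\ forall x, `|x| < n.+1%:R -> is_derive x 1 F (k x).
  (* An integral from a fixed lower end serves only a bounded window, so there is one primitive for
     each [n], and they are glued afterwards. *)
  pose F x := (\int[lebesgue_measure]_(t in `[(- n.+1%:R : R), x]) k t)%R.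
  exists (fun x => F x - F 0); split; first by rewrite subrr.
  move=> x; rewrite ltr_norml => /andP[nx xn].
  have [|dF Fx] := @continuous_FTC1_closed R k (- n.+1%:R) x n.+1%:R xn _ nx (kc x).
    apply: continuous_compact_integrable; first exact: segment_compact.
    exact: continuous_subspaceT.
  rewrite -[k x]subr0 -Fx; apply: is_deriveB.
  by rewrite derive1E; exact: derivableP.
have {loc} [F FP] := choice loc.
(* Each point is read in a window large enough for it; by the mean value theorem all such windows
   give the same value. *)
pose G x := F (Num.bound `|x|) x.
have FE n x : `|x| < n.+1%:R -> F n x = G x.
  rewrite /G; move=> xn; set m := Num.bound `|x|.
  have xm : `|x| < m.+1%:R.
    by apply: lt_trans (archi_boundP (normr_ge0 _)) _; rewrite ltr_nat.
  have Fd (l : nat) : `|x| < l.+1%:R -> forall xi : R, 0 <= xi <= 1 ->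
      is_derive (xi * x) 1 (F l) (k (xi * x)).
    move=> xl xi /andP[xi0 xi1]; apply: (FP l).2; apply: le_lt_trans xl.
    by rewrite normrM ger0_norm// ler_piMl.
  have := @mvt0 (fun t => F n t - F m t) (fun t => k t - k t) x.
  case; first by move=> xi xi01; apply: derB; exact: Fd.
  by move=> xi _; rewrite (FP n).1 (FP m).1 !subrr mul0r subr0 => /subr0_eq.
exists G; split; first by rewrite /G (FP _).1.
move=> x; pose n := Num.bound `|x|.
have xn : `|x| < n.+1%:R.
  by apply: lt_trans (archi_boundP (normr_ge0 _)) _; rewrite ltr_nat.
apply: near_eq_is_derive ((FP n).2 x xn); near=> y; apply: FE; near: y.
by apply: (cvgr_lt `|x|) => //; exact: norm_continuous.
Unshelve. all: by end_near. Qed.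

(** Total in [k]: where there is no antiderivative it is the zero function. *)
Definition prim k : R -> R :=
  xget (fun=> 0) [set F : R -> R | F 0 = 0 /\ forall x, is_derive x 1 F (k x)].

Lemma primP k : continuous k ->
  prim k 0 = 0 /\ forall x, is_derive x 1 (prim k) (k x).
Proof.
move=> /antiderivative_exists[F Fk]; rewrite /prim; case: xgetP => [G _ //|].
by move=> /(_ F).
Qed.

Lemma prim0 k : continuous k -> prim k 0 = 0.
Proof. by move=> /primP[]. Qed.

Lemma prim_der k x : continuous k -> is_derive x 1 (prim k) (k x).
Proof. by move=> /primP[]. Qed.

Lemma prim_unique k (F : R -> R) x : continuous k ->
  (forall t, is_derive t 1 F (k t)) -> F x - F 0 = prim k x.
Proof.
move=> kc Fk; have := @mvt0 (fun t => F t - prim k t) (fun t => k t - k t) x.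
case; first by move=> xi _; apply: derB => //; exact: prim_der.
move=> xi _; rewrite prim0// subr0 subrr mul0r => /subr0_eq.
by move=> <-; rewrite opprB addrC subrK.
Qed.

(* [avg k s] and [avg1 k s] are the integrals over [tau] in [[0, 1]] of
   [k (s * tau)] and [tau * k (s * tau)]. *)
Definition avg k s : R := if s == 0 then k 0 else prim k s / s.

Lemma continuous_idM k : continuous k -> continuous (fun r : R => r * k r).
Proof. by move=> kc x; apply: continuousM; [exact: cvg_id|exact: kc]. Qed.

Definition avg1 k s : R :=
  if s == 0 then k 0 / 2 else prim (fun r => r * k r) s / s ^+ 2.

Lemma mulr_avg k s : continuous k -> s * avg k s = prim k s.
Proof.
move=> kc; rewrite /avg; case: eqP => [->|/eqP s0].
  by rewrite mul0r prim0.
by rewrite mulrC divfK.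
Qed.

(** The mean value theorem for [prim k]. As [xi * s] lies between 0 and [s], bounds of [k] on a
    segment around 0 pass to its averages. *)
Lemma avg_mean k s : continuous k ->
  exists2 xi : R, 0 <= xi <= 1 & avg k s = k (xi * s).
Proof.
move=> kc; rewrite /avg; case: eqP => [->|/eqP s0].
  by exists 0; rewrite ?mulr0// lexx ler01.
have [|xi xi01] := @mvt0 (prim k) k s; first by move=> *; exact: prim_der.
by rewrite prim0// subr0 => ->; exists xi => //; rewrite mulfK.
Qed.

Lemma avg1_mean k s : continuous k ->
  exists2 xi : R, 0 <= xi <= 1 & avg1 k s = k (xi * s) / 2.
Proof.
move=> kc; rewrite /avg1; case: eqP => [->|/eqP s0].
  by exists 0; rewrite ?mulr0// lexx ler01.
have rkc := continuous_idM kc.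
set P := prim _.
(* Rolle's theorem for [P (t s) - t ^ 2 P s], which vanishes at both ends; the factor [c > 0]
   cancels from the resulting equation. *)
have [|c /andP[c0 c1]] := @mvt (fun t => P (t * s) - (t * t) * P s)
    (fun t => t * s * k (t * s) * (1 * s + t * 0) -
              ((1 * t + t * 1) * P s + t * t * 0)) 0 1 ltr01.
  move=> x _; apply: derB.
    apply: der_comp; first exact: prim_der.
    by apply: derM; do ?[exact: derI|exact: derC].
  by apply: derM; do ?[exact: derM|exact: derI|exact: derC].
have P0 : P 0 = 0 by exact: prim0.
rewrite !mul1r !mul0r P0 !subr0 mulr1 subrr => e.
exists c; first by rewrite !ltW.
have {}e : 2 * c * P s = c * (s ^+ 2 * k (c * s)).
  transitivity ((c + c * 1) * P s + c * c * 0); first by ring.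
  by rewrite -(subr0_eq (esym e)); ring.
have {}e : 2 * P s = s ^+ 2 * k (c * s).
  by apply: (@mulfI _ c); rewrite ?gt_eqF// -e; ring.
have -> : k (c * s) = 2 * P s / s ^+ 2 by rewrite e mulrAC mulfV ?mul1r ?expf_neq0.
by field.
Qed.

Lemma mulr_avg1 k s : continuous k ->
  s ^+ 2 * avg1 k s = prim (fun r => r * k r) s.
Proof.
move=> kc; rewrite /avg1; case: eqP => [->|/eqP s0].
  by rewrite expr0n /= mul0r prim0//; exact: continuous_idM.
by rewrite mulrC divfK// expf_neq0.
Qed.

Lemma mean_continuous0 k (A : R -> R) (c : R) : continuous k ->
  (forall s, exists2 xi : R, 0 <= xi <= 1 & A s = k (xi * s) * c) ->
  {for 0, continuous A}.
Proof.
move=> kc Am; have A0 : A 0 = k 0 * c.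
  by have [xi _ ->] := Am 0; rewrite mulr0.
apply/cvgrPdist_lt => e e0; rewrite A0.
have kcc : {for 0, continuous (fun x => k x * c)}.
  by apply: continuousM; [exact: kc|exact: cst_continuous].
move/cvgrPdist_lt: kcc => /(_ e e0) /nbhs_ballP[d /= d0 dk].
apply/nbhs_ballP; exists d => //= s; rewrite /ball /= sub0r normrN => sd.
have [xi /andP[xi0 xi1] ->] := Am s.
apply: dk; rewrite /ball /= sub0r normrN normrM ger0_norm//.
by apply: le_lt_trans sd; rewrite ler_piMl.
Qed.

Lemma avg1_continuous0 k : continuous k -> {for 0, continuous (avg1 k)}.
Proof. by move=> kc; apply: (mean_continuous0 kc) => s; exact: avg1_mean. Qed.

Lemma avg0 k : avg k 0 = k 0. Proof. by rewrite /avg eqxx. Qed.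

Lemma avg1_0 k : avg1 k 0 = k 0 / 2. Proof. by rewrite /avg1 eqxx. Qed.

Lemma avg_continuous k : continuous k -> continuous (avg k).
Proof.
move=> kc s; have [->|s0] := eqVneq s 0.
  apply: (@mean_continuous0 k _ 1) => // t.
  by have [xi xi01 ->] := avg_mean t kc; exists xi; rewrite ?mulr1.
have : {for s, continuous (fun t => prim k t / t)}.
  apply: continuousM; first exact: is_derive_continuous (prim_der s kc).
  by apply: continuousV => //; exact: cvg_id.
rewrite /continuous_at /avg (negPf s0); apply: cvg_trans.
apply: near_eq_cvg; near=> t; rewrite ifF//; apply/negbTE.
near: t; exact: neq0_near.
Unshelve. all: by end_near. Qed.

Lemma prim_idM k (k1 : R -> R) s : continuous k1 ->
  (forall t, is_derive t 1 k (k1 t)) ->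
  prim (fun r => r * k1 r) s = s * k s - prim k s.
Proof.
move=> k1c kd.
have kc : continuous k by move=> t; exact: is_derive_continuous (kd t).
have d t : is_derive t 1 (fun t => t * k t - prim k t) (t * k1 t).
  by apply: is_derive_eq (derB (derM (derI t) (kd t)) (prim_der t kc)) _; ring.
by rewrite -(prim_unique s (continuous_idM k1c) d) mul0r prim0// !subr0.
Qed.

(** Differentiating [k (s * tau)] under the integral brings out a factor [tau], whence [avg1]. *)
Lemma avg_der k (k1 : R -> R) s : continuous k1 ->
  (forall t, is_derive t 1 k (k1 t)) -> is_derive s 1 (avg k) (avg1 k1 s).
Proof.
move=> k1c kd.
have kc : continuous k by move=> t; exact: is_derive_continuous (kd t).
have [->|s0] := eqVneq s 0.
  (* Integration by parts removes the case distinction of [avg]. As [avg1 k1] is continuous at 0,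
     Caratheodory's criterion then differentiates the product [t * avg1 k1 t] there. *)
  have avgE : avg k = fun t => k t - t * avg1 k1 t.
    apply/funext => t; have [->|t0] := eqVneq t 0.
      by rewrite avg0 mul0r subr0.
    apply: (mulfI t0); rewrite mulr_avg// mulrBr mulrA -expr2 mulr_avg1//.
    by rewrite (prim_idM t k1c kd); ring.
  have d1 : is_derive (0 : R) 1 (fun t => t * avg1 k1 t) (avg1 k1 0).
    apply/is_derive1_caratheodory; exists (avg1 k1); split => // [t|].
      by rewrite mul0r !subr0 mulrC.
    exact: avg1_continuous0.
  rewrite avgE; apply: is_derive_eq (derB (kd 0) d1) _.
  by rewrite avg1_0; field.
apply: (@near_eq_is_derive _ _ _ (fun t => prim k t / t)).
  near=> t; rewrite /avg ifF//; apply/negbTE.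
  near: t; exact: neq0_near.
apply: is_derive_eq (derM (prim_der s kc) (derV s0 (derI s))) _.
rewrite -(mulr_avg s kc); apply: (mulfI (expf_neq0 2 s0)).
rewrite mulr_avg1// (prim_idM _ k1c kd) -(mulr_avg s kc); field.
exact: s0.
Unshelve. all: by end_near. Qed.

Lemma avgB k (k' : R -> R) s : continuous k -> continuous k' ->
  avg (fun t => k t - k' t) s = avg k s - avg k' s.
Proof.
move=> kc k'c; rewrite /avg; case: eqP => // _; rewrite -mulrBl; congr (_ / _).
have d t : is_derive t 1 (fun t => prim k t - prim k' t) (k t - k' t).
  by apply: derB; exact: prim_der.
rewrite -(prim_unique s _ d) ?prim0// ?subrr ?subr0// => t.
by apply: continuousB; [exact: kc|exact: k'c].
Qed.

Lemma avgZ k (c s : R) : continuous k ->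
  avg (fun t => c * k t) s = c * avg k s.
Proof.
move=> kc; rewrite /avg; case: eqP => // _; rewrite mulrA; congr (_ / _).
have d t : is_derive t 1 (fun t => c * prim k t) (c * k t).
  by apply: is_derive_eq (derM (derC c t) (prim_der t kc)) _; ring.
rewrite -(prim_unique s _ d) ?prim0// ?mulr0 ?subr0//.
by apply: contR => t; apply: contM; [exact: contC|exact: kc].
Qed.

Lemma avg1B k (k' : R -> R) s : continuous k -> continuous k' ->
  avg1 (fun t => k t - k' t) s = avg1 k s - avg1 k' s.
Proof.
move=> kc k'c; rewrite /avg1; case: eqP => [_|_]; first by field.
rewrite -mulrBl; congr (_ / _).
have kcx := continuous_idM kc; have k'cx := continuous_idM k'c.
have d t : is_derive t 1 (fun t => prim (fun r => r * k r) t -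
    prim (fun r => r * k' r) t) (t * (k t - k' t)).
  by rewrite mulrBr; apply: derB; exact: prim_der.
rewrite -(prim_unique s _ d) ?prim0// ?subrr ?subr0//.
apply: continuous_idM => t; apply: continuousB; [exact: kc|exact: k'c].
Qed.

Lemma avg_bound k (b s : R) : continuous k ->
  (forall xi : R, 0 <= xi <= 1 -> `|k (xi * s)| <= b) -> `|avg k s| <= b.
Proof. by move=> kc kb; have [xi /kb ? ->] := avg_mean s kc. Qed.

Lemma avg1_bound k (b s : R) : continuous k ->
  (forall xi : R, 0 <= xi <= 1 -> `|k (xi * s)| <= b) -> `|avg1 k s| <= b.
Proof.
move=> kc kb; have [xi /kb kxi ->] := avg1_mean s kc.
by rewrite normrM normfV (ger0_norm (ler0n _ 2)); have := normr_ge0 (k (xi * s)); lra.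
Qed.
End OneVariable.

(** * Gronwall's inequality and Picard iteration *)

Section Volterra.
Variable R : realType.
Implicit Types (f g k y : R -> R) (s t x : R).

Lemma deriv_bound_le f (df : R -> R) (b db : R -> R) (t : R) :
  0 <= t ->
  (forall x, 0 <= x <= t -> is_derive x 1 f (df x)) ->
  (forall x, 0 <= x <= t -> is_derive x 1 b (db x)) ->
  (forall x, 0 <= x <= t -> `|df x| <= db x) ->
  `|f t - f 0| <= b t - b 0.
Proof.
move=> t0 fd bd fb; rewrite ler_norml.
have h1 := @deriv_ge0_le R (fun t => b t - f t) (fun t => db t - df t) 0 t t0
  (fun x xt => derB (bd x xt) (fd x xt)).
have h2 := @deriv_ge0_le R (fun t => b t + f t) (fun t => db t + df t) 0 t t0
  (fun x xt => derD (bd x xt) (fd x xt)).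
have {}h1 : b 0 - f 0 <= b t - f t.
  apply: h1 => x /andP[/ltW x0 /ltW xt]; have := fb x; rewrite x0 xt => /(_ isT).
  by rewrite ler_norml subr_ge0 => /andP[].
have {}h2 : b 0 + f 0 <= b t + f t.
  apply: h2 => x /andP[/ltW x0 /ltW xt]; have := fb x; rewrite x0 xt => /(_ isT).
  by rewrite ler_norml -lerBlDl sub0r => /andP[].
by apply/andP; split; lra.
Qed.

Lemma derIM (c x : R) : is_derive x 1 (fun t : R => t * c) c.
Proof. by apply: is_derive_eq (derM (derI x) (derC c x)) _; ring. Qed.

Lemma expR_der (al c x : R) :
  is_derive x 1 (fun t : R => c * expR (al * t)) (c * al * expR (al * x)).
Proof.
apply: is_derive_eq (derM (derC c x) (der_comp (is_derive_expR (al * x))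
  (derM (derC al x) (derI x)))) _.
by ring.
Qed.

(** The bound on [dE t] involves [E] at an earlier point [xi * t], so the usual integrating factor
    does not apply. Instead let [N] be the maximum of [E] in absolute value with the weight
    [expR (- (2 * K * t))]. Integrating [K * N * expR (2 * K * t)] yields a factor [N / 2], so that
    [N <= |E 0| + d + N / 2]. *)
Lemma gronwall01 (E dE : R -> R) (K d : R) : 0 < K -> 0 <= d ->
  (forall t, 0 <= t <= 1 -> is_derive t 1 E (dE t)) ->
  (forall t, 0 <= t <= 1 ->
    exists2 xi : R, 0 <= xi <= 1 & `|dE t| <= K * `|E (xi * t)| + d) ->
  forall t, 0 <= t <= 1 -> `|E t| <= 2 * (`|E 0| + d) * expR (2 * K).
Proof.
move=> K0 d0 Ed dEb; have K20 : 0 < 2 * K by rewrite mulr_gt0.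
pose w (t : R) : R := `|E t| * expR (- (2 * K * t)).
have wc (t : R) : 0 <= t <= 1 -> {for t, continuous w}.
  move=> t01; apply: (@continuousM R R).
    apply: (continuous_comp (f := E) (g := fun x : R => `|x|)); last exact: norm_continuous.
    exact: is_derive_continuous (Ed t t01).
  apply: (continuous_comp (f := fun t : R => - (2 * K * t)) (g := @expR R)).
    by apply: continuousN; apply: (@continuousM R R); [exact: cst_continuous|exact: cvg_id].
  exact: continuous_expR.
have [|] := @EVT_max R w 0 1 ler01.
  by apply: continuous_in_subspaceT => t; rewrite inE/= in_itv /= => /wc.
move=> t1; rewrite in_itv /= => t1b wmax; set N := w t1 in wmax.
have N0 : 0 <= N by rewrite mulr_ge0 ?expR_ge0.
have EN t : 0 <= t <= 1 -> `|E t| <= N * expR (2 * K * t).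
  move=> t01; have := wmax t; rewrite in_itv /= t01 => /(_ isT).
  by rewrite /w expRN -ler_pdivlMr ?invr_gt0 ?expR_gt0// invrK.
have Nle : N <= `|E 0| + d + N / 2.
  have [t10 t11] := andP t1b.
  have h : `|E t1 - E 0| <= d * t1 + N / 2 * expR (2 * K * t1) -
      (d * 0 + N / 2 * expR (2 * K * 0)).
    apply: (@deriv_bound_le E dE (fun t => d * t + N / 2 * expR (2 * K * t))
    (fun t => 0 * t + d * 1 + N / 2 * (2 * K) * expR (2 * K * t)) t1 t10).
  - by move=> x /andP[x0 xt]; apply: Ed; rewrite x0 (le_trans xt).
  - by move=> x _; apply: derD; [apply: derM; do ?[exact: derI|exact: derC]|exact: expR_der].
  - move=> x /andP[x0 xt]; have x1 := le_trans xt t11.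
    have [|xi /andP[xi0 xi1] h] := dEb x; first by rewrite x0.
    apply: le_trans h _.
    rewrite mul0r add0r mulr1 addrC lerD2l.
    have -> : N / 2 * (2 * K) * expR (2 * K * x) = K * (N * expR (2 * K * x)) by field.
    rewrite ler_pM2l//; apply: le_trans (EN _ _) _.
      by rewrite mulr_ge0//= mulr_ile1.
    by rewrite ler_wpM2l// ler_expR ler_pM2l// ler_piMl.
  rewrite !mulr0 add0r expR0 mulr1 in h.
  have {}h : `|E t1| <= `|E 0| + d + N / 2 * expR (2 * K * t1).
    have := ler_normD (E t1 - E 0) (E 0); rewrite subrK.
    have : d * t1 <= d by rewrite ler_piMr.
    by lra.
  have e1 : 1 <= expR (2 * K * t1) by rewrite -[leLHS]expR0 ler_expR mulr_ge0// ltW.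
  have := h; rewrite -(ler_pM2r (expR_gt0 (- (2 * K * t1)))) -/(w t1) -/N => /le_trans; apply.
  rewrite expRN mulrDl mulfK ?gt_eqF ?expR_gt0// lerD2r ler_piMr ?addr_ge0//.
  by rewrite invf_le1 ?expR_gt0.
move=> t t01; apply: le_trans (EN t t01) _.
have [t0 t1'] := andP t01.
have N2 : N <= 2 * (`|E 0| + d) by lra.
apply: le_trans (ler_wpM2r (expR_ge0 _) N2) _.
by rewrite (ler_wpM2l (le_trans N0 N2))// ler_expR ler_piMr// ltW.
Qed.

(** The segment from 0 to [s], on either side of 0, is rescaled to the unit interval. The [+ 1]
    keeps the rescaled constant positive at [s = 0]. *)
Lemma gronwall (D dD : R -> R) (K d s : R) : 0 < K -> 0 <= d ->
  (forall t, 0 <= t <= 1 -> is_derive (t * s) 1 D (dD (t * s))) ->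
  (forall t, 0 <= t <= 1 ->
    exists2 xi : R, 0 <= xi <= 1 & `|dD (t * s)| <= K * `|D (xi * (t * s))| + d) ->
  `|D s| <= 2 * (`|D 0| + d * `|s|) * expR (2 * (K * (`|s| + 1))).
Proof.
move=> K0 d0 Dd Db.
have s0 : 0 <= `|s| by [].
have h := @gronwall01 (fun t => D (t * s)) (fun t => dD (t * s) * s)
  (K * (`|s| + 1)) (d * `|s|) _ _ _ _ 1.
rewrite mul0r mul1r in h; apply: h.
- by rewrite mulr_gt0// ltr_wpDl.
- by rewrite mulr_ge0.
- move=> t t01; exact: (der_comp (g := fun t : R => t * s) (Dd t t01) (derIM s t)).
- move=> t t01; have [xi xi01 h] := Db t t01; exists xi => //.
  rewrite normrM -mulrA.
  apply: le_trans (ler_wpM2r s0 h) _.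
  rewrite -(mulrA xi t) mulrDl lerD2r -mulrA ler_pM2l// mulrDl.
  by rewrite mul1r [leLHS]mulrC lerDl.
- by rewrite ler01 lexx.
Qed.

(** Integration gains the factor [1 / al], which makes a Picard step a contraction in the norm with
    weight [expR (al * |s|)], on the whole line at once. *)
Lemma exp_integral_bound (F dF : R -> R) (al M s : R) : 0 < al ->
  (forall x, is_derive x 1 F (dF x)) ->
  (forall x, `|dF x| <= M * expR (al * `|x|)) ->
  `|F s - F 0| <= M / al * expR (al * `|s|).
Proof.
move=> al0 Fd Fb.
have M0 : 0 <= M.
  by have := le_trans (normr_ge0 _) (Fb 0); rewrite normr0 mulr0 expR0 mulr1.
have h : `|F (1 * s) - F (0 * s)| <= M / al * expR ((al * `|s|) * 1) -
    M / al * expR ((al * `|s|) * 0).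
  apply: (@deriv_bound_le (fun t => F (t * s)) (fun t => dF (t * s) * s)
    (fun t => M / al * expR ((al * `|s|) * t))
    (fun t => M / al * (al * `|s|) * expR ((al * `|s|) * t)) 1 ler01).
- by move=> t _; exact: (der_comp (g := fun t : R => t * s) (Fd _) (derIM s t)).
- by move=> t _; exact: expR_der.
- move=> t /andP[t0 t1]; rewrite normrM.
  apply: le_trans (ler_wpM2r (normr_ge0 _) (Fb _)) _.
  rewrite normrM (ger0_norm t0) mulrA divfK ?gt_eqF// -!mulrA ler_wpM2l//.
  by rewrite [t * _]mulrC [_ * `|s|]mulrC.
rewrite mul1r mul0r mulr1 in h; apply: le_trans h _.
by rewrite gerBl mulr_ge0 ?expR_ge0// divr_ge0// ltW.
Qed.

Lemma le0_of_half_powers (x A : R) : (forall n, x <= A * 2^-1 ^+ n) -> x <= 0.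
Proof.
move=> xA; rewrite leNgt; apply/negP => x0.
have A0 : 0 < A by have := lt_le_trans x0 (xA 0%N); rewrite expr0 mulr1.
pose n := Num.bound (A / x).
have h : A / x < n%:R by apply: archi_boundP; rewrite divr_ge0// ltW.
have := xA n; rewrite exprVn ler_pdivlMr ?exprn_gt0// => h2.
have : A < x * n%:R by rewrite mulrC -ltr_pdivrMr.
apply/negP; rewrite -leNgt (le_trans _ h2)// ler_wpM2l ?ltW//.
by rewrite -natrX ltr_nat ltn_expl.
Qed.

Lemma continuous_approx (y : R -> R) (s : R) :
  (forall e : R, 0 < e -> exists2 g : R -> R, {for s, continuous g} &
     \forall t \near s, `|y t - g t| <= e) ->
  {for s, continuous y}.
Proof.
move=> yg; apply/cvgrPdist_lt => e e0.
have e4 : 0 < e / 4 by rewrite divr_gt0.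
have [g gc ygs] := yg _ e4.
have ygs0 := nbhs_singleton ygs.
move/cvgrPdist_lt: gc => /(_ _ e4) gc.
near=> t.
have h1 : `|y t - g t| <= e / 4 by near: t.
have h2 : `|g s - g t| < e / 4 by near: t.
have -> : y s - y t = (y s - g s) + (g s - g t) - (y t - g t) by ring.
have := ler_normB ((y s - g s) + (g s - g t)) (y t - g t).
have := ler_normD (y s - g s) (g s - g t).
by lra.
Unshelve. all: by end_near. Qed.

(** * Global Picard iteration in an exponentially weighted norm *)

Section Picard.
Variables (G : R -> R -> R) (c : R -> R) (L C G0 h : R).
Hypothesis Gc : forall y : R -> R, continuous y -> continuous (fun s : R => G s (y s)).
Hypothesis L0 : 0 <= L.
Hypothesis GL : forall s (u v : R), `|G s u - G s v| <= L * `|u - v|.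
Hypothesis cc : continuous c.
Hypothesis cC : forall s, `|c s| <= C.
Hypothesis Gh : forall s, `|G s h| <= G0.

Let slope (y : R -> R) (s : R) : R := - (c s * avg (fun r => G r (y r)) s).
Let step (y : R -> R) (s : R) : R := h + prim (slope y) s.
(** Since [al > 2 * (C * L)], a Picard step at least halves distances weighted by [E]. *)
Let al : R := 2 * (C * L) + 1.

Let C0 : 0 <= C. Proof. exact: le_trans (normr_ge0 _) (cC 0). Qed.
Let al0 : 0 < al. Proof. by rewrite ltr_wpDl// mulr_ge0// mulr_ge0. Qed.

Let slope_continuous y : continuous y -> continuous (slope y).
Proof.
move=> yc; apply: contR => s; apply: contN; apply: contM; first exact: cc.
by apply: avg_continuous; exact: Gc.
Qed.

Let step_der y s : continuous y -> is_derive s 1 (step y) (slope y s).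
Proof.
move=> yc; apply: is_derive_eq (derD (derC h s) (prim_der s (slope_continuous yc))) _.
by rewrite add0r.
Qed.

Let step_continuous y : continuous y -> continuous (step y).
Proof. by move=> yc s; exact: is_derive_continuous (step_der s yc). Qed.

Let step0 y : continuous y -> step y 0 = h.
Proof. by move=> yc; rewrite /step prim0 ?addr0//; exact: slope_continuous. Qed.

Let E (s : R) : R := expR (al * `|s|).
Let E_gt0 s : 0 < E s. Proof. exact: expR_gt0. Qed.
Let E_mono xi s : 0 <= xi <= 1 -> E (xi * s) <= E s.
Proof.
move=> /andP[xi0 xi1]; rewrite ler_expR ler_pM2l// normrM ger0_norm//.
by rewrite ler_piMl.
Qed.

Let step_contract y (y' : R -> R) (B : R) : continuous y -> continuous y' -> 0 <= B ->
  (forall s, `|y s - y' s| <= B * E s) ->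
  forall s, `|step y s - step y' s| <= B / 2 * E s.
Proof.
move=> yc y'c B0 yB s.
have := @exp_integral_bound (fun t => step y t - step y' t)
  (fun t => slope y t - slope y' t) al (C * (L * B)) s al0 _ _.
rewrite !step0// subrr subr0 => H; apply: le_trans (H _ _) _.
- by move=> x; apply: derB; exact: step_der.
- move=> x; rewrite -/(E x).
  have -> : slope y x - slope y' x =
      - (c x * avg (fun t => G t (y t) - G t (y' t)) x).
    rewrite avgB; [|exact: Gc|exact: Gc].
    by rewrite /slope; ring.
  rewrite normrN normrM -mulrA ler_pM//.
  apply: avg_bound.
    by apply: contR => t; apply: contB; [exact: (Gc yc)|exact: (Gc y'c)].
  move=> xi xi01; apply: le_trans (GL _ _ _) _; rewrite -mulrA ler_wpM2l//.
  by apply: le_trans (yB _) _; rewrite ler_wpM2l// E_mono.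
- rewrite -/(E s) ler_pM2r// ler_pdivrMr// /al.
  have : B / 2 * (2 * (C * L) + 1) = C * (L * B) + B / 2 by field.
  move=> ->; rewrite lerDl divr_ge0//.
Qed.

Let yn n := iter n step (fun=> h).
Let B : R := C * G0 / al.
Let B0 : 0 <= B.
Proof.
rewrite divr_ge0//; last exact: ltW.
by rewrite mulr_ge0//; exact: le_trans (normr_ge0 _) (Gh 0).
Qed.

Let B2n_ge0 (n : nat) : 0 <= 2 * B * 2^-1 ^+ n.
Proof.
apply: mulr_ge0; first exact: mulr_ge0 (ler0n _ 2) B0.
by apply: exprn_ge0; rewrite invr_ge0.
Qed.

Let yn_continuous n : continuous (yn n).
Proof.
elim: n => [|n IH]; first by move=> s; exact: cst_continuous.
exact: step_continuous.
Qed.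

Let yn_close n s : `|yn n.+1 s - yn n s| <= B * 2^-1 ^+ n * E s.
Proof.
elim: n s => [|n IH] s.
  rewrite expr0 mulr1 /=.
  have := @exp_integral_bound (step (fun=> h)) (slope (fun=> h)) al (C * G0) s al0.
  have hc : continuous (fun _ : R => h) by move=> x; exact: cst_continuous.
  rewrite step0//; apply; first by move=> x; exact: step_der.
  move=> x; rewrite normrN normrM; apply: le_trans (_ : C * G0 <= _).
    by rewrite ler_pM//; apply: avg_bound => //; exact: Gc.
  rewrite ler_peMr// ?mulr_ge0//.
    exact: le_trans (normr_ge0 _) (Gh 0).
  by rewrite -[leLHS]expR0 ler_expR mulr_ge0// ltW.
have -> : B * 2^-1 ^+ n.+1 * E s = (B * 2^-1 ^+ n) / 2 * E s.
  by rewrite exprSr mulrA.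
have H0 : 0 <= B * 2^-1 ^+ n by rewrite mulr_ge0// exprn_ge0// invr_ge0.
exact: (step_contract (@yn_continuous n.+1) (@yn_continuous n) H0 IH).
Qed.

(** The limit of the iterates is taken pointwise, as the supremum of lower bounds. The factor 2 is
    the sum of the remaining geometric steps: it makes [low] nondecreasing and [up] nonincreasing in
    [n]. *)
Let low n s := yn n s - 2 * B * 2^-1 ^+ n * E s.
Let up n s := yn n s + 2 * B * 2^-1 ^+ n * E s.

Let low_up n m s : low n s <= up m s.
Proof.
have lowS (k : nat) : low k s <= low k.+1 s.
  have := yn_close k s; rewrite ler_norml /low exprS => /andP[+ _].
  have -> : 2 * B * 2^-1 ^+ k * E s = 2 * (B * 2^-1 ^+ k * E s) by ring.
  have -> : 2 * B * (2^-1 * 2^-1 ^+ k) * E s = B * 2^-1 ^+ k * E s by field.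
  by move: (B * _ * _) => X; lra.
have upS (k : nat) : up k.+1 s <= up k s.
  have := yn_close k s; rewrite ler_norml /up exprS => /andP[_].
  have -> : 2 * B * 2^-1 ^+ k * E s = 2 * (B * 2^-1 ^+ k * E s) by ring.
  have -> : 2 * B * (2^-1 * 2^-1 ^+ k) * E s = B * 2^-1 ^+ k * E s by field.
  by move: (B * _ * _) => X; lra.
have lowD (k j : nat) : low k s <= low (k + j)%N s.
  by elim: j => [|j IH]; rewrite ?addn0// addnS (le_trans IH).
have upD (k j : nat) : up (k + j)%N s <= up k s.
  by elim: j => [|j IH]; rewrite ?addn0// addnS (le_trans _ IH).
have lu (k : nat) : low k s <= up k s.
  have := mulr_ge0 (B2n_ge0 k) (ltW (E_gt0 s)); rewrite /low /up.
  by move: (2 * _ * _ * _) => X; lra.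
apply: le_trans (lowD n m) _; apply: le_trans (lu _) _.
by rewrite addnC.
Qed.

Let y s : R := sup (range (low ^~ s)).

Let y_low n s : low n s <= y s.
Proof.
apply: ub_le_sup; last by exists n.
by exists (up 0%N s) => _ [m _ <-]; exact: low_up.
Qed.

Let y_up n s : y s <= up n s.
Proof.
apply: ge_sup; first by exists (low 0%N s); exists 0%N.
by move=> _ [m _ <-]; exact: low_up.
Qed.

Let y_close n s : `|y s - yn n s| <= 2 * B * 2^-1 ^+ n * E s.
Proof.
have := y_low n s; have := y_up n s; rewrite /low /up ler_norml => h1 h2.
by apply/andP; split; lra.
Qed.

Let y_continuous : continuous y.
Proof.
move=> s; apply: continuous_approx => e e0.
have [n hn] : exists n, 2 * B * 2^-1 ^+ n * expR (al * (`|s| + 1)) <= e.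
  apply: contrapT => /forallNP hn.
  have : e <= 0.
    apply: (@le0_of_half_powers _ (2 * B * expR (al * (`|s| + 1)))) => n.
    by have /negP := hn n; rewrite -ltNge mulrAC => /ltW.
  by rewrite leNgt e0.
exists (yn n); first exact: yn_continuous.
near=> t; apply: le_trans (y_close n t) _; apply: le_trans _ hn.
rewrite (ler_wpM2l (B2n_ge0 n))// ler_expR ler_pM2l//.
have : `|s - t| < 1 by near: t; apply: cvgr_dist_lt => //; exact: cvg_id.
by have := ler_normB s (s - t); rewrite opprB addrC subrK; lra.
Unshelve. all: by end_near. Qed.

Let y_fixed s : step y s = y s.
Proof.
apply/eqP; rewrite -subr_eq0 -normr_le0.
apply: (@le0_of_half_powers _ (2 * B * E s)) => n.
have := step_contract y_continuous (@yn_continuous n) (B2n_ge0 n) (y_close n) s.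
have := y_close n.+1 s.
rewrite -[step (yn n)]/(yn n.+1) exprS => h1 h2.
have -> : step y s - y s = (step y s - yn n.+1 s) - (y s - yn n.+1 s) by ring.
apply: le_trans (ler_normB _ _) _; apply: le_trans (lerD h2 h1) _.
by rewrite le_eqVlt; apply/orP; left; apply/eqP; field.
Qed.

Lemma volterra_solution : exists y : R -> R, [/\ continuous y, y 0 = h &
  forall s, is_derive s 1 y (- (c s * avg (fun r => G r (y r)) s))].
Proof.
exists y; split; first exact: y_continuous.
  by rewrite -y_fixed step0//; exact: y_continuous.
move=> s; have <- : step y = y by apply/funext => t; exact: y_fixed.
have {2}-> : step y = y by apply/funext => t; exact: y_fixed.
by apply: step_der; exact: y_continuous.
Qed.

End Picard.
End Volterra.

(** * Joint continuity *)

Section TwoVariables.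
Variable R : realType.
Implicit Types (F G : R -> R -> R) (h s T e : R).

Lemma near_realP (x : R) (P : R -> Prop) :
  (\forall t \near x, P t) <->
  exists2 d : R, 0 < d & forall t, `|t - x| < d -> P t.
Proof.
split.
  move=> /nbhs_ballP[d /= d0 dP]; exists d => // t td; apply: dP.
  by rewrite /ball /= distrC.
move=> [d d0 dP]; apply/nbhs_ballP; exists d => //= t.
by rewrite /ball /= distrC => /dP.
Qed.

Lemma near_real2P (x y : R) (P : R -> R -> Prop) :
  (\forall p \near ((x, y) : R * R), P p.1 p.2) <->
  exists2 d : R, 0 < d &
    forall t u, `|t - x| < d -> `|u - y| < d -> P t u.
Proof.
split.
  move=> /nbhs_ballP[d /= d0 dP]; exists d => // t u td ud.
  by apply: (dP (t, u)); split; rewrite /ball /= distrC.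
move=> [d d0 dP]; apply/nbhs_ballP; exists d => //= -[t u] [/=].
by rewrite /ball /= distrC => td; rewrite /ball /= distrC => /(dP _ _ td).
Qed.

Lemma near_ltr (s b : R) : s < b -> \forall t \near s, t < b.
Proof.
move=> sb; apply/near_realP; exists (b - s); first by rewrite subr_gt0.
by move=> t /ltr_normlW; rewrite ltrD2r.
Qed.

Lemma cont_realP (f : R -> R) (x : R) : {for x, continuous f} <->
  forall e, 0 < e -> exists2 d : R, 0 < d &
    forall t, `|t - x| < d -> `|f t - f x| < e.
Proof.
split.
  move=> /cvgrPdist_lt fc e /fc /near_realP[d d0 dP]; exists d => // t /dP.
  by rewrite distrC.
move=> fc; apply/cvgrPdist_lt => e /fc[d d0 dP]; apply/near_realP.
by exists d => // t /dP; rewrite distrC.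
Qed.

Lemma near_eq_cont (T : topologicalType) (f g : T -> R) (x : T) :
  (\forall t \near x, f t = g t) -> {for x, continuous f} -> {for x, continuous g}.
Proof.
move=> fg fc; rewrite /prop_for /continuous_at -(nbhs_singleton fg).
by apply: cvg_trans fc; apply: near_eq_cvg.
Qed.

Definition jc (F : R -> R -> R) : Prop :=
  forall p : R * R, {for p, continuous (fun q : R * R => F q.1 q.2)}.

Lemma cont_real2P F h s :
  {for ((h, s) : R * R), continuous (fun q : R * R => F q.1 q.2)} <->
  forall e, 0 < e -> exists2 d : R, 0 < d &
    forall t u, `|t - h| < d -> `|u - s| < d -> `|F t u - F h s| < e.
Proof.
split.
  move=> /cvgrPdist_lt /= fc e /fc /(near_real2P h s (fun t u => `|F h s - F t u| < e)).
  by move=> [d d0 dP]; exists d => // t u td ud; rewrite distrC; exact: dP.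
move=> fc; apply/cvgrPdist_lt => e /fc[d d0 dP] /=.
apply/(near_real2P h s (fun t u => `|F h s - F t u| < e)).
by exists d => // t u td ud; rewrite distrC; exact: dP.
Qed.

Lemma jc_section F h : jc F -> continuous (F h).
Proof.
move=> Fc; apply: contR => s; apply/cont_realP => e e0.
have /cont_real2P /(_ e e0)[d d0 dP] := Fc (h, s).
by exists d => // t td; apply: dP => //; rewrite subrr normr0.
Qed.

Lemma jc_unif F h0 T e : jc F -> 0 < e -> exists2 d : R, 0 < d &
  forall h, `|h - h0| < d -> forall s, `|s| <= T -> `|F h s - F h0 s| <= e.
Proof.
move=> Fc e0; apply/near_realP.
have /compact_near_coveringP cov := @segment_compact R (- T) T.
have {}cov : \forall h \near h0, `[- T, T]%classic `<=` (fun s => `|F h s - F h0 s| <= e).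
  apply: (cov R (nbhs h0) (fun h s => `|F h s - F h0 s| <= e)) => s _.
  have e2 : 0 < e / 2 by rewrite divr_gt0.
  have /cont_real2P /(_ _ e2)[d d0 dP] := Fc (h0, s).
  apply/(near_real2P s h0 (fun t h => `|F h t - F h0 t| <= e)).
  exists d => // t h td hd.
  have -> : F h t - F h0 t = (F h t - F h0 s) - (F h0 t - F h0 s) by ring.
  apply: le_trans (ler_normB _ _) _; have := dP _ _ hd td.
  have : `|F h0 t - F h0 s| < e / 2 by apply: dP => //; rewrite subrr normr0.
  by lra.
apply: filterS cov => h H s sT; apply: H => /=.
by rewrite in_itv /= -ler_norml.
Qed.

Lemma unif_jc F : (forall h, continuous (F h)) ->
  (forall h0 T e, 0 < e -> exists2 d : R, 0 < d &
    forall h, `|h - h0| < d -> forall s, `|s| <= T -> `|F h s - F h0 s| <= e) ->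
  jc F.
Proof.
move=> Fs Fu [h0 s0]; apply/cont_real2P => e e0.
have e2 : 0 < e / 2 by rewrite divr_gt0.
have /cont_realP /(_ _ e2)[d1 d10 d1P] := Fs h0 s0.
have [d2 d20 d2P] := Fu h0 (`|s0| + 1) _ e2.
exists (Num.min d1 (Num.min d2 1)); first by rewrite !lt_min d10 d20 ltr01.
move=> t u; rewrite !lt_min => /and3P[_ t2 _] /and3P[u1 _ u3].
have -> : F t u - F h0 s0 = (F t u - F h0 u) + (F h0 u - F h0 s0) by ring.
apply: le_lt_trans (ler_normD _ _) _; have := d1P _ u1.
have : `|F t u - F h0 u| <= e / 2.
  apply: d2P => //; have := ler_normD (u - s0) s0; rewrite subrK; lra.
by lra.
Qed.

Lemma jcD F G : jc F -> jc G -> jc (fun h s => F h s + G h s).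
Proof. by move=> Fc Gc p; apply: contD; [exact: Fc|exact: Gc]. Qed.
Lemma jcB F G : jc F -> jc G -> jc (fun h s => F h s - G h s).
Proof. by move=> Fc Gc p; apply: contB; [exact: Fc|exact: Gc]. Qed.
Lemma jcM F G : jc F -> jc G -> jc (fun h s => F h s * G h s).
Proof. by move=> Fc Gc p; apply: contM; [exact: Fc|exact: Gc]. Qed.
Lemma jcN F : jc F -> jc (fun h s => - F h s).
Proof. by move=> Fc p; apply: contN; exact: Fc. Qed.
Lemma jcC (c : R) : jc (fun _ _ => c).
Proof. by move=> p; exact: contC. Qed.

Lemma jc_comp (f : R -> R) F : continuous f -> jc F -> jc (fun h s => f (F h s)).
Proof.
move=> fc Fc p.
by apply: (cont_comp (f := f) (g := fun q : R * R => F q.1 q.2)); [exact: fc|exact: Fc].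
Qed.

Lemma jc_snd (f : R -> R) : continuous f -> jc (fun _ s => f s).
Proof.
move=> fc p; apply: (cont_comp (f := f) (g := snd)); first exact: fc.
exact: cvg_snd.
Qed.

Lemma jc_fst (f : R -> R) : continuous f -> jc (fun h _ => f h).
Proof.
move=> fc p; apply: (cont_comp (f := f) (g := fst)); first exact: fc.
exact: cvg_fst.
Qed.

Lemma scale_le (xi s T : R) : 0 <= xi <= 1 -> `|s| <= T -> `|xi * s| <= T.
Proof.
move=> /andP[xi0 xi1] sT; rewrite normrM ger0_norm//.
by apply: le_trans sT; rewrite ler_piMl.
Qed.

Lemma jc_avg F : jc F -> jc (fun h => avg (F h)).
Proof.
move=> Fc; apply: unif_jc; first by move=> h; apply: avg_continuous; exact: jc_section.
move=> h0 T e e0; have [d d0 dP] := jc_unif h0 T Fc e0; exists d => // h hd s sT.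
rewrite -avgB; [|exact: jc_section|exact: jc_section].
apply: avg_bound; last by move=> xi xi01; apply: dP => //; exact: scale_le.
by apply: contR => t; apply: contB; exact: jc_section.
Qed.

Lemma avg1_continuous (k : R -> R) : continuous k -> continuous (avg1 k).
Proof.
move=> kc; apply: contR => s; have [->|s0] := eqVneq s 0.
  exact: avg1_continuous0.
have c1 : {for s, continuous (fun t : R => prim (fun r => r * k r) t * (t ^+ 2)^-1)}.
  apply: contM; first exact: is_derive_continuous (prim_der s (continuous_idM kc)).
  apply: contV; first by rewrite expf_neq0.
  exact: exprn_continuous.
apply: near_eq_cont c1; near=> t; rewrite /avg1 ifF//; apply/negbTE.
by near: t; exact: neq0_near.
Unshelve. all: by end_near. Qed.

Lemma jc_avg1 F : jc F -> jc (fun h => avg1 (F h)).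
Proof.
move=> Fc; apply: unif_jc; first by move=> h; apply: avg1_continuous; exact: jc_section.
move=> h0 T e e0; have [d d0 dP] := jc_unif h0 T Fc e0; exists d => // h hd s sT.
rewrite -avg1B; [|exact: jc_section|exact: jc_section].
apply: avg1_bound; last by move=> xi xi01; apply: dP => //; exact: scale_le.
by apply: contR => t; apply: contB; exact: jc_section.
Qed.

Lemma der_of_small (f : R -> R) (h0 l : R) :
  (forall e, 0 < e -> exists2 d : R, 0 < d & forall h, `|h - h0| < d ->
    `|f h - f h0 - (h - h0) * l| <= e * `|h - h0|) ->
  is_derive h0 1 f l.
Proof.
move=> fl; apply/is_derive1_caratheodory.
exists (fun h => if h == h0 then l else (f h - f h0) / (h - h0)); split.
- move=> h; case: eqP => [->|/eqP hh]; first by rewrite !subrr mulr0.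
  by rewrite divfK// subr_eq0.
- apply/cont_realP => e e0; rewrite eqxx.
  have [|d d0 dP] := fl (e / 2); first by rewrite divr_gt0.
  exists d => // h hd; case: eqP => [_|/eqP hh]; first by rewrite subrr normr0.
  have hh0 : h - h0 != 0 by rewrite subr_eq0.
  have -> : (f h - f h0) / (h - h0) - l =
    (f h - f h0 - (h - h0) * l) / (h - h0) by field.
  rewrite normrM normfV ltr_pdivrMr ?normr_gt0//.
  apply: le_lt_trans (dP h hd) _; rewrite ltr_pM2r ?normr_gt0//.
  by lra.
- by rewrite eqxx.
Qed.
End TwoVariables.

(** * Dependence of the radial solutions on the height *)

(* In the variable [s = 1 - cos t], where [t] is the distance to the pole, a
   radial solution of [Lap u + g(u) = 0] solves [(s (2 - s) y')' = - g(y)],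
   i.e. [y' = - avg (g \o y) / (2 - s)], which is no longer singular at
   [s = 0]. The coefficient [1 / (2 - s)] is truncated to make it global. *)
Section Family.
Variables (R : realType) (g g1 : R -> R) (L eps : R).
Implicit Types (s t h u v T e d : R).
Hypothesis g_der : forall x : R, is_derive x 1 g (g1 x).
Hypothesis g1_cont : continuous g1.
Hypothesis g1_bound : forall x, `|g1 x| <= L.
Hypothesis eps_gt0 : 0 < eps.

Definition coef (s : R) : R := (Num.max (2 - s) eps)^-1.

Let max_gt0 s : 0 < Num.max (2 - s) eps.
Proof. by rewrite lt_max eps_gt0 orbT. Qed.
Lemma coef_cont : continuous coef.
Proof.
apply: contR => s; apply: contV; first by rewrite gt_eqF.
apply: (@continuous_max R R (fun s => 2 - s) (fun=> eps)); last exact: contC.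
by apply: contB; [exact: contC|exact: cvg_id].
Qed.

Lemma coef_ge0 s : 0 <= coef s. Proof. by rewrite invr_ge0 ltW. Qed.

Lemma coef_bound s : `|coef s| <= eps^-1.
Proof. by rewrite ger0_norm ?coef_ge0// lef_pV2 ?posrE// le_max lexx orbT. Qed.

Lemma coefE s : s < 2 - eps -> coef s = (2 - s)^-1.
Proof. by move=> s2; rewrite /coef max_l//; lra. Qed.

Lemma coef_der s : s < 2 - eps -> is_derive s 1 coef (coef s ^+ 2).
Proof.
move=> s2; rewrite coefE//.
have s20 : 2 - s != 0 by rewrite gt_eqF//; move: eps_gt0; lra.
apply: (@near_eq_is_derive R R R (fun t : R => (2 - t)^-1)).
  by near=> t; rewrite coefE//; near: t; exact: near_ltr.
apply: is_derive_eq (derV (f := fun t : R => 2 - t) s20 (derB (derC 2 s) (derI s))) _.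
by rewrite sub0r opprK mul1r exprVn.
Unshelve. all: by end_near. Qed.

Let L0 : 0 <= L. Proof. exact: le_trans (normr_ge0 _) (g1_bound 0). Qed.

Lemma g_cont : continuous g.
Proof. by move=> x; exact: is_derive_continuous (g_der x). Qed.

Lemma g_mvt (u v : R) : exists2 w, `|w - v| <= `|u - v| & g u - g v = g1 w * (u - v).
Proof.
have [|xi xi01 /=] := @mvt0 R (fun t => g (v + t)) (fun t => g1 (v + t) * 1) (u - v).
  move=> xi _; apply: is_derive_eq (der_comp (f := g) (g := fun t : R => v + t) (g_der _)
    (derD (derC v _) (derI _))) _.
  by rewrite add0r.
rewrite addr0 mulr1 (addrC v) subrK => ->; exists (v + xi * (u - v)) => //.
by rewrite addrC addKr scale_le.
Qed.

Lemma g_lip (u v : R) : `|g u - g v| <= L * `|u - v|.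
Proof. by have [w _ ->] := g_mvt u v; rewrite normrM ler_wpM2r. Qed.

Lemma Y_exists (h : R) : exists y : R -> R, [/\ continuous y, y 0 = h &
  forall s, is_derive s 1 y (- (coef s * avg (fun r => g (y r)) s))].
Proof.
apply: (@volterra_solution R (fun _ => g) coef L eps^-1 `|g h| h) => //.
- by move=> y yc; apply: contR => s; apply: cont_comp; [exact: g_cont|exact: yc].
- by move=> _; exact: g_lip.
- exact: coef_cont.
- exact: coef_bound.
Qed.

Definition Y (h : R) : R -> R := sval (cid (Y_exists h)).

Lemma Y_cont h : continuous (Y h).
Proof. by rewrite /Y; case: cid => y []. Qed.

Lemma Y0 h : Y h 0 = h.
Proof. by rewrite /Y; case: cid => y []. Qed.

Definition W (h s : R) : R := - (coef s * avg (fun r => g (Y h r)) s).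

Lemma Y_der_s h s : is_derive s 1 (Y h) (W h s).
Proof. by rewrite /W /Y; case: cid => y []. Qed.

(** The equation of [Y_exists] linearized along [Y h]; [Y_der_h] shows that its solution is the
    derivative of [Y] in [h]. *)
Lemma Z_exists (h : R) : exists z : R -> R, [/\ continuous z, z 0 = 1 &
  forall s, is_derive s 1 z (- (coef s * avg (fun r => g1 (Y h r) * z r) s))].
Proof.
apply: (@volterra_solution R (fun s z => g1 (Y h s) * z) coef L eps^-1 L 1) => //.
- move=> y yc; apply: contR => s; apply: contM; last exact: yc.
  by apply: cont_comp; [exact: g1_cont|exact: Y_cont].
- by move=> s u v; rewrite -mulrBr normrM ler_wpM2r.
- exact: coef_cont.
- exact: coef_bound.
- by move=> s; rewrite mulr1.
Qed.

Definition Z (h : R) : R -> R := sval (cid (Z_exists h)).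

Lemma Z_cont h : continuous (Z h).
Proof. by rewrite /Z; case: cid => y []. Qed.

Lemma Z0 h : Z h 0 = 1.
Proof. by rewrite /Z; case: cid => y []. Qed.

Definition V (h s : R) : R := - (coef s * avg (fun r => g1 (Y h r) * Z h r) s).

Lemma Z_der_s h s : is_derive s 1 (Z h) (V h s).
Proof. by rewrite /V /Z; case: cid => y []. Qed.

(** [avg k t] is the value of [k] at some [xi * t], which is why [gronwall] is stated with an
    earlier point on the right-hand side. *)
Lemma coef_gronwall (D k : R -> R) (d T s : R) : 0 <= d -> continuous k ->
  (forall t, is_derive t 1 D (- (coef t * avg k t))) ->
  (forall t, `|t| <= T -> `|k t| <= L * `|D t| + d) -> `|s| <= T ->
  `|D s| <= 2 * (`|D 0| + eps^-1 * d * T) * expR (2 * ((eps^-1 * L + 1) * (T + 1))).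
Proof.
move=> d0 kc Dd kb sT.
have e0 : 0 < eps^-1 by rewrite invr_gt0.
have K0 : 0 < eps^-1 * L + 1 by rewrite ltr_wpDl// mulr_ge0// ltW.
have T0 : 0 <= T by exact: le_trans sT.
have d'0 : 0 <= eps^-1 * d by rewrite mulr_ge0// ltW.
apply: le_trans (gronwall (dD := fun t => - (coef t * avg k t)) (d := eps^-1 * d)
    (s := s) K0 d'0 _ _) _.
- move=> t t01; have [xi xi01 e] := avg_mean (t * s) kc.
  exists xi => //; rewrite normrN normrM e.
  apply: le_trans (ler_pM _ _ (coef_bound _) (kb _ _)) _ => //.
    by rewrite !scale_le.
  by rewrite mulrDr lerD2r (mulrA eps^-1) mulrDl lerDl mul1r.
- apply: ler_pM.
  + by rewrite mulr_ge0// addr_ge0// mulr_ge0.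
  + exact: expR_ge0.
  + by rewrite ler_pM2l// lerD2l ler_wpM2l.
  + by rewrite ler_expR ler_pM2l// ler_pM2l// lerD2r.
Qed.

Let M (T : R) : R := expR (2 * ((eps^-1 * L + 1) * (T + 1))).
Let M_gt0 T : 0 < M T. Proof. exact: expR_gt0. Qed.

Let gY_cont h : continuous (fun r => g (Y h r)).
Proof. by apply: contR => s; apply: cont_comp; [exact: g_cont|exact: Y_cont]. Qed.

Let g1YZ_cont h : continuous (fun r => g1 (Y h r) * Z h r).
Proof.
apply: contR => s; apply: contM; last exact: Z_cont.
by apply: cont_comp; [exact: g1_cont|exact: Y_cont].
Qed.

Lemma Y_lip h h0 T s : `|s| <= T -> `|Y h s - Y h0 s| <= 2 * `|h - h0| * M T.
Proof.
move=> sT.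
have := @coef_gronwall (fun s => Y h s - Y h0 s) (fun s => g (Y h s) - g (Y h0 s)) 0 T s.
rewrite !Y0 mulr0 mul0r addr0; apply => //.
- by apply: contR => t; apply: contB; exact: gY_cont.
- move=> t; apply: is_derive_eq (derB (Y_der_s h t) (Y_der_s h0 t)) _.
  rewrite avgB; [|exact: gY_cont|exact: gY_cont].
  by rewrite /W; ring.
- by move=> t _; rewrite addr0; exact: g_lip.
Qed.

Lemma Y_jc : jc Y.
Proof.
apply: unif_jc; first exact: Y_cont.
move=> h0 T e e0; exists (e / (2 * M T)); first by rewrite divr_gt0// mulr_gt0.
move=> h hd s sT; apply: le_trans (Y_lip h h0 sT) _.
by move: hd; rewrite ltr_pdivlMr ?mulr_gt0// => /ltW; rewrite mulrCA mulrA.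
Qed.

Lemma gY_jc : jc (fun h s => g (Y h s)).
Proof. by apply: jc_comp; [exact: g_cont|exact: Y_jc]. Qed.

Lemma g1Y_jc : jc (fun h s => g1 (Y h s)).
Proof. by apply: jc_comp; [exact: g1_cont|exact: Y_jc]. Qed.

Lemma W_jc : jc W.
Proof.
apply: jcN; apply: jcM; first exact: jc_snd coef_cont.
exact: jc_avg gY_jc.
Qed.

Lemma Z_jc : jc Z.
Proof.
apply: unif_jc; first exact: Z_cont.
move=> h0 T e e0.
pose c := eps^-1 * (`|T| + 1); have c0 : 0 < c.
  by rewrite mulr_gt0 ?invr_gt0// ltr_wpDl.
have c2M : 0 < 2 * c * M T by exact: mulr_gt0 (mulr_gt0 (ltr0Sn _ 1) c0) (M_gt0 T).
pose d := e / (2 * c * M T).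
have d0 : 0 < d by exact: divr_gt0.
have [|dl dl0 dlP] := @jc_unif R (fun h s => g1 (Y h s) * Z h0 s) h0 T d _ d0.
  by apply: jcM; [exact: g1Y_jc|exact: jc_snd (@Z_cont h0)].
exists dl => // h hd s sT.
have Hg := @coef_gronwall (fun s => Z h s - Z h0 s)
  (fun s => g1 (Y h s) * Z h s - g1 (Y h0 s) * Z h0 s) d T s (ltW d0) _ _ _ sT.
rewrite !Z0 subrr normr0 add0r in Hg; apply: le_trans (Hg _ _ _) _.
- by apply: contR => t; apply: contB; exact: g1YZ_cont.
- move=> t; apply: is_derive_eq (derB (Z_der_s h t) (Z_der_s h0 t)) _.
  rewrite avgB; [|exact: g1YZ_cont|exact: g1YZ_cont].
  by rewrite /V; ring.
- move=> t tT.
  have -> : g1 (Y h t) * Z h t - g1 (Y h0 t) * Z h0 t =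
    g1 (Y h t) * (Z h t - Z h0 t) + (g1 (Y h t) * Z h0 t - g1 (Y h0 t) * Z h0 t) by ring.
  apply: le_trans (ler_normD _ _) _; apply: lerD; last exact: dlP.
  by rewrite normrM ler_wpM2r.
- rewrite -/(M T).
  have -> : e = 2 * (c * d) * M T by rewrite /d; field; rewrite !gt_eqF.
  rewrite ler_pM2r// ler_pM2l// mulrAC ler_pM2r//.
  rewrite ler_pM2l ?invr_gt0//; have := ler_norm T; lra.
Qed.

Lemma V_jc : jc V.
Proof.
apply: jcN; apply: jcM; first exact: jc_snd coef_cont.
by apply: jc_avg; apply: jcM; [exact: g1Y_jc|exact: Z_jc].
Qed.

(** The remainder [Y h - Y h0 - (h - h0) Z h0] solves the linearized equation up to a source that is
    [o(h - h0)], because [g1] is continuous and [Y] Lipschitz in [h]; Gronwall does the rest.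
    Uniformity in [s] is what allows the second expansion to be averaged in [W_der_h]. *)
Lemma gY_expand h0 T e : 0 < e -> exists2 d : R, 0 < d & forall h, `|h - h0| < d ->
  (forall s, `|s| <= T -> `|Y h s - Y h0 s - (h - h0) * Z h0 s| <= e * `|h - h0|) /\
  (forall s, `|s| <= T ->
    `|g (Y h s) - g (Y h0 s) - (h - h0) * (g1 (Y h0 s) * Z h0 s)| <= e * `|h - h0|).
Proof.
move=> e0.
pose c := eps^-1 * (`|T| + 1); have c0 : 0 < c.
  by rewrite mulr_gt0 ?invr_gt0// ltr_wpDl.
have L1 : 0 < L + 1 by rewrite ltr_wpDl.
(* The expansion of [g (Y h)] costs [L] times that of [Y] plus the source, in total
   [L * e' + e' = e]. The second bound in [d] absorbs the factor from Gronwall's inequality. *)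
pose e' := e / (L + 1); have e'0 : 0 < e' by rewrite divr_gt0.
have c2M : 0 < 2 * c * M T by exact: mulr_gt0 (mulr_gt0 (ltr0Sn _ 1) c0) (M_gt0 T).
pose d := Num.min e' (e' / (2 * c * M T)).
have d0 : 0 < d by rewrite lt_min e'0; exact: divr_gt0.
have [|dl dl0 dlP] := @jc_unif R (fun u s => g1 (Y h0 s + u) * Z h0 s) 0 T d _ d0.
  apply: jcM; last exact: jc_snd (@Z_cont h0).
  apply: jc_comp => //; apply: jcD; first exact: jc_snd (@Y_cont h0).
  by apply: jc_fst; apply: contR => x; exact: cvg_id.
exists (dl / (2 * M T)); first by rewrite divr_gt0// mulr_gt0.
move=> h; rewrite ltr_pdivlMr ?mulr_gt0// => hd.
have k_bound t : `|t| <= T ->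
    `|g (Y h t) - g (Y h0 t) - (h - h0) * (g1 (Y h0 t) * Z h0 t)| <=
    L * `|Y h t - Y h0 t - (h - h0) * Z h0 t| + d * `|h - h0|.
  move=> tT; have [w wY ->] := g_mvt (Y h t) (Y h0 t).
  have -> : g1 w * (Y h t - Y h0 t) - (h - h0) * (g1 (Y h0 t) * Z h0 t) =
    g1 w * (Y h t - Y h0 t - (h - h0) * Z h0 t) +
    (g1 w * Z h0 t - g1 (Y h0 t) * Z h0 t) * (h - h0) by ring.
  apply: le_trans (ler_normD _ _) _; apply: lerD; first by rewrite normrM ler_wpM2r.
  rewrite normrM ler_wpM2r//.
  have H := dlP (w - Y h0 t) _ t tT.
  rewrite (addrC (Y h0 t)) subrK addr0 subr0 in H; apply: H.
  apply: le_lt_trans wY _; apply: le_lt_trans (Y_lip h h0 tT) _.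
  by rewrite [2 * _]mulrC -mulrA.
have D_bound s : `|s| <= T ->
    `|Y h s - Y h0 s - (h - h0) * Z h0 s| <= e' * `|h - h0|.
  move=> sT.
  have Hg := @coef_gronwall (fun s => Y h s - Y h0 s - (h - h0) * Z h0 s)
    (fun s => g (Y h s) - g (Y h0 s) - (h - h0) * (g1 (Y h0 s) * Z h0 s))
    (d * `|h - h0|) T s _ _ _ _ sT.
  rewrite !Y0 Z0 mulr1 subrr normr0 add0r in Hg; apply: le_trans (Hg _ _ _ _) _.
  - by rewrite mulr_ge0// ltW.
  - apply: contR => t; apply: contB; first by apply: contB; exact: gY_cont.
    by apply: contM; [exact: contC|exact: g1YZ_cont].
  - move=> t; apply: is_derive_eq (derB (derB (Y_der_s h t) (Y_der_s h0 t))
      (derM (derC (h - h0) t) (Z_der_s h0 t))) _.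
    have cc : continuous (fun t => (h - h0) * (g1 (Y h0 t) * Z h0 t)).
      by apply: contR => x; apply: contM; [exact: contC|exact: g1YZ_cont].
    rewrite avgB//; last first.
      by apply: contR => x; apply: contB; exact: gY_cont.
    rewrite avgB; [|exact: gY_cont|exact: gY_cont].
    rewrite avgZ; last exact: g1YZ_cont.
    by rewrite /W /V; ring.
  - exact: k_bound.
  - rewrite -/(M T).
    have d2 : d <= e' / (2 * c * M T) by rewrite ge_min lexx orbT.
    have cT : eps^-1 * T <= c.
      by rewrite ler_pM2l ?invr_gt0//; have := ler_norm T; lra.
    have -> : 2 * (eps^-1 * (d * `|h - h0|) * T) * M T =
      (2 * M T) * (eps^-1 * T) * d * `|h - h0| by ring.
    rewrite ler_wpM2r//.
    apply: le_trans (_ : (2 * M T) * c * (e' / (2 * c * M T)) <= _); last first.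
      by rewrite le_eqVlt; apply/orP; left; apply/eqP; field; rewrite !gt_eqF.
    apply: (@le_trans _ _ ((2 * M T) * c * d)).
      by rewrite ler_pM2r// ler_pM2l// mulr_gt0.
    have -> : 2 * M T * c = 2 * c * M T by ring.
    by rewrite ler_pM2l.
have ee' : e' <= e by rewrite ler_pdivrMr// ler_pMr// lerDr.
split=> s sT.
  by apply: le_trans (D_bound s sT) _; rewrite ler_wpM2r.
apply: le_trans (k_bound s sT) _.
have -> : e * `|h - h0| = L * (e' * `|h - h0|) + e' * `|h - h0|.
  by rewrite /e'; field; rewrite gt_eqF.
apply: lerD; first by rewrite ler_wpM2l// D_bound.
by rewrite ler_wpM2r// ge_min lexx.
Qed.

Lemma Y_der_h h s : is_derive h 1 (Y ^~ s) (Z h s).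
Proof.
apply: der_of_small => e e0; have [d d0 dP] := gY_expand h `|s| e0.
by exists d => // h' /dP[+ _]; apply.
Qed.

Lemma W_der_h h s : is_derive h 1 (W ^~ s) (V h s).
Proof.
apply: der_of_small => e e0.
have [d d0 dP] := gY_expand h `|s| (mulr_gt0 e0 eps_gt0).
exists d => // h' /dP[_ k_small].
have cc : continuous (fun t => (h' - h) * (g1 (Y h t) * Z h t)).
  by apply: contR => x; apply: contM; [exact: contC|exact: g1YZ_cont].
have cB : continuous (fun t => g (Y h' t) - g (Y h t)).
  by apply: contR => x; apply: contB; exact: gY_cont.
have -> : W h' s - W h s - (h' - h) * V h s =
    - (coef s * avg (fun t => g (Y h' t) - g (Y h t) -
                     (h' - h) * (g1 (Y h t) * Z h t)) s).
  rewrite avgB// avgB; [|exact: gY_cont|exact: gY_cont].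
  rewrite avgZ; last exact: g1YZ_cont.
  by rewrite /W /V; ring.
rewrite normrN normrM.
have -> : e * `|h' - h| = eps^-1 * (e * eps * `|h' - h|) by field; rewrite gt_eqF.
apply: ler_pM => //; first exact: coef_bound.
apply: avg_bound; first by apply: contR => x; apply: contB; [exact: cB|exact: cc].
by move=> xi xi01; apply: k_small; exact: scale_le.
Qed.

(** The product rule applied to [W], with [coef ^ 2] for the derivative of [coef]. As an explicit
    formula it is jointly continuous everywhere, including at the pole [s = 0]. *)
Definition Q (h s : R) : R :=
  - (coef s ^+ 2 * avg (fun r => g (Y h r)) s +
     coef s * avg1 (fun r => g1 (Y h r) * W h r) s).

Let g1YW_cont h : continuous (fun r => g1 (Y h r) * W h r).
Proof. exact: (@jc_section R (fun h r => g1 (Y h r) * W h r) h (jcM g1Y_jc W_jc)). Qed.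

Lemma Q_jc : jc Q.
Proof.
have c_jc : jc (fun _ s => coef s) by exact: jc_snd coef_cont.
apply: jcN; apply: jcD.
  by apply: jcM; [exact: jcM|exact: jc_avg gY_jc].
by apply: jcM => //; apply: jc_avg1; apply: jcM; [exact: g1Y_jc|exact: W_jc].
Qed.

Lemma gY_der_s h s : is_derive s 1 (fun r => g (Y h r)) (g1 (Y h s) * W h s).
Proof. exact: (der_comp (g_der _) (Y_der_s h s)). Qed.

Lemma W_der_s h s : s < 2 - eps -> is_derive s 1 (W h) (Q h s).
Proof.
move=> s2.
have H := derN (derM (coef_der s2) (avg_der s (@g1YW_cont h) (gY_der_s h))).
exact: H.
Qed.

Lemma Q_ode h s : s < 2 - eps ->
  s * (2 - s) * Q h s = 2 * (s - 1) * W h s - g (Y h s).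
Proof.
move=> s2; have s20 : 2 - s != 0 by rewrite gt_eqF//; move: eps_gt0; lra.
have sA : s * avg1 (fun r => g1 (Y h r) * W h r) s =
    g (Y h s) - avg (fun r => g (Y h r)) s.
  have [->|s0] := eqVneq s 0; first by rewrite mul0r avg0 subrr.
  apply: (mulfI s0); rewrite mulrA -expr2 mulr_avg1; last exact: g1YW_cont.
  rewrite (prim_idM s (@g1YW_cont h) (gY_der_s h)) mulrBr mulr_avg//.
rewrite /Q /W coefE//.
have -> : s * (2 - s) * - ((2 - s)^-1 ^+ 2 * avg (fun r => g (Y h r)) s +
    (2 - s)^-1 * avg1 (fun r => g1 (Y h r) * W h r) s) =
  - (s * (2 - s)^-1 * avg (fun r => g (Y h r)) s +
    s * avg1 (fun r => g1 (Y h r) * W h r) s) by field.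
by rewrite sA; field.
Qed.

Lemma V_ode h s : s < 2 - eps ->
  is_derive s 1 (fun t => t * (2 - t) * V h t) (- (g1 (Y h s) * Z h s)).
Proof.
move=> s2; apply: (@near_eq_is_derive R R R (fun t : R => - prim (fun r => g1 (Y h r) * Z h r) t)).
  near=> t; have t2 : t < 2 - eps by near: t; exact: near_ltr.
  have t20 : 2 - t != 0 by rewrite gt_eqF//; move: eps_gt0; lra.
  rewrite /V coefE// -mulr_avg; last exact: g1YZ_cont.
  by field.
exact: (derN (prim_der s (@g1YZ_cont h))).
Unshelve. all: by end_near. Qed.

End Family.

(** * C^1 maps and the implicit function theorem *)

Section C1maps.
Variable R : realType.
Implicit Types (U V W : normedModType R).

Lemma is_diff_of_small V W (f : V -> W) (x : V) (df : {linear V -> W}) :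
  continuous df ->
  (forall e : R, 0 < e ->
    \forall y \near x, `|f y - f x - df (y - x)| <= e * `|y - x|) ->
  is_diff x f df.
Proof.
move=> dfc fs.
have H : f \o shift x = cst (f x) + df +o_ 0 id.
  apply/eqaddoP => e /fs /nbhs_ballP[d /= d0 dP]; apply/nbhs_ballP; exists d => //= y.
  rewrite -ball_normE /= sub0r normrN => yd.
  have := dP (x + y); rewrite (addrC x) addrK opprD addrA; apply.
  by rewrite -ball_normE /= opprD addrCA subrr addr0 normrN.
have E := diff_unique dfc H.
by apply: DiffDef => //; apply/diff_locallyP; rewrite E.
Qed.

Lemma is_diff_small V W (f df : V -> W) (x : V) : is_diff x f df ->
  forall e : R, 0 < e ->
    \forall y \near x, `|f y - f x - df (y - x)| <= e * `|y - x|.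
Proof.
move=> [fd <-] e e0.
have /diff_locally /eqaddoP /(_ e e0) /nbhs_ballP[d /= d0 dP] := fd.
apply/nbhs_ballP; exists d => //= y; rewrite -ball_normE /= => yd.
have := dP (y - x); rewrite -ball_normE /= sub0r normrN distrC => /(_ yd).
by rewrite !fctE /= subrK opprD addrA.
Qed.

(* Continuity of the differential jointly in the point and the direction
   amounts, in finite dimension, to continuity of all directional
   derivatives, and is stable under composition. *)
Definition c1_at V W (g : V -> W) (x : V) : Prop :=
  differentiable g x /\
  forall v, {for ((x, v) : V * V), continuous (fun z : V * V => 'd g (z.1) (z.2))}.

Definition c1 V W (g : V -> W) (x : V) : Prop := \forall y \near x, c1_at g y.

Lemma c1_near V W (g : V -> W) (x : V) : c1 g x -> \forall y \near x, c1 g y.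
Proof. exact: near_join. Qed.

Lemma c1_diff V W (g : V -> W) (x : V) : c1 g x -> differentiable g x.
Proof. by move=> /nbhs_singleton[]. Qed.

Lemma c1_cont V W (g : V -> W) (x : V) : c1 g x -> {for x, continuous g}.
Proof. by move=> /c1_diff; exact: differentiable_continuous. Qed.

Lemma nearP1 U V (P : U -> Prop) (x : U) (v : V) : (\forall y \near x, P y) ->
  \forall z \near ((x, v) : U * V), P z.1.
Proof. by move=> H; apply: (cvg_fst H). Qed.

Lemma near_eq_cont_at (T S : topologicalType) (f g : T -> S) (x : T) :
  (\forall t \near x, f t = g t) -> {for x, continuous f} -> {for x, continuous g}.
Proof.
move=> fg fc; rewrite /prop_for /continuous_at -(nbhs_singleton fg).
by apply: cvg_trans fc; apply: near_eq_cvg.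
Qed.

Lemma continuous_comp_at (S T X : topologicalType) (f : T -> X) (g : S -> T) (x : S) :
  {for g x, continuous f} -> {for x, continuous g} ->
  {for x, continuous (fun t => f (g t))}.
Proof. by move=> fc gc; exact: continuous_comp. Qed.

Lemma c1_intro V W (g : V -> W) (dg : V -> V -> W) (x : V) :
  (\forall y \near x, is_diff y g (dg y) /\
    forall v, {for ((y, v) : V * V), continuous (fun z : V * V => dg z.1 z.2)}) ->
  c1 g x.
Proof.
move=> H; rewrite /c1.
near=> y.
have [gd dgc] : is_diff y g (dg y) /\
    forall v, {for ((y, v) : V * V), continuous (fun z : V * V => dg z.1 z.2)}.
  by near: y.
split; first exact: ex_diff.
move=> v; apply: near_eq_cont_at (dgc v).
have Hy : \forall z \near y, is_diff z g (dg z).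
  by near: y; apply: near_join; apply: filterS H => z [].
by apply: filterS (nearP1 v Hy) => z /= zd; rewrite diff_val.
Unshelve. all: by end_near. Qed.

Lemma near_eq_diff V W (f g : V -> W) (x : V) (df : V -> W) :
  (\forall y \near x, f y = g y) -> is_diff x f df -> is_diff x g df.
Proof.
move=> fg fd; have fgx := nbhs_singleton fg.
have dfE : 'd f x = df :> (V -> W) by exact: diff_val.
rewrite -dfE.
have dc : continuous ('d f x) by apply: diff_continuous; exact: ex_diff.
apply: is_diff_of_small => // e e0.
have := is_diff_small fd e0; apply: filterS2 fg => y fgy.
by rewrite -fgy -fgx dfE.
Qed.

Lemma near_eq_c1 V W (f g : V -> W) (x : V) :
  (\forall y \near x, f y = g y) -> c1 f x -> c1 g x.
Proof.
move=> fg fc; apply: (@c1_intro _ _ _ (fun y => 'd f y)).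
near=> y; have [fd fcc] : c1_at f y by near: y.
split; last exact: fcc.
by apply: (@near_eq_diff _ _ f g); [near: y; exact: near_join|exact: differentiableP].
Unshelve. all: by end_near. Qed.

Lemma c1_comp U V W (f : U -> V) (g : V -> W) (x : U) :
  c1 f x -> c1 g (f x) -> c1 (fun y => g (f y)) x.
Proof.
move=> fc gc; apply: (@c1_intro _ _ _ (fun y v => 'd g (f y) ('d f y v))).
have gc' : \forall y \near x, c1_at g (f y) by exact: (c1_cont fc gc).
near=> y.
have [fd fcy] : c1_at f y by near: y.
have [gd gcy] : c1_at g (f y) by near: y.
split.
  apply: DiffDef; first exact: differentiable_comp.
  by rewrite (diff_comp fd gd).
move=> v.
apply: (@continuous_comp_at _ _ _ (fun z : V * V => 'd g (z.1) (z.2))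
  (fun z : U * U => (f z.1, 'd f (z.1) (z.2)))) => /=; first exact: gcy.
apply: cvg_pair => /=; last exact: fcy.
apply: (@cvg_comp _ _ _ fst f _ (nbhs y)); first exact: cvg_fst.
exact: differentiable_continuous.
Unshelve. all: by end_near. Qed.

Lemma c1_pair U V W (f : U -> V) (g : U -> W) (x : U) :
  c1 f x -> c1 g x -> c1 (fun y => (f y, g y)) x.
Proof.
move=> fc gc; apply: (@c1_intro _ _ _ (fun y v => ('d f y v, 'd g y v))).
near=> y.
have [fd fcy] : c1_at f y by near: y.
have [gd gcy] : c1_at g y by near: y.
split; last by move=> v; apply: cvg_pair; [exact: fcy|exact: gcy].
by apply: is_diff_pair; exact: differentiableP.
Unshelve. all: by end_near. Qed.

Lemma c1_linear V W (f : {linear V -> W}) (x : V) : continuous f -> c1 f x.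
Proof.
move=> fc; apply: (@c1_intro _ _ _ (fun _ => f)); near=> y; split.
  by apply: DiffDef; [exact: linear_differentiable|exact: diff_lin].
move=> v; apply: (@cvg_comp _ _ _ snd f _ (nbhs v)); first exact: cvg_snd.
exact: fc.
Unshelve. all: by end_near. Qed.

Lemma c1_linear_fun V W (f : V -> W) (x : V) :
  linear f -> continuous f -> c1 f x.
Proof.
move=> fl fc.
pose fM := GRing.isLinear.Build _ _ _ _ _ fl.
pose fL : {linear V -> W} := HB.pack f fM.
exact: (@c1_linear _ _ fL).
Qed.

Lemma c1_cst V W (w : W) (x : V) : c1 (fun=> w) x.
Proof.
apply: (@c1_intro _ _ _ (fun _ _ => 0)); near=> y; split; last by move=> v; exact: cvg_cst.
exact: is_diff_cst.
Unshelve. all: by end_near. Qed.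

Lemma c1_id V (x : V) : c1 (fun y : V => y) x.
Proof. by apply: c1_linear_fun => // y; exact: cvg_id. Qed.

Lemma c1_fst V W (x : V * W) : c1 (fun p : V * W => p.1) x.
Proof. by apply: c1_linear_fun => // y; exact: cvg_fst. Qed.

Lemma c1_snd V W (x : V * W) : c1 (fun p : V * W => p.2) x.
Proof. by apply: c1_linear_fun => // y; exact: cvg_snd. Qed.

Lemma c1_comp_fst U V W (f : V -> W) (p : V * U) :
  c1 f p.1 -> c1 (fun q : V * U => f q.1) p.
Proof. by move=> fc; apply: (c1_comp (f := fun q : V * U => q.1)); [exact: c1_fst|]. Qed.

Lemma c1D V W (f g : V -> W) (x : V) : c1 f x -> c1 g x -> c1 (fun y => f y + g y) x.
Proof.
move=> fc gc.
apply: (c1_comp (f := fun y => (f y, g y)) (g := fun p : W * W => p.1 + p.2)).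
  exact: c1_pair.
apply: c1_linear_fun => [a u v /=|p]; last exact: add_continuous.
by rewrite scalerDr addrACA.
Qed.

Lemma c1Zr V W (f : V -> W) (c : R) (x : V) : c1 f x -> c1 (fun y => c *: f y) x.
Proof.
move=> fc; apply: (c1_comp (g := fun w : W => c *: w)) => //.
apply: c1_linear_fun => [a u v /=|p]; last exact: scaler_continuous.
by rewrite scalerDr !scalerA mulrC.
Qed.

Lemma c1N V W (f : V -> W) (x : V) : c1 f x -> c1 (fun y => - f y) x.
Proof.
move=> /(c1Zr (-1)); apply: near_eq_c1.
by apply: nearW => y; rewrite scaleN1r.
Qed.

Lemma c1B V W (f g : V -> W) (x : V) : c1 f x -> c1 g x -> c1 (fun y => f y - g y) x.
Proof. by move=> fc gc; exact: (c1D fc (c1N gc)). Qed.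

Lemma c1_sum V W (I : Type) (r : seq I) (f : I -> V -> W) (x : V) :
  (forall i, c1 (f i) x) -> c1 (fun y => \sum_(i <- r) f i y) x.
Proof.
move=> fc; elim: r => [|i r IH].
  by apply: (near_eq_c1 _ (c1_cst 0 x)); apply: nearW => y; rewrite big_nil.
apply: (near_eq_c1 _ (c1D (fc i) IH)); apply: nearW => y.
by rewrite big_cons.
Qed.

Lemma c1_mul_at (p : R * R) : c1 (fun q : R * R => q.1 * q.2) p.
Proof.
apply: (@c1_intro _ _ _ (fun p q : R * R => p.1 * q.2 + q.1 * p.2)); near=> y; split.
  exact: is_diff_mulr.
move=> v; set z := (y, v).
have c11 : {for z, continuous (fun z : (R * R) * (R * R) => z.1.1)}.
  by apply: (@cvg_comp _ _ _ fst fst _ (nbhs y)); exact: cvg_fst.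
have c12 : {for z, continuous (fun z : (R * R) * (R * R) => z.1.2)}.
  by apply: (@cvg_comp _ _ _ fst snd _ (nbhs y)); [exact: cvg_fst|exact: cvg_snd].
have c21 : {for z, continuous (fun z : (R * R) * (R * R) => z.2.1)}.
  by apply: (@cvg_comp _ _ _ snd fst _ (nbhs v)); [exact: cvg_snd|exact: cvg_fst].
have c22 : {for z, continuous (fun z : (R * R) * (R * R) => z.2.2)}.
  by apply: (@cvg_comp _ _ _ snd snd _ (nbhs v)); exact: cvg_snd.
by apply: contD; apply: contM.
Unshelve. all: by end_near. Qed.

Lemma c1M V (f g : V -> R) (x : V) : c1 f x -> c1 g x -> c1 (fun y => f y * g y) x.
Proof.
move=> fc gc.
apply: (c1_comp (f := fun y => (f y, g y)) (g := fun p : R * R => p.1 * p.2)).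
  exact: c1_pair.
exact: c1_mul_at.
Qed.

Lemma c1_inv_at (x : R) : x != 0 -> c1 (fun y : R => y^-1) x.
Proof.
move=> x0; apply: (@c1_intro _ _ _ (fun y v : R => - y ^- 2 * v)); near=> y.
have y0 : y != 0 by near: y; exact: neq0_near.
split.
  by apply: DiffDef; [exact: differentiable_Rinv|rewrite diff_Rinv].
move=> v; apply: contM; last exact: cvg_snd.
apply: contN; apply: contV; first by rewrite expf_neq0.
apply: (@cvg_comp _ _ _ fst (fun y : R => y ^+ 2) _ (nbhs y)); first exact: cvg_fst.
exact: exprn_continuous.
Unshelve. all: by end_near. Qed.

Lemma c1V V (f : V -> R) (x : V) : f x != 0 -> c1 f x -> c1 (fun y => (f y)^-1) x.
Proof. by move=> f0 fc; apply: (c1_comp (g := fun y : R => y^-1)) => //; exact: c1_inv_at. Qed.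

Lemma c1_scale V W (f : V -> R) (w : W) (x : V) : c1 f x -> c1 (fun y => f y *: w) x.
Proof.
move=> fc; apply: (c1_comp (g := fun c : R => c *: w)) => //.
apply: c1_linear_fun => [a u v /=|p]; last exact: scalel_continuous.
by rewrite scalerDl scalerA.
Qed.

Lemma c1_mx V m n (f : 'I_m -> 'I_n -> V -> R) (x : V) :
  (forall i j, c1 (f i j) x) -> c1 (fun y => \matrix_(i, j) f i j y : 'M[R]_(m, n)) x.
Proof.
move=> fc; have H : c1 (fun y => \sum_i \sum_j f i j y *: (delta_mx i j : 'M[R]_(m, n))) x.
  by apply: c1_sum => i; apply: c1_sum => j; exact: c1_scale.
apply: near_eq_c1 H; apply: nearW => y.
rewrite [RHS]matrix_sum_delta; apply: eq_bigr => i _; apply: eq_bigr => j _.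
by rewrite mxE.
Qed.

Lemma c1_coord m n (i : 'I_m) (j : 'I_n) (x : 'M[R]_(m, n)) :
  c1 (fun y : 'M[R]_(m, n) => y i j) x.
Proof. by apply: c1_linear_fun => [a u v|p]; [rewrite !mxE|exact: coord_continuous]. Qed.

(** The increment is split into a step in each variable, each treated by the mean value theorem;
    continuity of the partial derivatives makes the error small. *)
Lemma c1_two (F Fh Fs : R -> R -> R) (h0 s0 d : R) : 0 < d ->
  (forall h s : R, `|h - h0| < d -> `|s - s0| < d ->
    [/\ is_derive h 1 (F ^~ s) (Fh h s), is_derive s 1 (F h) (Fs h s),
        {for ((h, s) : R * R), continuous (fun q : R * R => Fh q.1 q.2)} &
        {for ((h, s) : R * R), continuous (fun q : R * R => Fs q.1 q.2)}]) ->
  c1 (fun p : R * R => F p.1 p.2) (h0, s0).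
Proof.
move=> d0 H.
have {H} /near_join H : \forall p \near ((h0, s0) : R * R),
    [/\ is_derive p.1 (1 : R) (F ^~ p.2) (Fh p.1 p.2),
        is_derive p.2 (1 : R) (F p.1) (Fs p.1 p.2),
        {for ((p.1, p.2) : R * R), continuous (fun q : R * R => Fh q.1 q.2)} &
        {for ((p.1, p.2) : R * R), continuous (fun q : R * R => Fs q.1 q.2)}].
  apply/(near_real2P h0 s0 (fun h s => [/\ is_derive h 1 (F ^~ s) (Fh h s),
     is_derive s 1 (F h) (Fs h s),
     {for ((h, s) : R * R), continuous (fun q : R * R => Fh q.1 q.2)} &
     {for ((h, s) : R * R), continuous (fun q : R * R => Fs q.1 q.2)}])).
  by exists d.
apply: (@c1_intro _ _ _ (fun p v : R * R => Fh p.1 p.2 * v.1 + Fs p.1 p.2 * v.2)).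
apply: filterS H => -[h s] H; have [_ _ ch cs] := nbhs_singleton H.
split; last first.
  move=> v; set z := ((h, s), v).
  have c1' : {for z, continuous (fun z : (R * R) * (R * R) => Fh z.1.1 z.1.2)}.
    apply: (@cvg_comp _ _ _ fst (fun p : R * R => Fh p.1 p.2) _ (nbhs ((h, s) : R * R))).
      exact: cvg_fst.
    exact: ch.
  have c2' : {for z, continuous (fun z : (R * R) * (R * R) => Fs z.1.1 z.1.2)}.
    apply: (@cvg_comp _ _ _ fst (fun p : R * R => Fs p.1 p.2) _ (nbhs ((h, s) : R * R))).
      exact: cvg_fst.
    exact: cs.
  have c21 : {for z, continuous (fun z : (R * R) * (R * R) => z.2.1)}.
    by apply: (@cvg_comp _ _ _ snd fst _ (nbhs v)); [exact: cvg_snd|exact: cvg_fst].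
  have c22 : {for z, continuous (fun z : (R * R) * (R * R) => z.2.2)}.
    by apply: (@cvg_comp _ _ _ snd snd _ (nbhs v)); exact: cvg_snd.
  by apply: contD; apply: contM.
move: ch cs => /cont_real2P chp /cont_real2P csp.
have lin : linear (fun v : R * R => Fh h s * v.1 + Fs h s * v.2).
  by move=> a u v /=; rewrite /GRing.scale /=; ring.
pose dM := GRing.isLinear.Build _ _ _ _ _ lin.
pose dL : {linear (R * R)%type -> R} := HB.pack (fun v : R * R => Fh h s * v.1 + Fs h s * v.2) dM.
apply: (@is_diff_of_small _ _ _ _ dL).
  have cL : forall v : R * R, {for v, continuous (fun v : R * R => Fh h s * v.1 + Fs h s * v.2)}.
    by move=> v; apply: contD; apply: contM; do ?[exact: contC|exact: cvg_fst|exact: cvg_snd].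
  exact: cL.
move=> e e0; have e2 : 0 < e / 2 by rewrite divr_gt0.
have [d1 d10 d1P] := chp _ e2; have [d2 d20 d2P] := csp _ e2.
have {H} [d3 d30 d3P] := (near_real2P h s (fun t u => [/\ is_derive t 1 (F ^~ u) (Fh t u),
     is_derive u 1 (F t) (Fs t u),
     {for ((t, u) : R * R), continuous (fun q : R * R => Fh q.1 q.2)} &
     {for ((t, u) : R * R), continuous (fun q : R * R => Fs q.1 q.2)}])).1 H.
apply/(near_real2P h s (fun t u => `|F t u - F h s - dL ((t, u) - (h, s))| <= e * `|((t, u) - (h, s) : R * R)|)).
exists (Num.min (Num.min d1 d2) d3); first by rewrite !lt_min d10 d20 d30.
move=> t u; rewrite !lt_min => /andP[/andP[t1 t2] t3].
move=> /andP[/andP[u1 u2] u3]; rewrite /dL /=.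
have xi_lt (a b xi c : R) : 0 <= xi <= 1 -> `|b - a| < c -> `|a + xi * (b - a) - a| < c.
  by move=> xi01 bd; rewrite addrC addKr; apply: le_lt_trans bd; exact: scale_le.
have [|xi xi01 /=] := @mvt0 R (fun k => F (h + k) u) (fun k => Fh (h + k) u * 1) (t - h).
  move=> xi xi01; have H : is_derive (h + xi * (t - h)) 1 (F ^~ u) (Fh (h + xi * (t - h)) u).
    by have [] := d3P _ u (xi_lt _ _ _ _ xi01 t3) u3.
  apply: is_derive_eq (der_comp (f := F ^~ u) (g := fun k : R => h + k) H
    (derD (derC h _) (derI _))) _.
  by rewrite add0r.
rewrite mulr1 addr0 (addrC h) subrK => Et.
have [|eta eta01 /=] := @mvt0 R (fun k => F h (s + k)) (fun k => Fs h (s + k) * 1) (u - s).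
  move=> eta eta01; have H : is_derive (s + eta * (u - s)) 1 (F h) (Fs h (s + eta * (u - s))).
    have hh : `|h - h| < d3 by rewrite subrr normr0.
    by have [] := d3P h _ hh (xi_lt _ _ _ _ eta01 u3).
  apply: is_derive_eq (der_comp (f := F h) (g := fun k : R => s + k) H
    (derD (derC s _) (derI _))) _.
  by rewrite add0r.
rewrite mulr1 addr0 (addrC s) subrK => Eu.
have -> : F t u - F h s - (Fh h s * (t - h) + Fs h s * (u - s)) =
  (F t u - F h u - Fh h s * (t - h)) + (F h u - F h s - Fs h s * (u - s)) by ring.
rewrite Et Eu -!mulrBl; apply: le_trans (ler_normD _ _) _; rewrite !normrM.
rewrite (_ : e * _ = e / 2 * `|((t - h, u - s) : R * R)| + e / 2 * `|((t - h, u - s) : R * R)|); last first.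
  by rewrite -mulrDl -splitr.
have nt : `|t - h| <= `|((t - h, u - s) : R * R)| by rewrite le_max lexx.
have nu : `|u - s| <= `|((t - h, u - s) : R * R)| by rewrite le_max lexx orbT.
apply: lerD; apply: ler_pM => //; apply: ltW.
  by apply: d1P => //; exact: xi_lt.
by apply: d2P; [rewrite subrr normr0|exact: xi_lt].
Unshelve. all: by end_near. Qed.

Lemma is_derive_section V (F : V * R -> R) (p : V) (x : R) :
  differentiable F (p, x) ->
  is_derive x 1 (fun t : R => F (p, t)) ('d F (p, x) (0, 1)).
Proof.
move=> Fd.
have gd : is_diff x (fun t : R => (p, t)) (fun t : R => (0, t)).
  exact: (is_diff_pair (is_diff_cst p x) (is_diff_id x)).
have gd' : differentiable (fun t : R => (p, t)) x by exact: ex_diff.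
have Fgd : differentiable (F \o (fun t : R => (p, t))) x by exact: differentiable_comp.
split; first exact: diff_derivable.
by rewrite deriveE//= (diff_comp gd' Fd) /= diff_val.
Qed.

End C1maps.

Lemma cont_pair (S T U : topologicalType) (f : S -> T) (g : S -> U) (x : S) :
  {for x, continuous f} -> {for x, continuous g} ->
  {for x, continuous (fun t => (f t, g t))}.
Proof. by move=> fc gc; exact: cvg_pair. Qed.

(** * The implicit function theorem for one real unknown *)

Section ImplicitFunction.
Variables (R : realType) (P : normedModType R) (F : P * R -> R) (p0 : P) (x0 : R).
Hypothesis F_c1 : c1 F (p0, x0).
Hypothesis F0 : F (p0, x0) = 0.
Variable D : P * R -> R.
Hypothesis DE : forall z, D z = 'd F z (0, 1).
Hypothesis D0 : 0 < D (p0, x0).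

Let D_cont (z : P * R) : c1_at F z -> {for z, continuous D}.
Proof.
move=> [_ /(_ (0, 1)) H]; rewrite (funext DE).
apply: (continuous_comp_at (f := fun z : (P * R) * (P * R) => 'd F (z.1) (z.2))
  (g := fun z : P * R => (z, (0, 1) : P * R)) H).
by apply: (cont_pair (f := fun q => q) (g := fun=> ((0, 1) : P * R))); [exact: cvg_id|exact: cvg_cst].
Qed.

Let good_ball : exists2 r : R, 0 < r & forall p x, ball p0 r p -> `|x - x0| < r ->
  c1_at F (p, x) /\ 0 < D (p, x).
Proof.
have H : \forall z \near (p0, x0), c1_at F z /\ 0 < D z.
  near=> z; split; first by near: z.
  near: z; apply: (cvgr_gt (D (p0, x0))) => //.
  exact: D_cont (nbhs_singleton F_c1).
move/nbhs_ballP: H => [r /= r0 rP]; exists r => // p x pr xr.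
by apply: (rP (p, x)); split => //=; rewrite /ball /= distrC.
Unshelve. all: by end_near. Qed.

Let r : R := sval (cid2 good_ball).
Let r0 : 0 < r. Proof. by rewrite /r; case: cid2. Qed.
Let r_good p x : ball p0 r p -> `|x - x0| < r -> c1_at F (p, x) /\ 0 < D (p, x).
Proof. by move: p x; rewrite /r; case: cid2. Qed.

(** Monotonicity in the unknown replaces a fixed-point argument: it gives uniqueness of the zero,
    and existence follows from a sign change, which persists for nearby parameters. *)
Let F_incr p x y : ball p0 r p -> `|x - x0| < r -> `|y - x0| < r -> x < y ->
  F (p, x) < F (p, y).
Proof.
move=> pr xr yr xy.
have mid z : x <= z <= y -> `|z - x0| < r.
  move: xr yr; rewrite !ltr_norml => /andP[x1 x2] /andP[y1 y2] /andP[z1 z2].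
  by apply/andP; split; lra.
have [|c /andP[c1' c2'] e] := @mvt R (fun t => F (p, t)) (fun t => D (p, t)) x y xy.
  by move=> z /mid zr; rewrite DE; apply: is_derive_section; have [[]] := r_good pr zr.
rewrite -subr_gt0 e mulr_gt0 ?subr_gt0//.
by have [|//] := r_good pr (mid c _); rewrite !ltW.
Qed.

Let rho : R := r / 2.
Let rho0 : 0 < rho. Proof. by rewrite divr_gt0. Qed.
Let rhor : rho < r. Proof. by rewrite /rho; have := r0; lra. Qed.
Let p0r : ball p0 r p0. Proof. exact: ballxx. Qed.

Let F_cont p x : ball p0 r p -> `|x - x0| < r -> {for p, continuous (fun q => F (q, x))}.
Proof.
move=> pr xr; have [[Fd _] _] := r_good pr xr.
apply: (continuous_comp_at (f := F) (g := fun q => (q, x))).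
  exact: differentiable_continuous.
by apply: (cont_pair (f := fun q => q) (g := fun=> x)); [exact: cvg_id|exact: cvg_cst].
Qed.

Let signs p x e : ball p0 r p -> F (p, x) = 0 -> 0 < e -> `|x - x0| + e < r ->
  \forall q \near p, [/\ ball p0 r q, F (q, x - e) < 0 & 0 < F (q, x + e)].
Proof.
move=> pr Fp e0 xer.
have xr : `|x - x0| < r by apply: le_lt_trans xer; rewrite lerDl ltW.
have x1 : `|x - e - x0| < r.
  by move: xer xr; rewrite addrAC; have := ler_normB (x - x0) e; rewrite (gtr0_norm e0); lra.
have x2 : `|x + e - x0| < r.
  by move: xer xr; rewrite addrAC; have := ler_normD (x - x0) e; rewrite (gtr0_norm e0); lra.
near=> q; split.
- near: q; move: pr; rewrite -!ball_normE /= => pr.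
  have : \forall q \near p, `|p0 - q| < r.
    apply: (cvgr_lt `|p0 - p|) => //.
    have pc : {for p, continuous (fun q : P => p0 - q)}.
      by apply: continuousB; [exact: cvg_cst|exact: cvg_id].
    exact: cvg_norm pc.
  by [].
- near: q; apply: (cvgr_lt (F (p, x - e))); first exact: F_cont.
  by rewrite -Fp; apply: F_incr => //; rewrite gtrBl.
- near: q; apply: (cvgr_gt (F (p, x + e))); first exact: F_cont.
  by rewrite -Fp; apply: F_incr => //; rewrite ltrDl.
Unshelve. all: by end_near. Qed.

(** The window of radius [r] is the same for all [p], so that by uniqueness the zero found near any
    [p] is the value of this one function. *)
Let phi (p : P) : R := xget x0 [set x | `|x - x0| < r /\ F (p, x) = 0].

Let phi_unique p x : ball p0 r p -> `|x - x0| < r -> F (p, x) = 0 -> x = phi p.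
Proof.
move=> pr xr Fx; rewrite /phi; case: xgetP => [y _ [yr Fy]|/(_ x)]; last by case.
have [xy|yx|//] := ltgtP x y.
- by have := F_incr pr xr yr xy; rewrite Fx Fy ltxx.
- by have := F_incr pr yr xr yx; rewrite Fx Fy ltxx.
Qed.

Let phiP p x e : ball p0 r p -> 0 < e -> `|x - x0| + e < r ->
  F (p, x - e) < 0 -> 0 < F (p, x + e) ->
  [/\ F (p, phi p) = 0, `|phi p - x0| < r & `|phi p - x| < e].
Proof.
move=> pr e0 xer F1 F2.
have inside y : `|y - x| <= e -> `|y - x0| < r.
  move=> yx; rewrite -(subrKA x); apply: le_lt_trans (ler_normD _ _) _.
  by apply: le_lt_trans xer; rewrite addrC lerD2l.
have [|||y] := @IVT R (fun t => F (p, t)) (x - e) (x + e) 0.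
- by rewrite lerBlDr -addrA lerDl addr_ge0 ?ltW.
- apply: derivable_within_continuous => z; rewrite in_itv /= => /andP[z1 z2].
  have zr : `|z - x0| < r by apply: inside; rewrite ler_norml; apply/andP; split; lra.
  have [[Fd _] _] := r_good pr zr.
  by have := is_derive_section Fd => ?; exact: ex_derive.
- by rewrite ge_min le_max (ltW F1) (ltW F2) orbT.
rewrite in_itv /= => /andP[y1 y2] Fy.
have yne1 : y != x - e by apply/eqP => E; move: F1; rewrite -E Fy ltxx.
have yne2 : y != x + e by apply/eqP => E; move: F2; rewrite -E Fy ltxx.
have yr : `|y - x0| < r by apply: inside; rewrite ler_norml; apply/andP; split; lra.
rewrite -(phi_unique pr yr Fy); split => //.
by rewrite ltr_norml; apply/andP; split; [rewrite ltrBrDl lt_neqAle eq_sym yne1|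
  rewrite ltrBlDr addrC lt_neqAle yne2].
Qed.

Let phi_near : \forall p \near p0,
  [/\ ball p0 r p, F (p, phi p) = 0 & `|phi p - x0| < r].
Proof.
have xr : `|x0 - x0| + rho < r by rewrite subrr normr0 add0r.
have := signs p0r F0 rho0 xr; apply: filterS => q [qr F1 F2].
by have [? ? ?] := phiP qr rho0 xr F1 F2.
Qed.

Let phi_cont p : ball p0 r p -> F (p, phi p) = 0 -> `|phi p - x0| < r ->
  {for p, continuous phi}.
Proof.
move=> pr Fp xr; apply/cvgrPdist_lt => e e0.
pose e' := Num.min e ((r - `|phi p - x0|) / 2).
have e'0 : 0 < e' by rewrite lt_min e0 divr_gt0// subr_gt0.
have e'r : `|phi p - x0| + e' < r.
  have : e' <= (r - `|phi p - x0|) / 2 by rewrite ge_min lexx orbT.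
  by lra.
have := signs pr Fp e'0 e'r; apply: filterS => q [qr F1 F2].
have [_ _] := phiP qr e'0 e'r F1 F2; rewrite distrC => /lt_le_trans; apply.
by rewrite ge_min lexx.
Qed.

Let dphi (p : P) (v : P) : R := - 'd F (p, phi p) (v, 0) / D (p, phi p).

Let phi_diff p : ball p0 r p -> F (p, phi p) = 0 -> `|phi p - x0| < r ->
  is_diff p phi (dphi p).
Proof.
move=> pr Fp xr; have phc := phi_cont pr Fp xr.
have [[Fd _] Dp] := r_good pr xr.
set x1 := phi p in Fp xr Fd Dp.
have lin : linear (dphi p).
  move=> a u v; rewrite /dphi.
  have -> : (a *: u + v, 0 : R) = a *: (u, 0 : R) + (v, 0 : R).
    by congr pair; rewrite /= scaler0 addr0.
  by rewrite linearD linearZ /= /GRing.scale /=; ring.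
pose dM := GRing.isLinear.Build _ _ _ _ _ lin.
pose dL : {linear P -> R} := HB.pack (dphi p) dM.
have dLc : continuous dL.
  have cL : forall v : P, {for v, continuous (dphi p)}.
    move=> v; apply: contM; last exact: contC.
    apply: contN.
    apply: (continuous_comp_at (f := 'd F (p, phi p)) (g := fun v : P => (v, 0 : R))).
      exact: diff_continuous.
    by apply: (cont_pair (f := fun q => q) (g := fun=> 0 : R)); [exact: cvg_id|exact: cvg_cst].
  exact: cL.
apply: (@is_diff_of_small _ _ _ _ _ dL) => // e e0.
have [k k0 kP] := linear_lipschitz dLc.
have k2 : 0 < 2 * k + 2 by rewrite addr_gt0 ?mulr_gt0.
(* The [1 / 2] first yields the Lipschitz bound [|t| <= (2 * k + 1) * |v|] for the increment [t] of
   [phi]; with it, [e / (2 * k + 2)] gives the error [e * |v|]. *)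
have eD : 0 < Num.min (e / (2 * k + 2)) (1 / 2) * D (p, x1).
  by rewrite mulr_gt0// lt_min !divr_gt0.
have Fsm := is_diff_small (differentiableP Fd) eD.
have gc : {for p, continuous (fun q => (q, phi q))}.
  by apply: (cont_pair (f := fun q => q) (g := phi)); [exact: cvg_id|exact: phc].
have Fsm' : \forall q \near p, `|F (q, phi q) - F (p, x1) - 'd F (p, x1) ((q, phi q) - (p, x1))|
    <= Num.min (e / (2 * k + 2)) (1 / 2) * D (p, x1) * `|((q, phi q) - (p, x1) : P * R)|.
  exact: (gc _ Fsm).
near=> q.
have Fq : F (q, phi q) = 0.
  near: q; have xr' : `|x1 - x0| + (r - `|x1 - x0|) / 2 < r by lra.
  have h0 : 0 < (r - `|x1 - x0|) / 2 by rewrite divr_gt0// subr_gt0.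
  have := signs pr Fp h0 xr'; apply: filterS => q [qr F1 F2].
  by have [] := phiP qr h0 xr' F1 F2.
have : `|F (q, phi q) - F (p, x1) - 'd F (p, x1) ((q, phi q) - (p, x1))|
    <= Num.min (e / (2 * k + 2)) (1 / 2) * D (p, x1) * `|((q, phi q) - (p, x1) : P * R)|.
  by near: q.
rewrite Fq Fp subrr sub0r normrN.
have -> : 'd F (p, x1) ((q, phi q) - (p, x1)) = D (p, x1) * (phi q - x1 - dphi p (q - p)).
  have -> : (q, phi q) - (p, x1) = (q - p, 0) + (phi q - x1) *: (0, 1) :> P * R.
    by congr pair; rewrite /= ?scaler0 ?addr0// add0r /GRing.scale /= mulr1.
  rewrite linearD linearZ /= -DE /dphi -/x1 /GRing.scale /=.
  by field; rewrite gt_eqF.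
rewrite normrM (gtr0_norm Dp) [_ * D _]mulrC -mulrA ler_pM2l//.
set t := phi q - x1; set v := q - p.
have nb : `|((q, phi q) - (p, x1) : P * R)| <= `|v| + `|t|.
  rewrite /Num.norm /= ge_max -/v -/t.
  by rewrite lerDl lerDr !normr_ge0.
have m0 : 0 <= Num.min (e / (2 * k + 2)) (1 / 2).
  by rewrite le_min !divr_ge0 ?(ltW k2)// ltW.
move=> /le_trans /(_ (ler_wpM2l m0 nb)) h.
have tb : `|t| <= (2 * k + 1) * `|v|.
  have h1 : Num.min (e / (2 * k + 2)) (1 / 2) * (`|v| + `|t|) <= 1 / 2 * (`|v| + `|t|).
    by rewrite ler_wpM2r ?addr_ge0// ge_min lexx orbT.
  have h2 := ler_normD (t - dphi p v) (dphi p v); rewrite subrK in h2.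
  have h3 := kP v; rewrite /dL /= in h3.
  by have := le_trans h h1; lra.
apply: le_trans h _.
apply: (@le_trans _ _ (e / (2 * k + 2) * (`|v| + `|t|))).
  by rewrite ler_wpM2r ?addr_ge0// ge_min lexx.
apply: (@le_trans _ _ (e / (2 * k + 2) * ((2 * k + 2) * `|v|))).
  rewrite ler_pM2l ?divr_gt0//; lra.
by rewrite mulrA divfK// gt_eqF.
Unshelve. all: by end_near. Qed.

Lemma implicit_function_pos : exists phi : P -> R,
  [/\ phi p0 = x0, c1 phi p0, \forall p \near p0, F (p, phi p) = 0 &
   exists2 e : R, 0 < e & forall p x, ball p0 e p -> `|x - x0| < e -> F (p, x) = 0 ->
     x = phi p].
Proof.
exists phi; split.
- by rewrite -(phi_unique p0r _ F0)// subrr normr0.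
- apply: (@c1_intro _ _ _ _ dphi); near=> p.
  have [pr Fp xr] : [/\ ball p0 r p, F (p, phi p) = 0 & `|phi p - x0| < r] by near: p.
  split; first exact: phi_diff.
  move=> v; have [Fc Dp] := r_good pr xr.
  have fc : {for (p, v), continuous (fun z : P * P => (z.1, phi z.1))}.
    apply: cont_pair; first exact: cvg_fst.
    by apply: (@cvg_comp _ _ _ fst phi _ (nbhs p)); [exact: cvg_fst|exact: phi_cont].
  apply: contM.
    apply: contN.
    apply: (continuous_comp_at (f := fun z : (P * R) * (P * R) => 'd F (z.1) (z.2))
      (g := fun z : P * P => ((z.1, phi z.1), (z.2, 0 : R)))); first exact: Fc.2.
    apply: cont_pair; first exact: fc.
    apply: (cont_pair (f := fun z : P * P => z.2) (g := fun=> 0 : R)); first exact: cvg_snd.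
    exact: cvg_cst.
  apply: contV; first by rewrite gt_eqF.
  apply: (continuous_comp_at (f := D) (g := fun z : P * P => (z.1, phi z.1))) fc.
  exact: D_cont.
- by apply: filterS phi_near => p [].
- by exists r.
Unshelve. all: by end_near. Qed.
End ImplicitFunction.

Lemma implicit_function (R : realType) (P : normedModType R) (F : P * R -> R)
    (p0 : P) (x0 : R) : c1 F (p0, x0) -> F (p0, x0) = 0 -> 'd F (p0, x0) (0, 1) != 0 ->
  exists phi : P -> R,
  [/\ phi p0 = x0, c1 phi p0, \forall p \near p0, F (p, phi p) = 0 &
   exists2 e : R, 0 < e & forall p x, ball p0 e p -> `|x - x0| < e -> F (p, x) = 0 ->
     x = phi p].
Proof.
move=> Fc F0; rewrite neq_lt => /orP[D0|D0]; last first.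
  exact: (@implicit_function_pos _ _ _ _ _ Fc F0 (fun z => 'd F z (0, 1))).
have Nc := c1N Fc.
have [||phi [h1 h2 h3 [e e0 h4]]] := @implicit_function_pos _ _ _ _ _ Nc _ (fun z => 'd (fun y => - F y) z (0, 1)) (fun=> erefl).
- by rewrite F0 oppr0.
- have -> : 'd (fun y => - F y) (p0, x0) (0, 1) = - 'd F (p0, x0) (0, 1).
    by rewrite diffN//; exact: c1_diff.
  by rewrite oppr_gt0.
- exists phi; split => //; first by apply: filterS h3 => p /eqP; rewrite oppr_eq0 => /eqP.
  by exists e => // p x pe xe Fx; apply: h4 => //; rewrite Fx oppr0.
Qed.

(** * Monotonicity of the radial solutions *)

Section FirstZero.
Variable R : realType.

Lemma first_zero (phi : R -> R) (b : R) :
  (forall t, 0 <= t <= b -> {for t, continuous phi}) -> 0 < phi 0 ->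
  (exists2 t, 0 <= t <= b & phi t <= 0) ->
  exists s : R, [/\ 0 < s, s <= b, phi s = 0 & forall t, 0 <= t < s -> 0 < phi t].
Proof.
move=> pc p0 [t0 t0b pt0].
pose E := [set t | 0 <= t <= b /\ phi t <= 0].
have E0 : E t0 by [].
have lE : has_lbound E by exists 0 => x [/andP[]].
have hE : has_inf E by split; [exists t0|].
pose s := inf E.
have s0 : 0 <= s by apply: lb_le_inf; [exists t0|move=> x [/andP[]]].
have sb : s <= b by apply: le_trans (ge_inf lE E0) _; case/andP: t0b.
have below t : 0 <= t < s -> 0 < phi t.
  move=> /andP[t1 t2]; rewrite ltNge; apply/negP => pt.
  have /(ge_inf lE) : E t by split => //; rewrite t1/= (le_trans (ltW t2)).
  by rewrite leNgt t2.
have sc : {for s, continuous phi} by apply: pc; rewrite s0.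
have ps : phi s <= 0.
  rewrite leNgt; apply/negP => ps.
  have [d d0 dP] := (cont_realP _ _).1 sc _ ps.
  have [x [/andP[x0 xb] px] xs] := inf_adherent d0 hE.
  have sx : s <= x by apply: ge_inf => //; split => //; rewrite x0.
  have : `|phi x - phi s| < phi s.
    by apply: dP; rewrite ger0_norm ?subr_ge0// ltrBlDl.
  by rewrite ltr_norml => /andP[]; lra.
have s_gt0 : 0 < s.
  by rewrite lt_neqAle s0 andbT; apply/eqP => E1; move: ps; rewrite -E1 leNgt p0.
exists s; split => //; apply/eqP; rewrite eq_le ps leNgt; apply/negP => pns.
have ns : 0 < - phi s by rewrite oppr_gt0.
have [d d0 dP] := (cont_realP _ _).1 sc _ ns.
pose t := s - Num.min (d / 2) s.
have mpos : 0 < Num.min (d / 2) s by rewrite lt_min divr_gt0.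
have ts : t < s by rewrite ltrBlDr ltrDl.
have t_ge0 : 0 <= t by rewrite subr_ge0 ge_min lexx orbT.
have : `|phi t - phi s| < - phi s.
  apply: dP; rewrite /t addrAC subrr sub0r normrN gtr0_norm//.
  have : Num.min (d / 2) s <= d / 2 by rewrite ge_min lexx.
  by lra.
have : 0 < phi t by apply: below; rewrite t_ge0.
by rewrite ltr_norml => ? /andP[]; lra.
Qed.

(** The form in which all sign arguments below are run: it is enough to refute a first zero, with
    positivity before it at hand. *)
Lemma pos_of_no_zero (phi : R -> R) (b : R) :
  (forall t, 0 <= t <= b -> {for t, continuous phi}) -> 0 < phi 0 ->
  (forall s, 0 < s -> s <= b -> phi s = 0 -> (forall t, 0 <= t < s -> 0 < phi t) -> False) ->
  forall t, 0 <= t <= b -> 0 < phi t.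
Proof.
move=> pc p0 H t tb; rewrite ltNge; apply/negP => pt.
by have [|s [s0 sb ps pss]] := first_zero pc p0; [exists t|exact: (H s)].
Qed.

Lemma ge0_of_pos_left (phi : R -> R) (s : R) : 0 < s -> {for s, continuous phi} ->
  (forall t, 0 <= t < s -> 0 < phi t) -> 0 <= phi s.
Proof.
move=> s0 pc pos; rewrite leNgt; apply/negP => ps.
have ns : 0 < - phi s by rewrite oppr_gt0.
have [d d0 dP] := (cont_realP _ _).1 pc _ ns.
pose t := s - Num.min (d / 2) s.
have mpos : 0 < Num.min (d / 2) s by rewrite lt_min divr_gt0.
have ts : t < s by rewrite ltrBlDr ltrDl.
have t_ge0 : 0 <= t by rewrite subr_ge0 ge_min lexx orbT.
have : `|phi t - phi s| < - phi s.
  apply: dP; rewrite /t addrAC subrr sub0r normrN gtr0_norm//.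
  have : Num.min (d / 2) s <= d / 2 by rewrite ge_min lexx.
  by lra.
have : 0 < phi t by apply: pos; rewrite t_ge0.
by rewrite ltr_norml => ? /andP[]; lra.
Qed.
End FirstZero.

(* [rZ] and [rW] are the derivatives of [rY] in [h] and in [s], [rV] is the mixed
   second derivative and [rQ] the second derivative in [s]. Past
   [s = 2 - eps], where the coefficient is truncated, nothing is known of
   [rQ]. *)
Record radial_system (R : realType) (g g1 : R -> R) (eps : R) := Radial {
  rY : R -> R -> R; rZ : R -> R -> R; rW : R -> R -> R; rV : R -> R -> R;
  rQ : R -> R -> R;
  rY_jc : jc rY; rZ_jc : jc rZ; rW_jc : jc rW; rV_jc : jc rV; rQ_jc : jc rQ;
  rY0 : forall h, rY h 0 = h;
  rZ0 : forall h, rZ h 0 = 1;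
  rY_h : forall h s : R, is_derive h 1 (rY ^~ s) (rZ h s);
  rY_s : forall h s : R, is_derive s 1 (rY h) (rW h s);
  rZ_s : forall h s : R, is_derive s 1 (rZ h) (rV h s);
  rW_h : forall h s : R, is_derive h 1 (rW ^~ s) (rV h s);
  rW_s : forall h s : R, s < 2 - eps -> is_derive s 1 (rW h) (rQ h s);
  rQ_ode : forall h s : R, s < 2 - eps ->
    s * (2 - s) * rQ h s = 2 * (s - 1) * rW h s - g (rY h s);
  rV_ode : forall h s : R, s < 2 - eps ->
    is_derive s 1 (fun t => t * (2 - t) * rV h t) (- (g1 (rY h s) * rZ h s));
  rW_avg : forall h s : R, s < 2 - eps ->
    rW h s = - (avg (fun r => g (rY h r)) s / (2 - s)) }.

Arguments rY_jc {R g g1 eps}.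
Arguments rZ_jc {R g g1 eps}.
Arguments rW_jc {R g g1 eps}.
Arguments rV_jc {R g g1 eps}.
Arguments rQ_jc {R g g1 eps}.

Lemma radial_exists (R : realType) (g g1 : R -> R) (L eps : R) :
  (forall x : R, is_derive x 1 g (g1 x)) -> continuous g1 ->
  (forall x, `|g1 x| <= L) -> 0 < eps -> inhabited (radial_system g g1 eps).
Proof.
move=> gd gc gb e0; constructor.
apply: (@Radial R g g1 eps (Y gd gb e0) (Z gd gc gb e0) (W gd gb e0)
  (V gd gc gb e0) (Q gd gb e0)).
- exact: Y_jc.
- exact: Z_jc.
- exact: W_jc.
- exact: V_jc.
- exact: Q_jc.
- exact: Y0.
- exact: Z0.
- exact: Y_der_h.
- exact: Y_der_s.
- exact: Z_der_s.
- exact: W_der_h.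
- exact: W_der_s.
- exact: Q_ode.
- exact: V_ode.
- by move=> h s s2; rewrite /W coefE// mulrC.
Qed.

(** * Signs of [W], [Z] and [J] for heights in [(0, M]], up to the first zero of [Y h] *)

Section Region.
Variables (R : realType) (g g1 : R -> R) (eps M : R) (S : radial_system g g1 eps).
Hypothesis eps_gt0 : 0 < eps.
Hypothesis eps_lt1 : eps < 1.
Hypothesis g_der : forall x : R, is_derive x 1 g (g1 x).
Hypothesis g_pos : forall x, 0 < x <= M -> 0 < g x.
Hypothesis g_sub : forall x, 0 < x <= M -> x * g1 x <= g x.
Implicit Types (h s t a b : R).

Local Notation Y := (rY S).
Local Notation Z := (rZ S).
Local Notation W := (rW S).
Local Notation V := (rV S).
Local Notation Q := (rQ S).

Lemma radial_cont (F : R -> R -> R) h s : jc F -> {for s, continuous (F h)}.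
Proof. by move=> /(@jc_section _ _ h); apply. Qed.

Lemma W_at0 h : W h 0 = - (g h / 2).
Proof. by rewrite rW_avg ?avg0 ?rY0 ?subr0//; move: eps_lt1; lra. Qed.

Lemma mW_der h s : s < 2 - eps ->
  is_derive s 1 (fun t => t * (2 - t) * W h t) (- g (Y h s)).
Proof.
move=> s2; apply: is_derive_eq (derM (derM (derI s) (derB (derC 2 s) (derI s))) (rW_s S h s2)) _.
by rewrite rQ_ode//; ring.
Qed.

Lemma m_gt0 s : 0 < s < 2 - eps -> 0 < s * (2 - s).
Proof. by move=> /andP[s0 s2]; rewrite mulr_gt0//; move: eps_gt0; lra. Qed.

(** The interval is half-open so that [s] may be the first zero of [Y h], that is, the boundary of
    the cap. *)
Definition pos h s := forall t, 0 <= t < s -> 0 < Y h t.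

Section OneSolution.
Variables (h s : R).
Hypothesis hM : 0 < h <= M.
Hypothesis s_lt : s < 2 - eps.
Hypothesis ph : pos h s.

(** Up to a first zero of [W] the solution decreases, hence stays in [(0, M]] where [g > 0]. Then
    [t (2 - t) W] decreases strictly from 0 and cannot vanish there. *)
Lemma W_neg t : 0 <= t <= s -> W h t < 0.
Proof.
have [h0 hM'] := andP hM.
move=> ts; rewrite -oppr_gt0; move: t ts.
apply: pos_of_no_zero.
- by move=> t _; apply: contN; exact: radial_cont (rW_jc S).
- by rewrite W_at0 opprK divr_gt0// g_pos.
move=> s1 s10 s1s W1 Wn.
have Yle t : 0 <= t < s1 -> Y h t <= h.
  move=> /andP[t0 ts1]; rewrite -[leRHS](rY0 S h).
  apply: (deriv_le0_ge (df := W h) t0) => [x _|x /andP[x0 xt]]; first exact: rY_s.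
  by apply: ltW; rewrite -oppr_gt0; apply: Wn; rewrite (ltW x0) (lt_trans xt).
have : s1 * (2 - s1) * W h s1 < 0 * (2 - 0) * W h 0.
  apply: (deriv_lt0_gt (f := fun t => t * (2 - t) * W h t)
    (df := fun t => - g (Y h t)) s10).
    by move=> x /andP[_ xs]; apply: mW_der; apply: le_lt_trans s_lt; apply: le_trans s1s.
  move=> x /andP[x0 xs]; rewrite oppr_lt0; apply: g_pos.
  rewrite ph ?(ltW x0) ?(lt_le_trans xs)//=.
  by apply: le_trans hM'; apply: Yle; rewrite (ltW x0).
by move/eqP: W1; rewrite oppr_eq0 => /eqP ->; rewrite mulr0 !mul0r ltxx.
Qed.

Lemma Y_decr t u : 0 <= t -> t < u -> u <= s -> Y h u < Y h t.
Proof.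
move=> t0 tu us; apply: (deriv_lt0_gt (df := W h) tu) => [x _|x /andP[x1 x2]].
  exact: rY_s.
by apply: W_neg; rewrite (le_trans t0 (ltW x1)) (le_trans (ltW x2)).
Qed.

Lemma Y_le t : 0 <= t <= s -> Y h t <= h.
Proof.
move=> /andP[]; rewrite le_eqVlt => /predU1P[<-|t0 ts]; first by rewrite rY0.
by rewrite -[leRHS](rY0 S h); apply/ltW/Y_decr.
Qed.

Lemma gY_ge0 t : 0 <= t < s -> 0 < g (Y h t).
Proof.
move=> /andP[t0 ts]; have [_ hM'] := andP hM; apply: g_pos; rewrite ph ?t0//=.
by apply: le_trans hM'; apply: Y_le; rewrite t0 ltW.
Qed.

(** The weighted Wronskian [D = x (2 - x) (Y V - W Z)] starts at 0 and has derivative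
    [Z (g Y - Y g1 Y)], which is nonnegative before the first zero of [Z]. So [Z / Y] is
    nondecreasing from its value [1 / h > 0], and no first zero occurs. *)
Lemma Z_gt0 t : 0 <= t < s -> 0 < Z h t.
Proof.
have [h0 hM'] := andP hM.
move=> /andP[t0 ts]; move: t0.
(* The right end is kept strictly below [s], where [Y h] may vanish, so that [Z / Y] is defined up
   to it. *)
have {ts} [u [tu us]] : exists u, t <= u /\ u < s by exists t.
move=> t0; have : 0 <= t <= u by rewrite t0.
have pu x : 0 <= x <= u -> 0 < Y h x.
  by move=> /andP[x0 xu]; apply: ph; rewrite x0 (le_lt_trans xu).
have lt2 x : x <= u -> x < 2 - eps.
  by move=> xu; apply: lt_trans s_lt; apply: le_lt_trans us.
move: t {t0 tu}; apply: pos_of_no_zero.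
- by move=> x _; exact: radial_cont (rZ_jc S).
- by rewrite rZ0.
move=> s1 s10 s1u Zs1 Zpos.
pose D x := Y h x * (x * (2 - x) * V h x) - x * (2 - x) * W h x * Z h x.
have D_ge0 x : 0 <= x <= s1 -> 0 <= D x.
  move=> /andP[x0 xs1]; have -> : 0 = D 0 by rewrite /D; ring.
  apply: (deriv_ge0_le (df := fun y => Z h y * (g (Y h y) - Y h y * g1 (Y h y))) x0).
    move=> y /andP[_ yx]; have y2 : y < 2 - eps by apply: lt2; rewrite (le_trans yx)// (le_trans xs1).
    apply: is_derive_eq (derB (derM (rY_s S h y) (rV_ode S h y2)) (derM (mW_der h y2) (rZ_s S h y))) _.
    by ring.
  move=> y /andP[y0 yx]; have ys1 : y < s1 := lt_le_trans yx xs1.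
  apply: mulr_ge0; first by apply/ltW/Zpos; rewrite (ltW y0).
  rewrite subr_ge0; apply: g_sub; rewrite pu/=; last by rewrite (ltW y0)/= ltW// (lt_le_trans ys1).
  apply: le_trans hM'; apply: Y_le; rewrite (ltW y0)/=.
  by rewrite (le_trans (ltW ys1))// (le_trans s1u)// ltW.
have : Z h 0 / Y h 0 <= Z h s1 / Y h s1.
  apply: (deriv_ge0_le (f := fun x => Z h x / Y h x)
    (df := fun x => (V h x * Y h x - W h x * Z h x) / Y h x ^+ 2) (ltW s10)).
    move=> x /andP[x0 xs]; have Yx : Y h x != 0 by rewrite gt_eqF// pu// x0 (le_trans xs).
    apply: is_derive_eq (derM (rZ_s S h x) (derV Yx (rY_s S h x))) _.
    by field.
  move=> x /andP[x0 xs]; rewrite divr_ge0 ?sqr_ge0//.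
  have mx : 0 < x * (2 - x) by rewrite m_gt0// x0/= lt2// (le_trans (ltW xs)).
  have := D_ge0 x; rewrite (ltW x0) (ltW xs) /D => /(_ isT).
  have -> : Y h x * (x * (2 - x) * V h x) - x * (2 - x) * W h x * Z h x =
    x * (2 - x) * (V h x * Y h x - W h x * Z h x) by ring.
  by rewrite pmulr_rge0.
by rewrite Zs1 mul0r rY0 rZ0 leNgt divr_gt0.
Qed.

Lemma Z_ge0 t : 0 <= t <= s -> 0 <= Z h t.
Proof.
move=> /andP[t0]; rewrite le_eqVlt => /predU1P[ts|ts]; last first.
  by apply/ltW/Z_gt0; rewrite t0.
move: t0; rewrite le_eqVlt => /predU1P[<-|t0]; first by rewrite rZ0 ler01.
apply: ge0_of_pos_left t0 _ _; first exact: radial_cont (rZ_jc S).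
by move=> x; rewrite ts; exact: Z_gt0.
Qed.

Definition J (x : R) : R :=
  x * (2 - x) * V h x * W h x + (1 - x) * W h x * Z h x + g (Y h x) * Z h x.

Lemma J_der x : x < 2 - eps ->
  is_derive x 1 J (- (1 - x) * W h x * V h x - W h x * Z h x + (1 - x) * Q h x * Z h x).
Proof.
move=> x2; apply: is_derive_eq (derD (derD (derM (rV_ode S h x2) (rW_s S h x2))
  (derM (derM (derB (derC 1 x) (derI x)) (rW_s S h x2)) (rZ_s S h x)))
  (derM (der_comp (f := g) (g_der (Y h x)) (rY_s S h x)) (rZ_s S h x))) _.
have -> : x * (2 - x) * V h x * Q h x = x * (2 - x) * Q h x * V h x by ring.
by rewrite rQ_ode//; ring.
Qed.

(* [J] is half the derivative of [s (2 - s) W^2 = |grad|^2] along the level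
   sets of [Y]; the weight [s (2 - s)] makes [s (2 - s) J^2] nondecreasing. *)
Lemma J_gt0 t : 0 <= t <= s -> 0 < J t.
Proof.
have [h0 hM'] := andP hM.
move: t; apply: pos_of_no_zero.
- move=> x /andP[_ xs]; apply: is_derive_continuous (J_der _).
  exact: le_lt_trans xs s_lt.
- rewrite /J !mul0r add0r subr0 mul1r rZ0 !mulr1 W_at0 rY0.
  by have := g_pos hM; lra.
move=> s1 s10 s1s Js1 Jpos.
have H0 : 0 < s1 / 2 < s1 by apply/andP; split; lra.
have [H1 H2] := andP H0.
have lt2 x : x <= s1 -> x < 2 - eps by move=> xs; apply: le_lt_trans s_lt; apply: le_trans s1s.
(* The comparison starts at an interior point, as the weight vanishes at 0; any point of [(0, s1)]
   would do. *)
have : (s1 / 2) * (2 - s1 / 2) * J (s1 / 2) ^+ 2 <= s1 * (2 - s1) * J s1 ^+ 2.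
  apply: (deriv_ge0_le (f := fun x => x * (2 - x) * J x ^+ 2)
    (df := fun x => 2 * J x * (- W h x * Z h x)) (ltW H2)).
    move=> x /andP[_ xs]; have x2 := lt2 _ xs.
    apply: is_derive_eq (derM (derM (derI x) (derB (derC 2 x) (derI x)))
      (derM (J_der x2) (J_der x2))) _.
    set j := - (1 - x) * _ * _ - _ + _.
    have -> : (1 * (2 - x) + x * (0 - 1)) * (J x * J x) + x * (2 - x) * (j * J x + J x * j) =
      2 * J x * ((1 - x) * J x + x * (2 - x) * j) by ring.
    congr (_ * _); rewrite /j.
    have -> : x * (2 - x) * (- (1 - x) * W h x * V h x - W h x * Z h x +
        (1 - x) * Q h x * Z h x) = - (1 - x) * (x * (2 - x)) * W h x * V h x -
        x * (2 - x) * W h x * Z h x + (1 - x) * (x * (2 - x) * Q h x) * Z h x by ring.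
    by rewrite rQ_ode// /J; ring.
  move=> x /andP[x0 xs]; have xp : 0 <= x <= s.
    by rewrite (le_trans (ltW H1) (ltW x0)) (le_trans (ltW xs)).
  apply: mulr_ge0; last by rewrite mulr_ge0 ?Z_ge0// oppr_ge0 ltW// W_neg.
  by rewrite mulr_ge0// ltW// Jpos// xs andbT; case/andP: xp.
rewrite Js1 expr0n /= mulr0 leNgt => /negP; apply.
rewrite mulr_gt0 ?exprn_gt0 ?Jpos ?(ltW H1)//.
by rewrite m_gt0// H1/= lt2// ltW.
Qed.

End OneSolution.

(** * Comparison of solutions of different heights *)

Lemma g_ratio x y : 0 < x -> x <= y -> y <= M -> x * g y <= y * g x.
Proof.
move=> x0 xy yM.
have pz z : x <= z -> 0 < z by exact: lt_le_trans.
have : g y / y <= g x / x.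
  apply: (deriv_le0_ge (f := fun z => g z / z)
    (df := fun z => (z * g1 z - g z) / z ^+ 2) xy).
    move=> z /andP[xz _]; have z0 : z != 0 by rewrite gt_eqF// pz.
    apply: is_derive_eq (derM (g_der z) (derV z0 (derI z))) _.
    by field.
  move=> z /andP[/ltW xz /ltW zy]; rewrite mulr_le0_ge0 ?invr_ge0 ?sqr_ge0//.
  by rewrite subr_le0; apply: g_sub; rewrite pz//= (le_trans zy).
rewrite ler_pdivrMr ?pz// mulrAC ler_pdivlMr//.
by rewrite mulrC [g x * y]mulrC.
Qed.

(** The Wronskian argument of [Z_gt0] for two finite heights: while [Y h1 < Y h2], the quotient
    [Y h2 / Y h1] is nondecreasing because [g x / x] is nonincreasing. It thus stays at least
    [h2 / h1 > 1], so the two solutions never meet. *)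
Lemma compare h1 h2 s t : 0 < h1 -> h1 < h2 -> h2 <= M -> s < 2 - eps ->
  (forall x, 0 <= x <= s -> 0 < Y h1 x) -> 0 <= t <= s ->
  h2 * Y h1 t <= h1 * Y h2 t.
Proof.
move=> h10 h12 h2M s2 p1 ts.
have h20 := lt_trans h10 h12.
have lt2 x : x <= s -> x < 2 - eps by move=> xs; apply: le_lt_trans s2.
have H1 : 0 < h1 <= M by rewrite h10 (le_trans (ltW h12)).
have H2 : 0 < h2 <= M by rewrite h20.
have ratio s1 : 0 <= s1 -> s1 <= s -> (forall x, 0 <= x < s1 -> Y h1 x < Y h2 x) ->
    h2 * Y h1 s1 <= h1 * Y h2 s1.
  move=> s10 s1s Y12.
  have p1' : pos h1 s1.
    by move=> x /andP[x0 xs]; rewrite p1// x0 (le_trans (ltW xs)).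
  have p2' : pos h2 s1.
    move=> x /andP[x0 xs]; apply: lt_trans (Y12 x _); last by rewrite x0.
    by rewrite p1// x0 (le_trans (ltW xs)).
  have s12 := lt2 _ s1s.
  pose D x := Y h1 x * (x * (2 - x) * W h2 x) - x * (2 - x) * W h1 x * Y h2 x.
  have D_ge0 x : 0 <= x <= s1 -> 0 <= D x.
    move=> /andP[x0 xs1]; have -> : 0 = D 0 by rewrite /D; ring.
    apply: (deriv_ge0_le (df := fun y => Y h2 y * g (Y h1 y) - Y h1 y * g (Y h2 y)) x0).
      move=> y /andP[_ yx]; have y2 : y < 2 - eps by apply: lt2; rewrite (le_trans yx)// (le_trans xs1).
      apply: is_derive_eq (derB (derM (rY_s S h1 y) (mW_der h2 y2))
        (derM (mW_der h1 y2) (rY_s S h2 y))) _.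
      by ring.
    move=> y /andP[y0 yx]; have ys1 : y < s1 := lt_le_trans yx xs1.
    rewrite subr_ge0; apply: g_ratio.
    - by apply: p1'; rewrite (ltW y0).
    - by apply/ltW/Y12; rewrite (ltW y0).
    - by apply: le_trans h2M; apply: (Y_le H2 s12 p2'); rewrite (ltW y0) ltW.
  have : Y h2 0 / Y h1 0 <= Y h2 s1 / Y h1 s1.
    apply: (deriv_ge0_le (f := fun x => Y h2 x / Y h1 x)
      (df := fun x => (W h2 x * Y h1 x - W h1 x * Y h2 x) / Y h1 x ^+ 2) s10).
      move=> x /andP[x0 xs].
      have Yx : Y h1 x != 0 by rewrite gt_eqF// p1// x0 (le_trans xs).
      apply: is_derive_eq (derM (rY_s S h2 x) (derV Yx (rY_s S h1 x))) _.
      by field.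
    move=> x /andP[x0 xs]; rewrite divr_ge0 ?sqr_ge0//.
    have mx : 0 < x * (2 - x) by rewrite m_gt0// x0/= lt2// (le_trans (ltW xs)).
    have := D_ge0 x; rewrite (ltW x0) (ltW xs) /D => /(_ isT).
    have -> : Y h1 x * (x * (2 - x) * W h2 x) - x * (2 - x) * W h1 x * Y h2 x =
      x * (2 - x) * (W h2 x * Y h1 x - W h1 x * Y h2 x) by ring.
    by rewrite pmulr_rge0.
  rewrite !rY0 ler_pdivrMr// mulrAC ler_pdivlMr ?p1 ?s10//.
  by rewrite [Y h2 s1 * h1]mulrC.
have lt12 x : 0 <= x <= s -> 0 < Y h2 x - Y h1 x.
  move: x; apply: pos_of_no_zero.
  - by move=> x _; apply: contB; exact: radial_cont (rY_jc S).
  - by rewrite !rY0 subr_gt0.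
  move=> s1 s10 s1s /subr0_eq e Y12.
  have H := ratio s1 (ltW s10) s1s (fun x xs => ltac:(rewrite -subr_gt0; exact: Y12 xs)).
  move: H; rewrite e ler_pM2r; last by apply: p1; rewrite (ltW s10).
  by rewrite leNgt h12.
apply: ratio; [by case/andP: ts|by case/andP: ts|].
move=> x /andP[x0 xt]; rewrite -subr_gt0; apply: lt12.
by rewrite x0 (le_trans (ltW xt))//; case/andP: ts.
Qed.

(** By [compare] with [Y H], a lower solution cannot stay positive up to [S0], so on its way to 0 it
    takes each value below [h]. *)
Lemma level_exists H S0 h a : 0 < H <= M -> 0 <= S0 < 2 - eps -> pos H S0 -> Y H S0 = 0 ->
  0 < h <= H -> 0 <= a <= h -> exists s, [/\ 0 <= s <= S0, pos h s & Y h s = a].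
Proof.
move=> /andP[H0 HM] /andP[S00 S02] pH YH /andP[h0 hH] /andP[a0].
rewrite le_eqVlt => /predU1P[->|ah].
  exists 0; split; rewrite ?lexx ?rY0// => t /andP[t0].
  by rewrite ltNge t0.
have [t tS Yt] : exists2 t, 0 <= t <= S0 & Y h t <= 0.
  apply: contrapT => nex.
  have p1 x : 0 <= x <= S0 -> 0 < Y h x.
    by move=> xS; rewrite ltNge; apply/negP => Yx; apply: nex; exists x.
  have pS0 := p1 S0; rewrite S00 lexx in pS0; move/(_ isT): pS0.
  move: hH; rewrite le_eqVlt => /predU1P[->|hH]; first by rewrite YH ltxx.
  have := @compare h H S0 S0 h0 hH HM S02 p1; rewrite S00 lexx YH mulr0 => /(_ isT).
  by rewrite pmulr_rle0// leNgt => /negP.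
have [|||s [s0 sS /subr0_eq Ys Yp]] := @first_zero R (fun t => Y h t - a) S0.
- by move=> x _; apply: contB; [exact: radial_cont (rY_jc S)|exact: contC].
- by rewrite rY0 subr_gt0.
- by exists t => //; rewrite subr_le0 (le_trans Yt).
exists s; split => //; first by rewrite (ltW s0).
by move=> x /Yp; rewrite subr_gt0; exact: le_lt_trans.
Qed.

Lemma level_unique h s t : 0 < h <= M -> s < 2 - eps -> t < 2 - eps ->
  0 <= s -> 0 <= t -> pos h s -> pos h t -> Y h s = Y h t -> s = t.
Proof.
move=> hM s2 t2 s0 t0 ps pt e; have [st|ts|//] := ltgtP s t.
- by have := Y_decr hM t2 pt s0 st (lexx t); rewrite e ltxx.
- by have := Y_decr hM s2 ps t0 ts (lexx s); rewrite e ltxx.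
Qed.

(** * Level sets of [Y] and the gradient along them *)

Lemma Y_c1 h s : c1 (fun p : R * R => Y p.1 p.2) (h, s).
Proof.
apply: (@c1_two R Y Z W h s 1) => // h' s' _ _; split.
- exact: rY_h.
- exact: rY_s.
- exact: rZ_jc.
- exact: rW_jc.
Qed.

Lemma W_c1 h s : s < 2 - eps -> c1 (fun p : R * R => W p.1 p.2) (h, s).
Proof.
move=> s2; apply: (@c1_two R W V Q h s (2 - eps - s)); first by rewrite subr_gt0.
move=> h' s' _ /ltr_normlW; rewrite ltrD2r => s'2; split.
- exact: rW_h.
- exact: rW_s.
- exact: rV_jc.
- exact: rQ_jc.
Qed.

(* Requiring [W < 0] on [[0, s]] instead of [Y > 0] lets [s] go slightly past
   the zero of [Y h]. *)
Definition reg h s := [/\ 0 < h, h < M, s < 2 - eps & forall t, 0 <= t <= s -> W h t < 0].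

Lemma pos_reg h s : 0 < h < M -> s < 2 - eps -> pos h s -> reg h s.
Proof.
move=> /andP[h0 hM] s2 ph; split => // t ts.
by apply: (W_neg (h := h) (s := s)) => //; rewrite h0 ltW.
Qed.

Lemma reg_pos h s : reg h s -> 0 <= Y h s -> pos h s.
Proof.
move=> [h0 hM s2 Wn] Ys t /andP[t0 ts]; apply: le_lt_trans Ys _.
apply: (deriv_lt0_gt (df := W h) ts) => [x _|x /andP[x1 x2]]; first exact: rY_s.
by apply: Wn; rewrite (le_trans t0 (ltW x1)) ltW.
Qed.

(** By continuity [W h0 < 0] persists up to some [T > s0]; on the compact segment it is bounded away
    from 0, and [W h] is uniformly close to it for [h] near [h0]. *)
Lemma reg_open h0 s0 : reg h0 s0 -> 0 <= s0 -> exists2 d : R, 0 < d &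
  forall h s, `|h - h0| < d -> `|s - s0| < d -> reg h s.
Proof.
move=> [h00 h0M s02 Wn] s0_ge0.
have Ws0 : 0 < - W h0 s0 by rewrite oppr_gt0; apply: Wn; rewrite s0_ge0 lexx.
have Wc t : {for t, continuous (fun t => - W h0 t)}.
  by apply: contN; exact: radial_cont (rW_jc S).
have [d1 d10 d1P] := (cont_realP _ _).1 (Wc s0) _ Ws0.
pose T := s0 + d1 / 2.
have T0 : 0 <= T by rewrite addr_ge0// divr_ge0// ltW.
have WT t : 0 <= t <= T -> 0 < - W h0 t.
  move=> /andP[t0 tT]; have [ts|st] := leP t s0.
    by rewrite oppr_gt0; apply: Wn; rewrite t0.
  have : `|- W h0 t - - W h0 s0| < - W h0 s0.
    apply: d1P; rewrite gtr0_norm ?subr_gt0// ltrBlDl.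
    by apply: le_lt_trans tT _; rewrite /T; move: d10; lra.
  by rewrite ltr_norml => /andP[]; lra.
have [|t1 t1T t1min] := @EVT_min R (fun t => - W h0 t) 0 T T0.
  by apply: continuous_in_subspaceT => t _; exact: Wc.
have c0 : 0 < - W h0 t1 / 2 by rewrite divr_gt0// WT//; move: t1T; rewrite in_itv.
have [d2 d20 d2P] := jc_unif h0 T (rW_jc S) c0.
pose d := Num.min (Num.min d2 (d1 / 2)) (Num.min (Num.min h0 (M - h0)) (2 - eps - s0)).
have d0 : 0 < d by rewrite !lt_min d20 divr_gt0// h00 !subr_gt0 h0M s02.
exists d => // h s; rewrite !lt_min => /andP[/andP[h1 _] /andP[/andP[h2 h3] _]].
move=> /andP[/andP[_ s1] /andP[_ s2]]; split.
- by move: h2; rewrite ltr_norml => /andP[]; lra.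
- by have := ltr_normlW h3; lra.
- by have := ltr_normlW s2; lra.
move=> t /andP[t0 ts].
have tT : t <= T by apply: le_trans ts _; have := ltr_normlW s1; rewrite /T; lra.
have tT' : `|t| <= T by rewrite ger0_norm.
have := d2P h h1 t tT'; rewrite ler_norml => /andP[_ b1].
have := t1min t; rewrite in_itv /= t0 tT => /(_ isT) b2.
have b3 : 0 < - W h0 t1 by apply: WT; move: t1T; rewrite in_itv.
by lra.
Qed.

Lemma der_chain2 (F : R -> R -> R) (al be : R -> R) (t h s Fh Fs a b : R) :
  differentiable (fun p : R * R => F p.1 p.2) ((h, s) : R * R) ->
  al t = h -> be t = s ->
  is_derive h 1 (F ^~ s) Fh -> is_derive s 1 (F h) Fs ->
  is_derive t 1 al a -> is_derive t 1 be b ->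
  is_derive t 1 (fun u => F (al u) (be u)) (Fh * a + Fs * b).
Proof.
move=> Fd ah bs hd sd ad bd.
set G := fun p : R * R => F p.1 p.2 in Fd.
have ds : 'd G (h, s) (0, 1) = Fs.
  exact: der_unique (is_derive_section Fd) sd.
have gd : is_diff h (fun t : R => (t, s)) (fun t : R => (t, 0)).
  exact: (is_diff_pair (is_diff_id h) (is_diff_cst s h)).
have dh : 'd G (h, s) (1, 0) = Fh.
  have gd' : differentiable (fun t : R => (t, s)) h by exact: ex_diff.
  have H : 'D_1 (G \o (fun t : R => (t, s))) h = Fh by exact: derive_val.
  rewrite -H deriveE; last by apply: differentiable_comp.
  by rewrite (diff_comp gd' Fd) /= diff_val.
have adif : differentiable al t by apply/derivable1_diffP; exact: ex_derive.
have bdif : differentiable be t by apply/derivable1_diffP; exact: ex_derive.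
have pd := is_diff_pair (differentiableP adif) (differentiableP bdif).
have cd : differentiable (fun u : R => (al u, be u)) t by exact: (@ex_diff _ _ _ _ _ _ _ pd).
have Gd : differentiable G (al t, be t) by rewrite ah bs.
have Hd : differentiable (G \o (fun u : R => (al u, be u))) t by exact: differentiable_comp.
have E : 'd (fun u : R => (al u, be u)) t 1 = ('d al t 1, 'd be t 1).
  by rewrite (diff_val (is_diff_def := pd)).
split; first exact: diff_derivable.
rewrite deriveE// (diff_comp cd Gd) /= E ah bs.
have -> : 'd al t 1 = a by rewrite -deriveE//; exact: derive_val.
have -> : 'd be t 1 = b by rewrite -deriveE//; exact: derive_val.
have -> : (a, b) = a *: (1, 0) + b *: (0, 1) :> R * R.
  by congr pair; rewrite /= ?scaler0 ?addr0 ?add0r /GRing.scale /= mulr1.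
by rewrite linearD !linearZ /= dh ds /GRing.scale /= mulrC [_ * Fs]mulrC.
Qed.

Definition gradsq h s := s * (2 - s) * W h s ^+ 2.

(** Since [W] is the derivative of [Y] in the depth, the equation [Y h s = a] can be solved for [s]
    near the given point, in terms of height and value. *)
Lemma level_c1 h0 s0 : W h0 s0 != 0 -> exists sg : R * R -> R,
  [/\ sg (h0, Y h0 s0) = s0, c1 sg (h0, Y h0 s0) &
      \forall p \near ((h0, Y h0 s0) : R * R), Y p.1 (sg p) = p.2].
Proof.
move=> Wn; pose F := fun q : (R * R) * R => Y q.1.1 q.2 - q.1.2.
have Fc : c1 F ((h0, Y h0 s0), s0).
  apply: c1B; last by apply: (c1_comp_fst (f := fun p : R * R => p.2)); exact: c1_snd.
  apply: (c1_comp (f := fun q : (R * R) * R => (q.1.1, q.2)) (g := fun p : R * R => Y p.1 p.2)).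
    apply: c1_pair; last exact: c1_snd.
    by apply: (c1_comp_fst (f := fun p : R * R => p.1)); exact: c1_fst.
  exact: Y_c1.
have [||sg [sg0 sgc sgY _]] := implicit_function Fc.
- by rewrite /F /= subrr.
- by rewrite (der_unique (is_derive_section (c1_diff Fc))
    (derB (rY_s S h0 s0) (derC (Y h0 s0) s0))) subr0.
exists sg; split => //; apply: filterS sgY => p; exact: subr0_eq.
Qed.

(** Differentiating [Y h (phi h) = a] gives [W phi' = - Z]. This eliminates [phi'], the equation
    eliminates [Q], and what remains is [2 J]. *)
Lemma gradsq_level_der (phi : R -> R) h0 s0 a : s0 < 2 - eps -> W h0 s0 != 0 ->
  phi h0 = s0 -> differentiable phi h0 -> (\forall h \near h0, Y h (phi h) = a) ->
  is_derive h0 1 (fun h => gradsq h (phi h)) (2 * J h0 s0).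
Proof.
move=> s02 Wne ph pdiff pY.
have pd : is_derive h0 1 phi ('D_1 phi h0).
  by apply: derivableP; apply/derivable1_diffP.
have eq0 : Z h0 s0 + W h0 s0 * 'D_1 phi h0 = 0.
  have D1 := der_chain2 (al := id) (c1_diff (Y_c1 h0 s0)) erefl ph (rY_h S h0 s0) (rY_s S h0 s0)
    (derI h0) pd.
  have D2 : is_derive h0 1 (fun t => Y t (phi t)) 0.
    apply: near_eq_is_derive (derC a h0).
    by apply: filterS pY => h /= ->.
  by rewrite mulr1 in D1; exact: der_unique D1 D2.
have WD := der_chain2 (al := id) (c1_diff (W_c1 h0 s02)) erefl ph (rW_h S h0 s0) (rW_s S h0 s02)
  (derI h0) pd.
apply: is_derive_eq (derM (derM pd (derB (derC 2 h0) pd)) (derM WD WD)) _.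
rewrite /= ph !mulr1; set p := 'D_1 phi h0 in eq0 *.
have -> : (p * (2 - s0) + s0 * (0 - p)) * (W h0 s0 * W h0 s0) +
    s0 * (2 - s0) * ((V h0 s0 + Q h0 s0 * p) * W h0 s0 + W h0 s0 * (V h0 s0 + Q h0 s0 * p)) =
  2 * (1 - s0) * W h0 s0 * (W h0 s0 * p) + 2 * (s0 * (2 - s0)) * V h0 s0 * W h0 s0 +
    2 * (s0 * (2 - s0) * Q h0 s0) * (W h0 s0 * p) by ring.
have -> : W h0 s0 * p = - Z h0 s0 by apply/eqP; rewrite -addr_eq0 addrC eq0.
by rewrite rQ_ode// /J; ring.
Qed.

Lemma level_curve h0 s0 a : 0 < h0 < M -> 0 < s0 < 2 - eps -> pos h0 s0 ->
  Y h0 s0 = a -> 0 <= a ->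
  exists phi : R -> R, [/\ phi h0 = s0,
    is_derive h0 1 (fun h => gradsq h (phi h)) (2 * J h0 s0) &
    \forall h \near h0, [/\ 0 < phi h, phi h < 2 - eps, pos h (phi h) & Y h (phi h) = a]].
Proof.
move=> h0M /andP[s00 s02] p0 Ys a0.
have hM : 0 < h0 <= M by case/andP: h0M => -> /ltW.
have r0 := pos_reg h0M s02 p0.
have Wn : W h0 s0 != 0.
  by rewrite lt_eqF// (W_neg hM s02 p0)// (ltW s00) lexx.
have [sg] := level_c1 Wn; rewrite Ys => -[sg0 sgc sgY].
pose phi h := sg (h, a).
have pc : c1 phi h0.
  apply: (c1_comp (f := fun h : R => (h, a)) (g := sg)) => //.
  by apply: c1_pair; [exact: c1_id|exact: c1_cst].
have pY : \forall h \near h0, Y h (phi h) = a.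
  have /(_ _ sgY) : {for h0, continuous (fun h : R => (h, a))}.
    by apply: cont_pair; [exact: cvg_id|exact: cvg_cst].
  by [].
exists phi; split => //; first exact: gradsq_level_der (c1_diff pc) pY.
have [d d0 dP] := reg_open r0 (ltW s00).
have dm0 : 0 < Num.min d s0 by rewrite lt_min d0.
have [d' d'0 d'P] := (cont_realP _ _).1 (c1_cont pc) _ dm0.
near=> h.
have hd' : `|h - h0| < d'.
  by near: h; apply/near_realP; exists d'.
have hd : `|h - h0| < d by near: h; apply/near_realP; exists d.
have := d'P h hd'; rewrite [phi h0]sg0 lt_min => /andP[p1 p2].
have Yh : Y h (phi h) = a by near: h.
have rh := dP h (phi h) hd p1.
split => //.
+ by move: p2; rewrite ltr_norml => /andP[]; lra.
+ by case: rh.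
+ by apply: reg_pos => //; rewrite Yh.
Unshelve. all: by end_near. Qed.

(** The solution of height [H] reaches 0 before the truncation. By [compare] so does each lower one,
    and the level curves below cover the whole range of heights up to [H]. *)
Definition full H := exists S0, [/\ 0 < H < M, 0 <= S0 < 2 - eps, pos H S0 & Y H S0 = 0].

Definition lvl a h : R :=
  xget 0 [set s | [/\ 0 <= s, s < 2 - eps, pos h s & Y h s = a]].

Lemma lvlE a h s : 0 < h <= M -> 0 <= s -> s < 2 - eps -> pos h s -> Y h s = a ->
  lvl a h = s.
Proof.
move=> hM s0 s2 ps Ys; rewrite /lvl; case: xgetP => [t _ [t0 t2 pt Yt]|/(_ s)]; last by case.
by apply: (@level_unique h) => //; rewrite Yt.
Qed.

Lemma lvlP H h a : full H -> 0 <= a -> a < h -> h <= H ->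
  [/\ 0 < h < M, 0 < lvl a h < 2 - eps, pos h (lvl a h) & Y h (lvl a h) = a].
Proof.
move=> [S0 [/andP[H0 HM] S02 pH YH]] a0 ah hH.
have h0 : 0 < h by exact: le_lt_trans ah.
have hM : h < M by exact: le_lt_trans HM.
have [|||s [/andP[s0 sS] ps Ys]] := @level_exists H S0 h a _ S02 pH YH.
- by rewrite H0 ltW.
- by rewrite h0.
- by rewrite a0 ltW.
have s2 : s < 2 - eps by apply: le_lt_trans sS _; case/andP: S02.
have -> : lvl a h = s by apply: lvlE => //; rewrite h0 ltW.
split => //; first by rewrite h0.
rewrite s2 andbT lt_neqAle s0 andbT; apply/eqP => E.
by move: Ys ah; rewrite -E rY0 => ->; rewrite ltxx.
Qed.

Lemma lvl_gradsq_der H h a : full H -> 0 <= a -> a < h -> h <= H ->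
  is_derive h 1 (fun h => gradsq h (lvl a h)) (2 * J h (lvl a h)).
Proof.
move=> fH a0 ah hH; have [hM l0 pl Yl] := lvlP fH a0 ah hH.
have [phi [ph pd pn]] := level_curve hM l0 pl Yl a0.
have [h0 hM1] := andP hM.
have hM' : 0 < M - h by rewrite subr_gt0.
have n1 : \forall t \near h, `|t - h| < h by apply/near_realP; exists h.
have n2 : \forall t \near h, `|t - h| < M - h by apply/near_realP; exists (M - h).
apply: near_eq_is_derive pd; near=> t.
have tM : 0 < t <= M.
  have t1 : `|t - h| < h by near: t.
  have t2 : `|t - h| < M - h by near: t.
  by move: t1 t2; rewrite !ltr_norml => /andP[? _] /andP[_ ?]; apply/andP; split; lra.
have [p0 p2 pp Yp] : [/\ 0 < phi t, phi t < 2 - eps, pos t (phi t) & Y t (phi t) = a].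
  by near: t.
by rewrite (@lvlE a t (phi t))// ltW.
Unshelve. all: by end_near. Qed.

Lemma gradsq_incr H h1 h2 a : full H -> 0 <= a -> a < h1 -> h1 < h2 -> h2 <= H ->
  gradsq h1 (lvl a h1) < gradsq h2 (lvl a h2).
Proof.
move=> fH a0 ah1 h12 h2H.
have [c /andP[c1' c2'] e] := @mvt R (fun h => gradsq h (lvl a h)) (fun h => 2 * J h (lvl a h)) h1 h2 h12
  (fun h hh => lvl_gradsq_der fH a0 (lt_le_trans ah1 (andP hh).1) (le_trans (andP hh).2 h2H)).
rewrite -subr_gt0 e mulr_gt0 ?subr_gt0// mulr_gt0//.
have [/andP[h0 hM] /andP[l0 l2] pl Yl] := lvlP fH a0 (lt_trans ah1 c1') (le_trans (ltW c2') h2H).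
apply: (@J_gt0 c (lvl a c)) => //; first by rewrite h0 ltW.
by rewrite lexx ltW.
Qed.

(** * Estimates for low and for large heights *)

Lemma P_der h s : s < 2 - eps ->
  is_derive s 1 (fun t => - (t * (2 - t) * W h t)) (g (Y h s)).
Proof. by move=> s2; apply: is_derive_eq (derN (mW_der h s2)) _; rewrite opprK. Qed.

(** Let [P = - s (2 - s) W] and [q = (2 - s) * gradsq h s], so that [P ^ 2 = s q]. The energy
    [P ^ 2 + 2 F Y] is nonincreasing as [s (2 - s) <= 1] and [g <= F]; hence [s q <= 2 F (h - a)].
    Also [P <= F s], that is [q <= F ^ 2 s]. Multiplying the second bound by [q] and inserting the
    first removes [s], which may tend to 0. *)
Lemma gradsq_small h s a F : 0 < h <= M -> 0 < s < 2 - eps -> pos h s -> Y h s = a ->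
  0 <= a -> (forall x, 0 <= x <= M -> g x <= F) ->
  ((2 - s) * gradsq h s) ^+ 2 <= 2 * F ^+ 3 * (h - a).
Proof.
move=> hM /andP[s0 s2] ps Ys a0 gF.
have [h0 hM'] := andP hM.
have lt2 x : x <= s -> x < 2 - eps by move=> xs; apply: le_lt_trans s2.
have Yb x : 0 <= x <= s -> 0 <= Y h x <= M.
  move=> /andP[x0 xs]; rewrite (le_trans (Y_le hM s2 ps _) hM') ?x0// andbT.
  move: xs; rewrite le_eqVlt => /predU1P[->|xs]; first by rewrite Ys.
  by apply/ltW/ps; rewrite x0.
have F0 : 0 <= F.
  by apply: le_trans (gF h _); [apply/ltW/g_pos|rewrite (ltW h0)].
pose P t := - (t * (2 - t) * W h t).
have P00 : P 0 = 0 by rewrite /P !mul0r oppr0.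
have Pd x : x <= s -> is_derive x 1 P (g (Y h x)) by move=> xs; apply: P_der; exact: lt2.
have P1 : P s ^+ 2 + 2 * F * a <= 2 * F * h.
  have : P s ^+ 2 + 2 * F * Y h s <= P 0 ^+ 2 + 2 * F * Y h 0.
    apply: (deriv_le0_ge (f := fun t => P t ^+ 2 + 2 * F * Y h t)
      (df := fun t => 2 * (- W h t) * (t * (2 - t) * g (Y h t) - F)) (ltW s0)).
      move=> x /andP[_ xs].
      apply: is_derive_eq (derD (derM (Pd x xs) (Pd x xs)) (derM (derC (2 * F) x) (rY_s S h x))) _.
      by rewrite /P; ring.
    move=> x /andP[x0 xs].
    have xb : 0 <= x <= s by rewrite !ltW.
    have := W_neg hM s2 ps xb => Wx.
    apply: mulr_ge0_le0; first by rewrite mulr_ge0// oppr_ge0 ltW.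
    have g0 : 0 <= g (Y h x) by apply/ltW/(gY_ge0 hM s2 ps); rewrite (ltW x0).
    have gFx := gF _ (Yb x xb).
    have m1 : x * (2 - x) <= 1.
      by have := sqr_ge0 (x - 1); rewrite expr2; lra.
    have m0 : 0 <= x * (2 - x) by apply/ltW/m_gt0; rewrite x0/= lt2// ltW.
    rewrite subr_le0; apply: le_trans gFx.
    by rewrite ler_piMl.
  by rewrite P00 expr0n /= add0r rY0 Ys.
have P2 : P s <= F * s.
  have : P s - F * s <= P 0 - F * 0.
    apply: (deriv_le0_ge (f := fun t => P t - F * t)
      (df := fun t => g (Y h t) - (0 * t + F * 1)) (ltW s0)).
      by move=> x /andP[_ xs]; exact: (derB (Pd x xs) (derM (derC F x) (derI x))).
    move=> x /andP[x0 xs]; rewrite mul0r add0r mulr1 subr_le0; apply: gF.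
    by apply: Yb; rewrite !ltW.
  by rewrite P00 mulr0 subrr subr_le0.
have P0 : 0 <= P s.
  rewrite oppr_ge0 mulr_ge0_le0//; first by apply/ltW/m_gt0; rewrite s0.
  by apply/ltW/(W_neg hM s2 ps); rewrite (ltW s0) lexx.
have PE : P s ^+ 2 = s * (2 - s) * gradsq h s by rewrite /P /gradsq; ring.
have k0 : 0 <= 2 - s by move: eps_gt0; lra.
have b0 : 0 <= gradsq h s by rewrite mulr_ge0 ?sqr_ge0// mulr_ge0// ltW.
have A1 : s * ((2 - s) * gradsq h s) <= 2 * F * (h - a).
  by move: P1; rewrite PE; lra.
have A2 : (2 - s) * gradsq h s <= F ^+ 2 * s.
  have : P s ^+ 2 <= (F * s) ^+ 2 by rewrite ler_sqr ?nnegrE// mulr_ge0// ltW.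
  rewrite PE (_ : s * (2 - s) * gradsq h s = s * ((2 - s) * gradsq h s)); last by ring.
  rewrite (_ : (F * s) ^+ 2 = s * (F ^+ 2 * s)); last by ring.
  by rewrite ler_pM2l.
set q := (2 - s) * gradsq h s in A1 A2 *.
have q0 : 0 <= q by rewrite mulr_ge0.
apply: (@le_trans _ _ (F ^+ 2 * s * q)); first by rewrite expr2 ler_wpM2r.
rewrite (_ : F ^+ 2 * s * q = F ^+ 2 * (s * q)); last by ring.
rewrite (_ : 2 * F ^+ 3 * (h - a) = F ^+ 2 * (2 * F * (h - a))); last by ring.
by rewrite ler_wpM2l// sqr_ge0.
Qed.

(** As [P = - x (2 - x) W] is nondecreasing, its value at [s] bounds the slope before [s] by
    [2 b / (s0 sqrt (2 - x))]. This is integrable up to [x = 2], so the drop from [k] to [a] is at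
    most [8 b / s0], uniformly in [eps]. *)
Lemma gradsq_large h s a s0 k b : 0 < h <= M -> 0 < s0 -> s0 <= s -> s < 2 - eps ->
  pos h s -> Y h s = a -> k <= Y h s0 -> 0 <= b -> gradsq h s = b ^+ 2 ->
  s0 * (k - a) <= 8 * b.
Proof.
move=> hM s00 ss s2 ps Ys Yk b0 gb.
have s_gt0 : 0 < s by exact: lt_le_trans ss.
have lt2 x : x <= s -> x < 2 - eps by move=> xs; apply: le_lt_trans s2.
have q_pos x : x <= s -> 0 < 2 - x by move=> /lt2; move: eps_gt0; lra.
pose q x : R := Num.sqrt (2 - x).
have q0 x : x <= s -> 0 < q x by move=> xs; rewrite sqrtr_gt0 q_pos.
have qq x : x <= s -> q x ^+ 2 = 2 - x by move=> xs; rewrite sqr_sqrtr// ltW// q_pos.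
pose P t := - (t * (2 - t) * W h t).
have qd x : x <= s -> is_derive x 1 q (- (2 * q x)^-1).
  move=> xs; have sd := is_derive1_sqrt (q_pos x xs).
  apply: is_derive_eq (der_comp (f := Num.sqrt) (g := fun t : R => 2 - t) sd
    (derB (derC 2 x) (derI x))) _.
  by rewrite sub0r mulrN1.
have W_ge x : s0 <= x <= s -> - W h x <= 2 * b / (s0 * q x).
  move=> /andP[x1 x2]; have x0 : 0 < x by exact: lt_le_trans x1.
  have xb : 0 <= x <= s by rewrite x2 ltW.
  have P1 : P x <= P s.
    apply: (deriv_ge0_le (df := fun t => g (Y h t)) x2).
      by move=> y /andP[_ ys]; apply: P_der; exact: lt2.
    move=> y /andP[y1 y2]; apply/ltW/(gY_ge0 hM s2 ps).
    by rewrite y2 andbT (le_trans (ltW x0)) ?ltW.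
  have Ps : P s ^+ 2 = s * (2 - s) * b ^+ 2 by rewrite -gb /P /gradsq; ring.
  have Pb : P s <= 2 * q x * b.
    have B0 : 0 <= 2 * q x * b by rewrite !mulr_ge0// ltW// q0.
    have P0 : 0 <= P s.
      rewrite oppr_ge0 mulr_ge0_le0//; first by apply/ltW/m_gt0; rewrite s_gt0.
      by apply/ltW/(W_neg hM s2 ps); rewrite (ltW s_gt0) lexx.
    rewrite -ler_sqr ?nnegrE// Ps (_ : (2 * q x * b) ^+ 2 = 4 * q x ^+ 2 * b ^+ 2); last by ring.
    rewrite qq// ler_wpM2r ?sqr_ge0//.
    have e2 := q_pos s (lexx s); have s2' : s <= 2 by lra.
    apply: (@le_trans _ _ (2 * (2 - s))); first by rewrite ler_wpM2r// ltW.
    by move: e2 x2; lra.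
  have qx := q0 x x2.
  rewrite ler_pdivlMr ?mulr_gt0//.
  rewrite -(ler_pM2r qx).
  have -> : - W h x * (s0 * q x) * q x = s0 * (q x ^+ 2) * (- W h x) by ring.
  rewrite qq//.
  have Wx : 0 <= - W h x by rewrite oppr_ge0 ltW// (W_neg hM s2 ps).
  apply: (@le_trans _ _ (P x)).
    rewrite (_ : P x = x * (2 - x) * - W h x); last by rewrite /P; ring.
    by rewrite ler_wpM2r// ler_wpM2r// ltW// q_pos.
  by apply: le_trans P1 _; apply: le_trans Pb _; rewrite (_ : 2 * b * q x = 2 * q x * b)//; ring.
have : Y h s0 - 4 * b / s0 * q s0 <= Y h s - 4 * b / s0 * q s.
  apply: (deriv_ge0_le (f := fun t => Y h t - 4 * b / s0 * q t)
    (df := fun t => W h t - (0 * q t + 4 * b / s0 * - (2 * q t)^-1)) ss).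
    by move=> x /andP[_ xs]; exact: (derB (rY_s S h x) (derM (derC (4 * b / s0) x) (qd x xs))).
  move=> x /andP[x1 x2]; have xs : s0 <= x <= s by rewrite !ltW.
  have qx := q0 x (ltW x2).
  have := W_ge x xs.
  have -> : 0 * q x + 4 * b / s0 * - (2 * q x)^-1 = - (2 * b / (s0 * q x)).
    by field; rewrite !gt_eqF.
  by lra.
rewrite Ys => H.
have q2 : q s0 <= 2.
  rewrite -ler_sqr ?nnegrE ?(ltW (q0 _ ss))// qq//.
  by rewrite (_ : 2 ^+ 2 = 4 :> R); [lra|ring].
have c0 : 0 <= 4 * b / s0 by rewrite divr_ge0 ?mulr_ge0// ltW.
have Q1 : k - a <= 4 * b / s0 * 2.
  have h1 : 4 * b / s0 * q s0 <= 4 * b / s0 * 2 by rewrite ler_wpM2l.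
  have h2 : 0 <= 4 * b / s0 * q s by rewrite mulr_ge0// ltW// q0.
  by lra.
rewrite mulrC -ler_pdivlMr//.
by rewrite (_ : 8 * b / s0 = 4 * b / s0 * 2)//; ring.
Qed.

(** On the unit interval [2 - x >= 1], so the slope of [Y h] is at least [- F] until it first drops
    to [h / 2]. *)
Lemma Y_half h t F : 0 < h <= M -> (forall x, 0 <= x <= h -> g x <= F) ->
  0 <= t <= 1 -> F * t < h / 2 -> h / 2 < Y h t.
Proof.
move=> hM gF /andP[t0 t1] Ft; have [h0 hM'] := andP hM.
have F0 : 0 <= F.
  by apply: le_trans (gF h _); [apply/ltW/g_pos|rewrite (ltW h0) lexx].
have t2 : t < 2 - eps by move: eps_lt1; lra.
suff : forall x, 0 <= x <= t -> 0 < Y h x - h / 2.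
  by move=> /(_ t); rewrite t0 lexx subr_gt0; apply.
apply: pos_of_no_zero.
- by move=> x _; apply: contB; [exact: radial_cont (rY_jc S)|exact: contC].
- by rewrite rY0; lra.
move=> s1 s10 s1t /subr0_eq Ys1 Yp.
have s12 : s1 < 2 - eps by exact: le_lt_trans t2.
have ps : pos h s1 by move=> x /Yp; rewrite subr_gt0; apply: lt_trans; rewrite divr_gt0.
have : Y h 0 + F * 0 <= Y h s1 + F * s1.
  apply: (deriv_ge0_le (f := fun x => Y h x + F * x)
    (df := fun x => W h x + (0 * x + F * 1)) (ltW s10)).
    by move=> x _; exact: (derD (rY_s S h x) (derM (derC F x) (derI x))).
  move=> x /andP[x0 xs]; rewrite mul0r add0r mulr1.
  have x2 : x < 2 - eps by exact: lt_trans xs s12.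
  have x1 : x <= 1 by apply: le_trans t1; apply: le_trans s1t; exact: ltW.
  rewrite rW_avg//.
  have gc : continuous (fun r : R => g (Y h r)).
    move=> r; exact: is_derive_continuous (der_comp (f := g) (g_der _) (rY_s S h r)).
  have [xi xi01 ->] := avg_mean x gc.
  have xix : 0 <= xi * x <= s1.
    case/andP: xi01 => y0 y1; rewrite mulr_ge0 ?(ltW x0)//=.
    by apply: le_trans (ltW xs); rewrite ler_piMl// ltW.
  have gY : g (Y h (xi * x)) <= F.
    apply: gF; rewrite (Y_le hM s12 ps xix) andbT.
    have [y0 y1] := andP xix.
    move: y1; rewrite le_eqVlt => /predU1P[->|y1]; first by rewrite Ys1 divr_ge0// ltW.
    by apply/ltW/ps; rewrite y0.
  rewrite addrC subr_ge0 ler_pdivrMr; last by lra.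
  by apply: le_trans gY _; rewrite ler_peMr//; lra.
rewrite mulr0 addr0 rY0 Ys1 => H.
have : F * s1 <= F * t by rewrite ler_wpM2l.
by lra.
Qed.

(** If [Y h] stayed positive, [P = - x (2 - x) W] would be at least [c0 t1] beyond [t1], so
    [- W >= c0 t1 / (2 (2 - x))]. The integral of this grows like a logarithm near 2, and the last
    hypothesis says that it exceeds [h]. *)
Lemma full_exists h t1 F c0 : 0 < h < M -> (forall x, 0 <= x <= h -> g x <= F) ->
  (forall x, h / 2 <= x <= h -> c0 <= g x) -> 0 < c0 ->
  0 < t1 <= 1 -> F * t1 < h / 2 -> eps < 1 / 2 ->
  h + c0 * t1 / 2 * ln (2 * eps) < 0 -> full h.
Proof.
move=> /andP[h0 hM'] gF gc0 c0_gt0 /andP[t10 t11] Ft1 epsh lneg.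
have hM : 0 < h <= M by rewrite h0 ltW.
(* Close enough to 2 for the logarithm to win, yet strictly inside the region [s < 2 - eps] where
   the equation holds. *)
pose s := 2 - 2 * eps.
have s2 : s < 2 - eps by rewrite /s; move: eps_gt0; lra.
have s0 : 0 < s by rewrite /s; lra.
have [t tS Yt] : exists2 t, 0 <= t <= s & Y h t <= 0.
  apply: contrapT => nex.
  have p1 x : 0 <= x <= s -> 0 < Y h x.
    by move=> xS; rewrite ltNge; apply/negP => Yx; apply: nex; exists x.
  have ps : pos h s by move=> x /andP[x0 xs]; apply: p1; rewrite x0 ltW.
  have lt2 x : x <= s -> x < 2 - eps by move=> xs; apply: le_lt_trans s2.
  have t1s : t1 <= s by rewrite /s; lra.
  pose P t := - (t * (2 - t) * W h t).
  have P00 : P 0 = 0 by rewrite /P !mul0r oppr0.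
  have Pt1 : c0 * t1 <= P t1.
    have : P 0 - c0 * 0 <= P t1 - c0 * t1.
      apply: (deriv_ge0_le (f := fun t => P t - c0 * t)
        (df := fun t => g (Y h t) - (0 * t + c0 * 1)) (ltW t10)).
        move=> x /andP[_ xt].
        exact: (derB (P_der h (lt2 x (le_trans xt t1s))) (derM (derC c0 x) (derI x))).
      move=> x /andP[x0 xt]; rewrite mul0r add0r mulr1 subr_ge0; apply: gc0.
      rewrite (Y_le hM s2 ps) ?andbT; last by rewrite (ltW x0)/= (le_trans (ltW xt)).
      apply/ltW; apply: (Y_half hM gF); first by rewrite (ltW x0) (le_trans (ltW xt)).
      apply: le_lt_trans Ft1; rewrite ler_wpM2l ?(ltW xt)//.
      by apply: le_trans (gF h _); [apply/ltW/g_pos|rewrite (ltW h0) lexx].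
    by rewrite P00 mulr0 subrr subr_ge0.
  have : Y h s - c0 * t1 / 2 * ln (2 - s) <= Y h t1 - c0 * t1 / 2 * ln (2 - t1).
    apply: (deriv_le0_ge (f := fun t => Y h t - c0 * t1 / 2 * ln (2 - t))
      (df := fun t => W h t - (0 * ln (2 - t) + c0 * t1 / 2 * ((2 - t)^-1 * (0 - 1)))) t1s).
      move=> x /andP[_ xs]; have x2 : 0 < 2 - x by have := lt2 x xs; move: eps_gt0; lra.
      exact: (derB (rY_s S h x) (derM (derC (c0 * t1 / 2) x)
        (der_comp (f := @ln R) (g := fun t : R => 2 - t) (is_derive1_ln x2)
          (derB (derC 2 x) (derI x))))).
    move=> x /andP[x1 xs]; have x2 : 0 < 2 - x by have := lt2 x (ltW xs); move: eps_gt0; lra.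
    have x0 : 0 < x by exact: lt_trans x1.
    have Px : c0 * t1 <= P x.
      apply: le_trans Pt1 _; apply: (deriv_ge0_le (df := fun t => g (Y h t)) (ltW x1)).
        by move=> y /andP[_ yx]; apply: P_der; apply: lt2; rewrite (le_trans yx)// ltW.
      move=> y /andP[y1 y2]; apply/ltW/(gY_ge0 hM s2 ps).
      by rewrite (lt_trans y2)// andbT (le_trans (ltW t10))// ltW.
    rewrite mul0r add0r sub0r mulrN1 mulrN opprK.
    rewrite -(pmulr_rle0 _ (mulr_gt0 x0 x2)).
    have -> : x * (2 - x) * (W h x + c0 * t1 / 2 * (2 - x)^-1) = c0 * t1 * x / 2 - P x.
      by rewrite /P; field; rewrite gt_eqF.
    rewrite subr_le0; apply: le_trans Px.
    have : c0 * t1 * x <= c0 * t1 * 2 by rewrite ler_pM2l ?mulr_gt0//; lra.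
    by lra.
  have -> : 2 - s = 2 * eps by rewrite /s; ring.
  have ln0 : 0 <= ln (2 - t1) by rewrite ln_ge0//; lra.
  have Yt1 : Y h t1 <= h by apply: (Y_le hM s2 ps); rewrite (ltW t10).
  have Yspos : 0 < Y h s by apply: p1; rewrite lexx ltW.
  have : 0 <= c0 * t1 / 2 * ln (2 - t1) by rewrite mulr_ge0// divr_ge0// mulr_ge0 ?ltW.
  by lra.
have [|||S0 [S00 SS YS pS]] := @first_zero R (Y h) s _ _ _.
- by move=> x _; exact: radial_cont (rY_jc S).
- by rewrite rY0.
- by exists t.
exists S0; split => //; first by rewrite h0.
by rewrite (ltW S00) (le_lt_trans SS).
Qed.
End Region.

(** Only agreement of the nonlinearities along the first solution is required: the difference of the
    solutions then satisfies a homogeneous Gronwall inequality with the Lipschitz constant of [g'].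
    This makes all later notions independent of the truncation. *)
Lemma radial_agree (R : realType) (g g1 g' g1' : R -> R) (eps eps' L : R)
    (S : radial_system g g1 eps) (S' : radial_system g' g1' eps') (h s : R) :
  0 < eps -> 0 < eps' -> continuous g -> continuous g' -> 0 <= L ->
  (forall x y, `|g' x - g' y| <= L * `|x - y|) ->
  0 <= s -> s < 2 - eps -> s < 2 - eps' ->
  (forall t, 0 <= t <= s -> g' (rY S h t) = g (rY S h t)) ->
  forall t, 0 <= t <= s -> rY S' h t = rY S h t /\ rW S' h t = rW S h t.
Proof.
move=> e0 e0' gc gc' L0 gL s0 s2 s2' agree.
have Yc : continuous (rY S h) by move=> x; exact: is_derive_continuous (rY_s S h x).
have Yc' : continuous (rY S' h) by move=> x; exact: is_derive_continuous (rY_s S' h x).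
have kc : continuous (fun r => g (rY S h r)).
  by apply: contR => x; apply: cont_comp; [exact: gc|exact: Yc].
have kc' : continuous (fun r => g' (rY S' h r)).
  by apply: contR => x; apply: cont_comp; [exact: gc'|exact: Yc'].
have dW x : 0 <= x <= s -> exists2 xi : R, 0 <= xi <= 1 &
    rW S' h x - rW S h x = - ((g' (rY S' h (xi * x)) - g' (rY S h (xi * x))) / (2 - x)).
  move=> /andP[x0 xs].
  have kB : continuous (fun r => g' (rY S' h r) - g (rY S h r)).
    by apply: contR => y; apply: contB; [exact: kc'|exact: kc].
  have [xi xi01 e] := avg_mean x kB; exists xi => //.
  rewrite !rW_avg ?(le_lt_trans xs)//.
  rewrite agree; last first.
    have [y0 y1] := andP xi01; rewrite mulr_ge0//=.
    by apply: le_trans xs; rewrite ler_piMl.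
  by rewrite -e avgB//; ring.
have YE t : 0 <= t <= s -> rY S' h t = rY S h t.
  move=> /andP[t0 ts]; apply/eqP; rewrite -subr_eq0 -normr_le0.
  have K0 : 0 < L / eps + 1 by rewrite ltr_wpDl// divr_ge0// ltW.
  have := @gronwall R (fun x => rY S' h x - rY S h x) (fun x => rW S' h x - rW S h x)
    (L / eps + 1) 0 t K0 (lexx 0).
  rewrite !rY0 subrr normr0 mul0r addr0 mulr0 mul0r; apply.
    by move=> x _; exact: (derB (rY_s S' h _) (rY_s S h _)).
  move=> x /andP[x0 x1]; have xt : 0 <= x * t <= s.
    by rewrite mulr_ge0//= (le_trans _ ts)// ler_piMl.
  have [xi xi01 ->] := dW _ xt; exists xi => //; rewrite addr0.
  have x2 : eps <= 2 - x * t by case/andP: xt => _; move: s2; lra.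
  have x20 : 0 < 2 - x * t by exact: lt_le_trans x2.
  rewrite normrN normrM normfV (gtr0_norm x20) ler_pdivrMr//.
  apply: le_trans (gL _ _) _; rewrite mulrAC ler_wpM2r//.
  rewrite -ler_pdivrMr//; apply: (@le_trans _ _ (L / eps)); last by rewrite lerDl.
  by rewrite ler_wpM2l// lef_pV2.
move=> t ts; split; first exact: YE.
apply/eqP; rewrite -subr_eq0; have [xi xi01 ->] := dW t ts.
rewrite YE ?subrr ?mul0r ?oppr0//.
have [t0 t1] := andP ts; have [y0 y1] := andP xi01; rewrite mulr_ge0//=.
by apply: le_trans t1; rewrite ler_piMl.
Qed.

(** * Height and depth as functions of the value and the gradient *)

Section Cutoff.
Variables (R : realType) (f : R -> R).
Hypothesis f_derivable : forall x : R, derivable f x 1.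
Hypothesis f_C1 : continuous (derive1 f).
Hypothesis f_pos : forall x : R, 0 < x -> 0 < f x.
Hypothesis f_sub : forall x : R, 0 < x -> x * derive1 f x <= f x.
Implicit Types (n : nat) (h s t a b x y : R).

Definition bound n : R := n.+1%:R.
(** One index drives both truncations, of the heights by [bound] and of the depths by [margin]; with
    [n.+3] the margin is always below [1 / 2], as [full_exists] requires. *)
Definition margin n : R := n.+3%:R^-1.
Definition clamp n x : R := Num.max 0 (Num.min (bound n) x).
(* The derivative of [f] is frozen outside [[0, bound n]], which makes the
   nonlinearity globally Lipschitz. *)
Definition cutoff1 n x : R := derive1 f (clamp n x).
Definition cutoff n x : R := f 0 + prim (cutoff1 n) x.

Lemma bound_gt0 n : 0 < bound n. Proof. by rewrite ltr0n. Qed.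

Lemma bound_le m n : (m <= n)%N -> bound m <= bound n.
Proof. by move=> mn; rewrite ler_nat ltnS. Qed.

Lemma margin_gt0 n : 0 < margin n. Proof. by rewrite invr_gt0 ltr0n. Qed.

Lemma margin_lt n : margin n < 1 / 2.
Proof.
rewrite div1r ltf_pV2 ?posrE ?ltr0n//.
by rewrite ltr_nat.
Qed.

Lemma margin_lt1 n : margin n < 1.
Proof. by have := margin_lt n; lra. Qed.

Lemma margin_le m n : (m <= n)%N -> margin n <= margin m.
Proof. by move=> mn; rewrite lef_pV2 ?posrE ?ltr0n// ler_nat. Qed.

Lemma f_der x : is_derive x 1 f (derive1 f x).
Proof. by rewrite derive1E; apply: derivableP; exact: f_derivable. Qed.

Lemma f_cont : continuous f.
Proof. by move=> x; exact: is_derive_continuous (f_der x). Qed.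

Lemma clamp_cont n : continuous (clamp n).
Proof.
apply: contR => x; apply: (@continuous_max R R (fun=> 0)); first exact: cst_continuous.
by apply: (@continuous_min R R (fun=> bound n)); [exact: cst_continuous|exact: cvg_id].
Qed.

Lemma clamp_bound n x : 0 <= clamp n x <= bound n.
Proof.
rewrite le_max lexx ge_max (ltW (bound_gt0 n)) /=.
by rewrite ge_min lexx.
Qed.

Lemma clampE n x : 0 <= x <= bound n -> clamp n x = x.
Proof. by move=> /andP[x0 xM]; rewrite /clamp min_r// max_r. Qed.

Lemma cutoff1_cont n : continuous (cutoff1 n).
Proof. by apply: contR => x; apply: cont_comp; [exact: f_C1|exact: clamp_cont]. Qed.

Lemma cutoff1_bounded n : exists L : R, forall x, `|cutoff1 n x| <= L.
Proof.
have cA : continuous (fun x => `|derive1 f x|).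
  by apply: contR => x; apply: cont_comp; [exact: norm_continuous|exact: f_C1].
have [|c _ cP] := @EVT_max R (fun x => `|derive1 f x|) 0 (bound n) (ltW (bound_gt0 n)).
  exact: continuous_subspaceT.
by exists `|derive1 f c| => x; apply: cP; rewrite in_itv; exact: clamp_bound.
Qed.

Lemma cutoff_der n x : is_derive x 1 (cutoff n) (cutoff1 n x).
Proof.
apply: is_derive_eq (derD (derC (f 0) x) (prim_der x (@cutoff1_cont n))) _.
by rewrite add0r.
Qed.

(** No lower bound on [x] is assumed: below 0 all cutoffs are the same affine function. This matters
    because [reg] lets [Y h] become negative. *)
Lemma cutoff_agree m n x : x <= bound m -> x <= bound n -> cutoff m x = cutoff n x.
Proof.
move=> xm xn; apply/eqP; rewrite -subr_eq0.
have e : forall x0, x0 <= bound m -> x0 <= bound n -> cutoff1 m x0 = cutoff1 n x0.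
  by move=> y ym yn; rewrite /cutoff1 /clamp !min_r.
have [xi xi01] : exists2 xi : R, 0 <= xi <= 1 & (cutoff m x - cutoff n x) - (cutoff m 0 - cutoff n 0) =
    (cutoff1 m (xi * x) - cutoff1 n (xi * x)) * x.
  apply: (mvt0 (f := fun x => cutoff m x - cutoff n x) (df := fun x => cutoff1 m x - cutoff1 n x)) => xi _.
  exact: (derB (cutoff_der m _) (cutoff_der n _)).
have xx b : 0 <= b -> x <= b -> xi * x <= b.
  move=> b0 xb; case/andP: xi01 => x0 x1; have [xp|xn'] := leP 0 x.
    by apply: le_trans xb; rewrite ler_piMl.
  by apply: le_trans b0; rewrite mulr_ge0_le0// ltW.
have b0 k : 0 <= bound k by exact/ltW/bound_gt0.
rewrite (e (xi * x)) ?xx// subrr mul0r => /subr0_eq ->.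
by rewrite /cutoff (prim0 (@cutoff1_cont m)) (prim0 (@cutoff1_cont n)) subrr.
Qed.

Lemma cutoffE n x : 0 <= x <= bound n -> cutoff n x = f x.
Proof.
move=> /andP[x0 xM]; apply/eqP; rewrite -subr_eq0.
have [xi xi01] : exists2 xi : R, 0 <= xi <= 1 & (cutoff n x - f x) - (cutoff n 0 - f 0) =
    (cutoff1 n (xi * x) - derive1 f (xi * x)) * x.
  apply: (mvt0 (f := fun x => cutoff n x - f x) (df := fun x => cutoff1 n x - derive1 f x)) => xi _.
  exact: (derB (cutoff_der n _) (f_der _)).
case/andP: xi01 => y0 y1.
rewrite {1}/cutoff1 clampE; last by rewrite mulr_ge0//= (le_trans _ xM)// ler_piMl.
rewrite subrr mul0r => /subr0_eq ->.
by rewrite /cutoff (prim0 (@cutoff1_cont n)) addr0 subrr.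
Qed.

Lemma cutoff_pos n x : 0 < x <= bound n -> 0 < cutoff n x.
Proof. by move=> /andP[x0 xM]; rewrite cutoffE ?f_pos// ltW. Qed.

Lemma cutoff_sub n x : 0 < x <= bound n -> x * cutoff1 n x <= cutoff n x.
Proof.
move=> /andP[x0 xM]; rewrite cutoffE ?(ltW x0)// /cutoff1 clampE ?(ltW x0)//.
exact: f_sub.
Qed.

Lemma cutoff_lip n : exists2 L : R, 0 <= L & forall x y, `|cutoff n x - cutoff n y| <= L * `|x - y|.
Proof.
have [L LP] := cutoff1_bounded n.
exists L; first exact: le_trans (LP 0).
move=> x y; exact: (g_lip (fun x => cutoff_der n x) LP).
Qed.

Lemma radial_inhabited n : inhabited (radial_system (cutoff n) (cutoff1 n) (margin n)).
Proof.
have [L LP] := cutoff1_bounded n.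
exact: (radial_exists (fun x => cutoff_der n x) (@cutoff1_cont n) LP (margin_gt0 n)).
Qed.

Definition sys n := inhabited_witness (radial_inhabited n).

Local Notation Y n := (rY (sys n)).
Local Notation Z n := (rZ (sys n)).
Local Notation W n := (rW (sys n)).
Local Notation V n := (rV (sys n)).
Local Notation Q n := (rQ (sys n)).
Local Notation reg n := (reg (bound n) (sys n)).
Local Notation full n := (full (bound n) (sys n)).
Local Notation pos n := (pos (sys n)).
Local Notation gradsq n := (gradsq (sys n)).
Local Notation lvl n := (lvl (sys n)).

Lemma reg_Y_le n h s : reg n h s -> 0 <= s -> Y n h s <= h.
Proof.
move=> [h0 hM s2 Wn] s0; rewrite -[leRHS](rY0 (sys n) h).
apply: (deriv_le0_ge (df := W n h) s0) => [x _|x /andP[x0 xt]]; first exact: rY_s.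
by apply/ltW/Wn; rewrite !ltW.
Qed.

Lemma reg_le n h s t : reg n h s -> t <= s -> reg n h t.
Proof.
move=> [h0 hM s2 Wn] ts; split => //; first exact: le_lt_trans ts s2.
by move=> u /andP[u0 ut]; apply: Wn; rewrite u0 (le_trans ut).
Qed.

Lemma reg_agree m n h s : h < bound n -> s < 2 - margin n -> reg m h s -> 0 <= s ->
  [/\ reg n h s, Y n h s = Y m h s & W n h s = W m h s].
Proof.
move=> hn sn rm s0; have [h0 hm sm Wn] := rm.
have [L L0 LP] := cutoff_lip n.
have cg k : continuous (cutoff k) by move=> x; exact: is_derive_continuous (cutoff_der k x).
have H := @radial_agree R _ _ _ _ _ _ L (sys m) (sys n) h s (margin_gt0 m) (margin_gt0 n)
  (@cg m) (@cg n) L0 LP s0 sm sn _.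
have {}H := H (fun t ts => ltac:(
  have Yh : Y m h t <= h by [apply: reg_Y_le; [apply: reg_le rm _|]; case/andP: ts];
  by apply: cutoff_agree; apply: le_trans Yh _; exact: ltW)).
have [YE WE] := H s ltac:(by rewrite lexx s0).
split => //; split => // t ts; have [_ ->] := H t ts; exact: Wn.
Qed.

Lemma reg_mono m n h s : (m <= n)%N -> reg m h s -> 0 <= s ->
  [/\ reg n h s, Y n h s = Y m h s & W n h s = W m h s].
Proof.
move=> mn rm s0; have [_ hm sm _] := rm; apply: reg_agree => //.
- exact: lt_le_trans (bound_le mn).
- by apply: lt_le_trans sm _; rewrite lerB// margin_le.
Qed.

Lemma full_reg n H : full n H <->
  exists s, [/\ 0 <= s, reg n H s & Y n H s = 0].
Proof.
split=> [[s [hM /andP[s0 s2] ps Ys]]|[s [s0 rs Ys]]].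
  exists s; split => //; apply: pos_reg => //.
  - exact: margin_lt1.
  - exact: cutoff_pos.
exists s; have [h0 hM s2 _] := rs; rewrite h0 hM s0 s2; split => //.
by apply: reg_pos rs _; rewrite Ys.
Qed.

Lemma full_mono m n H : (m <= n)%N -> full m H -> full n H.
Proof.
move=> mn /full_reg[s [s0 rs Ys]]; apply/full_reg; exists s.
by have [rs' Ys' _] := reg_mono mn rs s0; rewrite Ys'.
Qed.

Lemma f_max h : 0 <= h -> exists2 F, 0 < F & forall x, 0 <= x <= h -> f x <= F.
Proof.
move=> h0; have [|c _ cP] := @EVT_max R f 0 h h0.
  by apply: continuous_subspaceT; exact: f_cont.
exists (`|f c| + 1) => [|x xh]; first by rewrite ltr_wpDl.
have := cP x; rewrite in_itv /= xh => /(_ isT); have := ler_norm (f c); lra.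
Qed.

(** The constants [F], [c0] and [t1] depend on [f] and [h] alone, so letting the margin tend to 0
    meets the logarithmic condition of [full_exists]. *)
Lemma full_large h : 0 < h -> exists n, full n h.
Proof.
move=> h0; have [F F0 FP] := f_max (ltW h0).
have [c0 c00 c0P] : exists2 c0, 0 < c0 & forall x, h / 2 <= x <= h -> c0 <= f x.
  have h2 : h / 2 <= h by lra.
  have [|c cI cP] := @EVT_min R f (h / 2) h h2.
    by apply: continuous_subspaceT; exact: f_cont.
  exists (f c); first by apply: f_pos; move: cI; rewrite in_itv /= => /andP[]; lra.
  by move=> x xI; apply: cP; rewrite in_itv.
pose t1 := Num.min 1 (h / (4 * F)).
have t10 : 0 < t1 by rewrite lt_min ltr01 divr_gt0// mulr_gt0.
have t11 : t1 <= 1 by rewrite ge_min lexx.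
have Ft1 : F * t1 < h / 2.
  have : F * t1 <= F * (h / (4 * F)) by rewrite ler_pM2l// ge_min lexx orbT.
  have -> : F * (h / (4 * F)) = h / 4 by field; rewrite gt_eqF.
  by lra.
have k0 : 0 < c0 * t1 / 2 by rewrite divr_gt0// mulr_gt0.
(* For a margin below [e], [ln (2 * margin n)] is below [- h / (c0 * t1 / 2) - 1]; the extra [- 1]
   makes the required inequality strict. *)
pose e := expR (- (h / (c0 * t1 / 2)) - 1) / 2.
have e0 : 0 < e by rewrite divr_gt0// expR_gt0.
pose n := Num.truncn (Num.max h e^-1).
have nP : Num.max h e^-1 < n.+1%:R by exact: truncnS_gt.
move: nP; rewrite gt_max => /andP[hn en].
exists n; apply: (@full_exists R _ _ _ _ (sys n) (margin_gt0 n) (margin_lt1 n)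
  (fun x => cutoff_der n x) (@cutoff_pos n) h t1 F c0) => //.
- by rewrite h0.
- by move=> x /andP[x0 xh]; rewrite cutoffE ?FP ?x0 ?xh//= (le_trans xh) ?(ltW hn).
- move=> x /andP[x0 xh]; rewrite cutoffE ?c0P ?x0 ?xh//= (le_trans xh) ?(ltW hn)//.
  by rewrite andbT; apply: le_trans x0; rewrite divr_ge0// ltW.
- by rewrite t10.
- exact: margin_lt.
have m0 : 0 < 2 * margin n by rewrite mulr_gt0// margin_gt0.
have m1 : 2 * margin n < expR (- (h / (c0 * t1 / 2)) - 1).
  suff : margin n < e by rewrite /e; lra.
  rewrite /margin -[e]invrK ltf_pV2 ?posrE ?invr_gt0 ?ltr0n//.
  by apply: lt_trans en _; rewrite ltr_nat.
have : ln (2 * margin n) < - (h / (c0 * t1 / 2)) - 1.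
  by rewrite -[ltRHS]expRK ltr_ln ?posrE ?expR_gt0.
rewrite -(ltr_pM2l k0) => L; rewrite -ltrBrDl sub0r; apply: lt_trans L _.
have -> : c0 * t1 / 2 * (- (h / (c0 * t1 / 2)) - 1) = - h - c0 * t1 / 2.
  by field; rewrite !gt_eqF.
by rewrite gtrBl.
Qed.
Lemma reg_pos_lt n h s : reg n h s -> 0 < h <= bound n /\ 0 < h < bound n.
Proof. by move=> [h0 hM _ _]; rewrite h0 hM ltW. Qed.

Lemma reg_W n h s : reg n h s -> 0 <= s -> W n h s < 0.
Proof. by move=> [_ _ _ Wn] s0; apply: Wn; rewrite s0 lexx. Qed.

Lemma reg_2 n h s : reg n h s -> s < 2.
Proof. by move=> [_ _ s2 _]; have := margin_gt0 n; lra. Qed.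

Lemma gradsqE n h s : gradsq n h s = s * (2 - s) * W n h s ^+ 2.
Proof. by []. Qed.

Lemma cont_near (T : topologicalType) (F : T -> R) (x : T) (e : R) :
  {for x, continuous F} -> 0 < e -> \forall y \near x, `|F y - F x| < e.
Proof.
move=> Fc e0; have /(near_realP (F x)) ne : exists2 d, 0 < d &
  forall t, `|t - F x| < d -> `|t - F x| < e by exists e.
exact: (Fc _ ne).
Qed.

(** * Existence, uniqueness and C^1 dependence of height and depth *)

Definition sol_at n a b h s :=
  [/\ 0 <= s, reg n h s, Y n h s = a & gradsq n h s = b].

(** The index only tells which truncation sees [(h, s)]; it can always be enlarged by
    [sol_at_mono]. *)
Definition sol a b h s := exists n, sol_at n a b h s.

Lemma sol_at_mono m n a b h s : (m <= n)%N -> sol_at m a b h s -> sol_at n a b h s.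
Proof.
move=> mn [s0 rs Ys gs]; have [rs' Ys' Ws'] := reg_mono mn rs s0.
by split => //; [rewrite Ys'|rewrite gradsqE Ws'].
Qed.

Lemma sol_at_lvl n a b h s : 0 <= a -> sol_at n a b h s -> 0 < s ->
  a < h /\ lvl n a h = s.
Proof.
move=> a0 [s0 rs Ys _] s_gt0; have [hM _] := reg_pos_lt rs.
have [_ _ s2 _] := rs.
have ps : pos n h s by apply: reg_pos rs _; rewrite Ys.
split; last first.
  exact: (lvlE (margin_lt1 n) (@cutoff_pos n) hM s0 s2 ps Ys).
rewrite -Ys -[ltRHS](rY0 (sys n) h).
exact: (Y_decr (margin_lt1 n) (@cutoff_pos n) hM s2 ps (lexx 0) s_gt0 (lexx s)).
Qed.

Lemma gradsq_eq0 n h s : reg n h s -> 0 <= s -> (gradsq n h s == 0) = (s == 0).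
Proof.
move=> rs s0; rewrite gradsqE !mulf_eq0 !(lt_eqF (reg_W rs s0)) !orbF.
by rewrite subr_eq0 (gt_eqF (reg_2 rs)) orbF.
Qed.

(** At depth 0 the gradient vanishes and the height is the value. Otherwise both heights lie on the
    level curve of [a], along which [gradsq] is strictly increasing. *)
Lemma sol_unique a b h s h' s' : 0 <= a -> sol a b h s -> sol a b h' s' ->
  h = h' /\ s = s'.
Proof.
move=> a0 [n0 S0] [n1 S1].
(* The level curve has to exist at all heights between [h] and [h'], not just at these two. *)
have [k kH] : exists k, full k (Num.max h h').
  by apply: full_large; case: S0 => _ [h0 _ _ _] _ _; rewrite lt_max h0.
pose N := maxn (maxn n0 n1) k.
have {}S0 : sol_at N a b h s by apply: sol_at_mono S0; rewrite !leq_max leqnn.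
have {}S1 : sol_at N a b h' s' by apply: sol_at_mono S1; rewrite !leq_max leqnn orbT.
have {}kH : full N (Num.max h h') by apply: full_mono kH; rewrite leq_maxr.
have [s0 rs Ys gs] := S0; have [s0' rs' Ys' gs'] := S1.
have [sz|sn] := eqVneq s 0.
  have sz' : s' = 0.
    apply/eqP; rewrite -(gradsq_eq0 rs' s0') gs' -gs.
    by rewrite (gradsq_eq0 rs s0) sz.
  by split; [move: Ys Ys'; rewrite sz sz' !rY0 => -> ->|rewrite sz].
have sp : 0 < s by rewrite lt_neqAle eq_sym sn.
have sp' : 0 < s'.
  by rewrite lt_neqAle eq_sym s0' andbT -(gradsq_eq0 rs' s0') gs' -gs (gradsq_eq0 rs s0).
have [ah ls] := sol_at_lvl a0 S0 sp; have [ah' ls'] := sol_at_lvl a0 S1 sp'.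
have incr := @gradsq_incr R _ _ _ _ (sys N) (margin_gt0 N) (margin_lt1 N)
  (fun x => cutoff_der N x) (@cutoff_pos N) (@cutoff_sub N) _ _ _ a kH a0.
have [hh|hh|hh] := ltgtP h h'.
- have := incr h h' ah hh; rewrite le_max lexx orbT => /(_ isT).
  by rewrite ls ls' gs gs' ltxx.
- have := incr h' h ah' hh; rewrite le_max lexx => /(_ isT).
  by rewrite ls ls' gs gs' ltxx.
- by split => //; rewrite -ls -ls' hh.
Qed.

(** On a fixed interval up to [t0], [Y 1 > 1 / 2], so [Y H > H / 2] for all [H > 1] by [compare].
    The level [a] is therefore reached beyond [t0], after a drop of at least [H / 2 - a], and
    [gradsq_large] makes the gradient large. *)
Lemma high_gradsq a b : 0 <= a -> 0 < b -> exists N H,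
  [/\ full N H, a < H & b <= gradsq N H (lvl N a H)].
Proof.
move=> a0 b0; have [F F0 FP] := @f_max 1 ler01.
pose t0 := Num.min 1 (1 / (4 * F)).
have F4 : 0 < 1 / (4 * F) by rewrite divr_gt0// mulr_gt0.
have t00 : 0 < t0 by rewrite lt_min ltr01.
have t01 : t0 <= 1 by rewrite ge_min lexx.
have Ft0 : F * t0 < 1 / 2.
  have : F * t0 <= F * (1 / (4 * F)) by rewrite ler_pM2l// ge_min lexx orbT.
  have -> : F * (1 / (4 * F)) = 1 / 4 by field; rewrite gt_eqF.
  by lra.
(* Chosen so that [H / 2 - a] exceeds the bound [8 * Num.sqrt b / t0] that [gradsq_large] would give
   for a gradient below [b]. *)
pose H := 2 * (8 * Num.sqrt b / t0 + a + 1) + 1.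
have sb : 0 <= Num.sqrt b by exact: sqrtr_ge0.
have q0 : 0 <= 8 * Num.sqrt b / t0 by rewrite divr_ge0// ?mulr_ge0// ltW.
have H1 : 1 < H by rewrite /H; lra.
have aH : a < H by rewrite /H; lra.
have H0 : 0 < H by exact: lt_trans H1.
have [N fN] := full_large H0.
exists N, H; split => //.
have lv := lvlP (margin_gt0 N) (margin_lt1 N) (fun x => cutoff_der N x) (@cutoff_pos N)
  (@cutoff_sub N) fN a0 aH (lexx H).
case: lv => HM /andP[l0 l2] pl Yl.
have hM : 0 < H <= bound N by case/andP: HM => -> /ltW.
have M1 : 0 < (1 : R) <= bound N by rewrite ltr01 /bound ler1n.
have half t : 0 <= t <= t0 -> 1 / 2 < Y N 1 t.
  move=> /andP[u0 ut].
  apply: (@Y_half R _ _ _ _ (sys N) (margin_lt1 N)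
    (fun x => cutoff_der N x) (@cutoff_pos N) 1 t F M1).
  - move=> x x1; rewrite cutoffE; first exact: FP.
    by case/andP: x1 => -> /= x1; apply: le_trans x1 _; case/andP: M1.
  - by rewrite u0 (le_trans ut).
  - by apply: le_lt_trans Ft0; rewrite ler_pM2l.
have tm : t0 < 2 - margin N by have := margin_lt1 N; lra.
have cmp t : 0 <= t <= t0 -> H / 2 < Y N H t.
  move=> tt.
  have HbN : H <= bound N by case/andP: hM.
  have half0 : 0 < 1 / 2 :> R by rewrite divr_gt0.
  have C := @compare R _ _ _ _ (sys N) (margin_gt0 N) (margin_lt1 N) (fun x => cutoff_der N x)
    (@cutoff_pos N) (@cutoff_sub N) 1 H t0 t ltr01 H1 HbN tm
    (fun x xx => lt_trans half0 (half x xx)) tt.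
  rewrite mul1r in C; apply: lt_le_trans C.
  by rewrite ltr_pM2l// -[2^-1]div1r; exact: half.
have tl : t0 <= lvl N a H.
  rewrite leNgt; apply/negP => lt.
  have : H / 2 < Y N H (lvl N a H) by apply: cmp; rewrite !ltW.
  by rewrite Yl /H; lra.
rewrite leNgt; apply/negP => bb.
have g0 : 0 <= gradsq N H (lvl N a H).
  by rewrite gradsqE mulr_ge0 ?sqr_ge0// mulr_ge0 ?ltW//; have := margin_gt0 N; lra.
have := @gradsq_large R _ _ _ _ (sys N) (margin_gt0 N) (margin_lt1 N)
  (@cutoff_pos N) H (lvl N a H) a t0 (H / 2) (Num.sqrt (gradsq N H (lvl N a H)))
  hM t00 tl l2 pl Yl (ltW (cmp t0 _)) (sqrtr_ge0 _) (esym (sqr_sqrtr g0)).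
rewrite lexx (ltW t00) => /(_ isT).
have : Num.sqrt (gradsq N H (lvl N a H)) <= Num.sqrt b by rewrite ler_sqrt ltW.
move=> A B; have : t0 * (H / 2 - a) <= 8 * Num.sqrt b by lra.
rewrite mulrC -ler_pdivlMr// /H; lra.
Qed.

Lemma low_gradsq N H a b : full N H -> 0 <= a -> a < H -> 0 < b ->
  exists h, [/\ a < h, h <= H & gradsq N h (lvl N a h) <= b].
Proof.
move=> fN a0 aH b0; have [F F0 FP] := f_max (ltW (bound_gt0 N)).
(* With [h - a <= e], [gradsq_small] bounds [(2 - s) * gradsq] by [margin N * b], and [2 - s] is at
   least the margin. *)
pose e := (margin N * b) ^+ 2 / (2 * F ^+ 3).
have e0 : 0 < e by rewrite divr_gt0 ?exprn_gt0 ?mulr_gt0 ?margin_gt0 ?exprn_gt0.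
pose h := Num.min H (a + e).
have ah : a < h by rewrite lt_min aH ltrDl.
have hH : h <= H by rewrite ge_min lexx.
have he : h <= a + e by rewrite ge_min lexx orbT.
exists h; split => //.
have [HM /andP[l0 l2] pl Yl] := lvlP (margin_gt0 N) (margin_lt1 N) (fun x => cutoff_der N x) (@cutoff_pos N)
  (@cutoff_sub N) fN a0 ah hH.
have hM : 0 < h <= bound N by case/andP: HM => -> /ltW.
have ll : 0 < lvl N a h < 2 - margin N by rewrite l0.
have small := @gradsq_small R _ _ _ _ (sys N) (margin_gt0 N) (margin_lt1 N)
  (@cutoff_pos N) h (lvl N a h) a F hM ll pl Yl a0 (fun x xM => ltac:(rewrite cutoffE//; exact: FP)).
have g0 : 0 <= gradsq N h (lvl N a h).
  by rewrite gradsqE mulr_ge0 ?sqr_ge0// mulr_ge0 ?ltW//; have := margin_gt0 N; lra.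
have F3 : 0 < 2 * F ^+ 3 by rewrite mulr_gt0 ?exprn_gt0.
have B1 : ((2 - lvl N a h) * gradsq N h (lvl N a h)) ^+ 2 <= (margin N * b) ^+ 2.
  apply: le_trans small _.
  rewrite -[leRHS](@divfK _ (2 * F ^+ 3)) ?gt_eqF// mulrC -/e.
  by rewrite ler_pM2r//; lra.
have m0 := margin_gt0 N.
have d0 : margin N <= 2 - lvl N a h by lra.
have B2 : (2 - lvl N a h) * gradsq N h (lvl N a h) <= margin N * b.
  have D0 : 0 <= 2 - lvl N a h by exact: le_trans (ltW m0) d0.
  rewrite -ler_sqr ?nnegrE//; first exact: mulr_ge0.
  by rewrite mulr_ge0// ltW.
rewrite -(ler_pM2l m0); apply: le_trans B2; exact: ler_wpM2r.
Qed.

Lemma sol_exists a b : 0 <= a -> 0 <= b -> (a, b) != (0, 0) -> exists h s, sol a b h s.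
Proof.
move=> a0; rewrite le_eqVlt => /predU1P[<-|b0] ab.
  have a_gt0 : 0 < a.
    by rewrite lt_neqAle a0 andbT; apply: contra ab => /eqP ->.
  have [n [S0 [/andP[_ aM] _ _ _]]] := full_large a_gt0.
  exists a, 0, n; split; rewrite ?rY0 ?lexx//; last by rewrite gradsqE !mul0r.
  apply: pos_reg.
  - exact: margin_lt1.
  - exact: cutoff_pos.
  - by rewrite a_gt0.
  - by have := margin_lt1 n; lra.
  - by move=> t /andP[t0]; rewrite ltNge t0.
have [N [H [fN aH bH]]] := high_gradsq a0 b0.
have [h1 [ah1 h1H bh1]] := low_gradsq fN a0 aH b0.
have lv h : a < h -> h <= H -> _ := fun ah hH =>
  lvlP (margin_gt0 N) (margin_lt1 N) (fun x => cutoff_der N x) (@cutoff_pos N)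
    (@cutoff_sub N) fN a0 ah hH.
have [||h hI hb] := @IVT R (fun h => gradsq N h (lvl N a h)) h1 H b h1H.
- apply: derivable_within_continuous => h; rewrite in_itv /= => /andP[h1h hH].
  have D := lvl_gradsq_der (margin_gt0 N) (margin_lt1 N) (fun x => cutoff_der N x) (@cutoff_pos N)
    (@cutoff_sub N) fN a0 (lt_le_trans ah1 h1h) hH.
  exact: ex_derive.
- by rewrite ge_min bh1 le_max bH orbT.
move: hI; rewrite in_itv /= => /andP[h1h hH].
have [HM /andP[l0 l2] pl Yl] := lv h (lt_le_trans ah1 h1h) hH.
exists h, (lvl N a h), N; split => //; first exact: ltW.
apply: pos_reg => //.
- exact: margin_lt1.
- exact: cutoff_pos.
Qed.

(** Two scalar uses of the implicit function theorem: the level set is solved for the depth as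
    [W <> 0], then [gradsq] along it for the height as [2 J > 0]. [H] and [S] are C^1 on a full
    neighbourhood, also across [b = 0], where the depth passes through 0. *)
Lemma sol_c1 n a0 b0 h0 s0 : 0 <= a0 -> sol_at n a0 b0 h0 s0 ->
  exists (H S : R * R -> R), [/\ c1 H (a0, b0), c1 S (a0, b0),
    H (a0, b0) = h0, S (a0, b0) = s0 &
    \forall p \near ((a0, b0) : R * R), 0 <= p.2 ->
      sol_at n p.1 p.2 (H p) (S p)].
Proof.
move=> a00 [s00 rs Ys gs].
have Wn : W n h0 s0 != 0 by rewrite lt_eqF// (reg_W rs).
have [hM hM'] := reg_pos_lt rs; have [_ _ s02 _] := rs.
have ps : pos n h0 s0 by apply: reg_pos rs _; rewrite Ys.
have [sg] := level_c1 Wn; rewrite Ys => -[sg0 sgc sgY].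
pose G := fun q : (R * R) * R => gradsq n q.2 (sg (q.2, q.1.1)) - q.1.2.
have Sc : c1 (fun q : (R * R) * R => sg (q.2, q.1.1)) ((a0, b0), h0).
  apply: (c1_comp (f := fun q : (R * R) * R => (q.2, q.1.1)) (g := sg)) => //.
  apply: c1_pair; first exact: c1_snd.
  by apply: (c1_comp_fst (f := fun p : R * R => p.1)); exact: c1_fst.
have Wc : c1 (fun q : (R * R) * R => W n q.2 (sg (q.2, q.1.1))) ((a0, b0), h0).
  apply: (c1_comp (f := fun q : (R * R) * R => (q.2, sg (q.2, q.1.1)))
    (g := fun p : R * R => W n p.1 p.2)).
    by apply: c1_pair; first exact: c1_snd.
  by rewrite /= sg0; exact: W_c1.
have Gc : c1 G ((a0, b0), h0).
  apply: c1B; last by apply: (c1_comp_fst (f := fun p : R * R => p.2)); exact: c1_snd.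
  apply: c1M; last exact: (c1M Wc Wc).
  have S2 : c1 (fun q : (R * R) * R => 2 - sg (q.2, q.1.1)) ((a0, b0), h0).
    exact: (c1B (c1_cst (2 : R) _) Sc).
  exact: (c1M Sc S2).
pose phi h := sg (h, a0).
have pc : c1 phi h0.
  apply: (c1_comp (f := fun h : R => (h, a0)) (g := sg)) => //.
  by apply: c1_pair; [exact: c1_id|exact: c1_cst].
have pY : \forall h \near h0, Y n h (phi h) = a0.
  have /(_ _ sgY) : {for h0, continuous (fun h : R => (h, a0))}.
    by apply: cont_pair; [exact: cvg_id|exact: cvg_cst].
  by [].
have Gd : is_derive h0 1 (fun h => gradsq n h (phi h)) (2 * J (sys n) h0 s0).
  exact: (gradsq_level_der s02 Wn sg0 (c1_diff pc) pY).
have [||H [H0 Hc HG _]] := implicit_function Gc.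
- by rewrite /G /= sg0 gs subrr.
- rewrite (der_unique (is_derive_section (c1_diff Gc)) (derB Gd (derC b0 h0))) subr0.
  rewrite gt_eqF// mulr_gt0//.
  apply: (J_gt0 (margin_gt0 n) (margin_lt1 n) (fun x => cutoff_der n x) (@cutoff_pos n)
    (@cutoff_sub n) hM s02 ps).
  by rewrite s00 lexx.
have Hp : {for ((a0, b0) : R * R), continuous (fun p : R * R => (H p, p.1))}.
  by apply: cont_pair; [exact: c1_cont|exact: cvg_fst].
have Sg : c1 (fun p : R * R => sg (H p, p.1)) (a0, b0).
  apply: (c1_comp (f := fun p : R * R => (H p, p.1)) (g := sg)).
    exact: (c1_pair Hc (c1_fst _)).
  by rewrite /= H0.
exists H, (fun p => sg (H p, p.1)); split => //; first by rewrite /= H0.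
have [d d0 dP] := reg_open rs s00.
have Wg : c1 (fun p : R * R => W n (H p) (sg (H p, p.1))) (a0, b0).
  apply: (c1_comp (f := fun p : R * R => (H p, sg (H p, p.1)))
    (g := fun p : R * R => W n p.1 p.2)); first exact: (c1_pair Hc Sg).
  by rewrite /= H0 sg0; exact: W_c1.
have Wneg : 0 < - W n h0 s0 by rewrite oppr_gt0 (reg_W rs).
have n4 := cont_near (c1_cont Wg) Wneg.
have n1 := cont_near (c1_cont Hc) d0.
have n2 := cont_near (c1_cont Sg) d0.
have n3 : \forall p \near ((a0, b0) : R * R), Y n (H p) (sg (H p, p.1)) = p.1.
  have Hp' : (fun p : R * R => (H p, p.1)) @ ((a0, b0) : R * R) --> ((h0, a0) : R * R).
    by rewrite -H0; exact: Hp.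
  exact: (Hp' _ sgY).
near=> p => p2.
have r : reg n (H p) (sg (H p, p.1)).
  apply: dP; first by rewrite -H0; near: p.
  have : `|sg (H p, p.1) - sg (H (a0, b0), (a0, b0).1)| < d by near: p.
  by rewrite H0 sg0.
have gp : gradsq n (H p) (sg (H p, p.1)) = p.2.
  by apply: subr0_eq; near: p.
have Yp : Y n (H p) (sg (H p, p.1)) = p.1 by near: p.
(* [gradsq] has the sign of the depth, so [b >= 0] excludes a negative depth. *)
split => //; rewrite leNgt; apply/negP => sneg.
move: p2; rewrite -gp gradsqE leNgt => /negP; apply.
have Wp : W n (H p) (sg (H p, p.1)) != 0.
  have : `|W n (H p) (sg (H p, p.1)) -
      W n (H (a0, b0)) (sg (H (a0, b0), (a0, b0).1))| < - W n h0 s0 by near: p.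
  rewrite H0 /= sg0 ltr_norml => /andP[_] Wp.
  by rewrite lt_eqF//; lra.
rewrite pmulr_llt0; last by rewrite exprn_even_gt0.
by rewrite nmulr_rlt0// subr_gt0; exact: reg_2 r.
Unshelve. all: by end_near. Qed.

Definition height a b : R := (xget (0, 0) [set p : R * R | sol a b p.1 p.2]).1.
Definition depth a b : R := (xget (0, 0) [set p : R * R | sol a b p.1 p.2]).2.

Lemma sol_height a b : 0 <= a -> 0 <= b -> (a, b) != (0, 0) ->
  sol a b (height a b) (depth a b).
Proof.
move=> a0 b0 /(sol_exists a0 b0)[h [s hs]]; rewrite /height /depth.
by case: xgetP => [p _ //|/(_ (h, s))]; case.
Qed.

Lemma height_eq a b h s : 0 <= a -> sol a b h s -> height a b = h /\ depth a b = s.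
Proof.
move=> a0 hs; rewrite /height /depth.
case: xgetP => [p _ /= pS|/(_ (h, s))]; last by case.
exact: (sol_unique a0 pS hs).
Qed.

Definition rim h s := exists n, [/\ 0 <= s, reg n h s & Y n h s = 0].

Lemma rim_unique h s t : rim h s -> rim h t -> s = t.
Proof.
move=> [n [s0 rs Ys]] [m [t0 rt Yt]]; pose N := maxn n m.
have [rs' Ys' _] := reg_mono (leq_maxl n m) rs s0.
have [rt' Yt' _] := reg_mono (leq_maxr n m) rt t0.
have [hM _] := reg_pos_lt rs'; have [_ _ s2 _] := rs'; have [_ _ t2 _] := rt'.
apply: (level_unique (margin_lt1 N) (@cutoff_pos N) hM s2 t2 s0 t0).
- by apply: reg_pos rs' _; rewrite Ys' Ys.
- by apply: reg_pos rt' _; rewrite Yt' Yt.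
- by rewrite Ys' Yt' Ys Yt.
Qed.

Definition radius h : R := xget 0 [set s | rim h s].

Lemma rim_radius h : 0 < h -> rim h (radius h).
Proof.
move=> /full_large[n /full_reg[s hs]]; rewrite /radius.
by case: xgetP => [t _ //|/(_ s)]; case; exists n.
Qed.

Lemma radius_eq h s : rim h s -> radius h = s.
Proof.
move=> hs; rewrite /radius; case: xgetP => [t _ ht|/(_ s)]; last by case.
exact: rim_unique ht hs.
Qed.

Lemma rim_gt0 h s : rim h s -> 0 < s < 2.
Proof.
move=> [n [s0 rs Ys]]; rewrite (reg_2 rs) andbT lt_neqAle s0 andbT.
apply/eqP => E; move: Ys; rewrite -E rY0 => h0.
by case: rs; rewrite h0 ltxx.
Qed.

Lemma radius_cont h0 : 0 < h0 -> {for h0, continuous radius}.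
Proof.
move=> h00; have r0 := rim_radius h00; have /andP[s00 _] := rim_gt0 r0.
have [n [s0 rs Ys]] := r0.
have Wn : W n h0 (radius h0) != 0 by rewrite lt_eqF// (reg_W rs).
have [sg] := level_c1 Wn; rewrite Ys => -[sg0 sgc sgY].
have pc : c1 (fun h => sg (h, 0)) h0.
  apply: (c1_comp (f := fun h : R => (h, 0)) (g := sg)) => //.
  by apply: c1_pair; [exact: c1_id|exact: c1_cst].
apply: near_eq_cont (c1_cont pc).
have pY : \forall h \near h0, Y n h (sg (h, 0)) = 0.
  have /(_ _ sgY) : {for h0, continuous (fun h : R => (h, 0 : R))}.
    by apply: cont_pair; [exact: cvg_id|exact: cvg_cst].
  by [].
have [d d0 dP] := reg_open rs s0.
have dm0 : 0 < Num.min d (radius h0) by rewrite lt_min d0.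
have n1 := cont_near (c1_cont pc) dm0.
have n2 : \forall h \near h0, `|h - h0| < d by apply/near_realP; exists d.
near=> h.
have : `|sg (h, 0) - sg (h0, 0)| < Num.min d (radius h0) by near: h.
rewrite sg0 lt_min => /andP[p1 p2].
apply/esym/radius_eq; exists n; split; last by near: h.
- by move: p2; rewrite ltr_norml => /andP[]; lra.
- by apply: dP => //; near: h.
Unshelve. all: by end_near. Qed.

(* Which index is chosen is irrelevant by [profileE]. *)
Definition profile h s : R := Y (xget 0%N [set n | reg n h s]) h s.

Lemma profileE n h s : reg n h s -> 0 <= s -> profile h s = Y n h s.
Proof.
move=> rs s0; rewrite /profile; case: xgetP => [m _ rm|/(_ n)]; last by case.
have [_ <- _] := reg_mono (leq_maxl m n) rm s0.
by have [_ <- _] := reg_mono (leq_maxr m n) rs s0.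
Qed.
End Cutoff.

(** * Calculus on the sphere and spherical caps *)

Section SphereCalculus.
Variable R : realType.
Local Notation E3 := 'rV[R]_3.
Implicit Types (x y z c q X : E3) (k t : R).

Lemma dotE x y : dot x y = x 0 0 * y 0 0 + x 0 1 * y 0 1 + x 0 2 * y 0 2.
Proof.
rewrite /dot !big_ord_recl big_ord0 addr0 addrA.
by congr (_ * _ + _ * _ + _ * _); congr (_ _ _); apply: val_inj.
Qed.

Lemma dotC x y : dot x y = dot y x.
Proof. by apply: eq_bigr => i _; rewrite mulrC. Qed.

Lemma dotDr x y z : dot x (y + z) = dot x y + dot x z.
Proof. by rewrite /dot -big_split; apply: eq_bigr => i _; rewrite mxE mulrDr. Qed.

Lemma dotZr k x y : dot x (k *: y) = k * dot x y.
Proof. by rewrite /dot big_distrr; apply: eq_bigr => i _; rewrite mxE /= mulrCA. Qed.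

Lemma dotNr x y : dot x (- y) = - dot x y.
Proof. by rewrite -scaleN1r dotZr mulN1r. Qed.

Lemma dotBr x y z : dot x (y - z) = dot x y - dot x z.
Proof. by rewrite dotDr dotNr. Qed.

Lemma dotDl x y z : dot (y + z) x = dot y x + dot z x.
Proof. by rewrite dotC dotDr !(dotC x). Qed.

Lemma dotZl k x y : dot (k *: y) x = k * dot y x.
Proof. by rewrite dotC dotZr dotC. Qed.

Lemma dotBl x y z : dot (y - z) x = dot y x - dot z x.
Proof. by rewrite dotC dotBr !(dotC x). Qed.

Lemma dotNl x y : dot (- y) x = - dot y x.
Proof. by rewrite dotC dotNr dotC. Qed.

Definition dot_simpl := (dotBr, dotBl, dotDr, dotDl, dotZr, dotZl, dotNr, dotNl).

Lemma dot0r x : dot x 0 = 0.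
Proof. by rewrite -(subrr 0) dotBr subrr. Qed.

Lemma dot_delta x i : dot x (delta_mx 0 i) = x 0 i.
Proof.
rewrite /dot (bigD1 i)//= mxE !eqxx mulr1 big1 ?addr0// => j ji.
by rewrite mxE eqxx (negbTE ji) mulr0.
Qed.

Lemma dot_ge0 x : 0 <= dot x x.
Proof. by apply: sumr_ge0 => i _; rewrite -expr2 sqr_ge0. Qed.

Lemma coord_sqr_le x i : x 0 i ^+ 2 <= dot x x.
Proof.
rewrite /dot (bigD1 i)//= -expr2 lerDl sumr_ge0// => j _.
by rewrite -expr2 sqr_ge0.
Qed.

Lemma dot_eq0 x : (dot x x == 0) = (x == 0).
Proof.
apply/eqP/eqP => [xx|->]; last by rewrite dot0r.
apply/rowP => i; rewrite mxE; apply/eqP; rewrite -sqrf_eq0 -[_ == 0]orbF.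
by rewrite orbF eq_le sqr_ge0 -xx coord_sqr_le.
Qed.

Lemma dot_gt0 x : (0 < dot x x) = (x != 0).
Proof. by rewrite lt_neqAle dot_ge0 andbT eq_sym dot_eq0. Qed.

Lemma coord_le_norm x i : `|x 0 i| <= `|x|.
Proof. by rewrite -[`|x|]/(mx_norm x) mx_normrE; apply: (le_trans _ (le_bigmax _ _ (0, i))). Qed.

Lemma dot_le x y : `|dot x y| <= 3 * (`|x| * `|y|).
Proof.
apply: le_trans (ler_norm_sum _ _ _) _.
apply: (@le_trans _ _ (\sum_(i < 3) `|x| * `|y|)).
  by apply: ler_sum => i _; rewrite normrM ler_pM// coord_le_norm.
by rewrite sumr_const card_ord mulr_natl.
Qed.

Lemma dot_cs x y : dot x y ^+ 2 <= dot x x * dot y y.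
Proof.
rewrite -subr_ge0 !dotE.
set a := x 0 0; set b := x 0 1; set c := x 0 2.
set d := y 0 0; set e := y 0 1; set g := y 0 2.
have -> : (a * a + b * b + c * c) * (d * d + e * e + g * g) -
    (a * d + b * e + c * g) ^+ 2 =
  (a * e - b * d) ^+ 2 + (a * g - c * d) ^+ 2 + (b * g - c * e) ^+ 2 by ring.
by rewrite !addr_ge0 ?sqr_ge0.
Qed.

Lemma S2_dot_le x y : S2 x -> S2 y -> -1 <= dot x y <= 1.
Proof.
move=> xx yy; have := dot_cs x y; rewrite xx yy mulr1 => h.
by apply/andP; split; nra.
Qed.

(** Half the squared chord agrees with the depth on the sphere and is a polynomial off it that
    vanishes to second order at the pole; this extension is used for regularity. *)
Lemma S2_dist x y : S2 x -> S2 y -> dot (x - y) (x - y) / 2 = 1 - dot x y.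
Proof. by move=> xx yy; rewrite !dot_simpl xx yy (dotC y x); field. Qed.

Lemma dot_tproj q x y : dot (tproj q x) y = dot x y - dot x q * dot q y.
Proof. by rewrite /tproj !dot_simpl. Qed.

Lemma tproj_orth q x : S2 q -> dot q (tproj q x) = 0.
Proof. by move=> qq; rewrite dotC dot_tproj qq mulr1 subrr. Qed.

Lemma tproj_id q x : dot x q = 0 -> tproj q x = x.
Proof. by move=> xq; rewrite /tproj xq scale0r subr0. Qed.

Lemma tproj_sym q x y : dot (tproj q x) y = dot x (tproj q y).
Proof. by rewrite dot_tproj /tproj !dot_simpl (dotC y q) (mulrC (dot q y)). Qed.

Lemma tproj2 q x y : S2 q -> dot (tproj q x) (tproj q y) = dot x (tproj q y).
Proof. by move=> qq; rewrite dot_tproj tproj_orth// mulr0 subr0. Qed.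

Lemma tproj_sqr q c : S2 q -> S2 c ->
  dot (tproj q c) (tproj q c) = 1 - dot c q ^+ 2.
Proof. by move=> qq cc; rewrite tproj2// /tproj !dot_simpl cc; ring. Qed.

Lemma dot_cont (T : topologicalType) (F G : T -> E3) (t : T) :
  {for t, continuous F} -> {for t, continuous G} ->
  {for t, continuous (fun s => dot (F s) (G s))}.
Proof.
move=> Fc Gc; have H i : {for t, continuous (fun s => F s 0 i * G s 0 i)}.
  apply: contM.
  - by apply: (cont_comp (f := fun x : E3 => x 0 i)) => //; exact: coord_continuous.
  - by apply: (cont_comp (f := fun x : E3 => x 0 i)) => //; exact: coord_continuous.
have : {for t, continuous (fun s => F s 0 0 * G s 0 0 + F s 0 1 * G s 0 1 + F s 0 2 * G s 0 2)}.
  by apply: contD; first apply: contD.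
by apply: near_eq_cont; apply: nearW => s; rewrite dotE.
Qed.

Lemma dot_c1 (V : normedModType R) (F G : V -> E3) (v : V) : c1 F v -> c1 G v ->
  c1 (fun u => dot (F u) (G u)) v.
Proof.
move=> Fc Gc; apply: c1_sum => i.
have Fi : c1 (fun u => F u 0 i) v.
  by apply: (c1_comp (g := fun y : E3 => y 0 i) Fc); exact: c1_coord.
have Gi : c1 (fun u => G u 0 i) v.
  by apply: (c1_comp (g := fun y : E3 => y 0 i) Gc); exact: c1_coord.
exact: c1M Fi Gi.
Qed.

Lemma c1_scaler (V : normedModType R) (F : V -> R) (G : V -> E3) (v : V) :
  c1 F v -> c1 G v -> c1 (fun u => F u *: G u) v.
Proof.
move=> Fc Gc.
have Gi (i : 'I_1) (j : 'I_3) : c1 (fun u => F u * G u i j) v.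
  apply: c1M Fc _.
  by apply: (c1_comp (g := fun y : E3 => y i j) Gc); exact: c1_coord.
apply: near_eq_c1 (c1_mx Gi); apply: nearW => u.
by apply/matrixP => i j; rewrite !mxE.
Qed.

Lemma c1_sqrt (V : normedModType R) (F : V -> R) (v : V) : 0 < F v -> c1 F v ->
  c1 (fun u => Num.sqrt (F u)) v.
Proof.
move=> F0 Fc.
have S : c1 (fun p : R * R => Num.sqrt p.2) (0, F v).
  apply: (@c1_two R (fun _ s => Num.sqrt s) (fun _ _ => 0)
    (fun _ s => (2 * Num.sqrt s)^-1) 0 (F v) (F v) F0) => h s _ sF.
  have s0 : 0 < s by move: sF; rewrite ltr_norml => /andP[]; lra.
  split.
  - exact: derC.
  - exact: is_derive1_sqrt.
  - exact: contC.
  - apply: contV; first by rewrite mulf_neq0// gt_eqF// sqrtr_gt0.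
    apply: contM; first exact: contC.
    by apply: (cont_comp (f := Num.sqrt)); [exact: sqrt_continuous|exact: cvg_snd].
apply: (c1_comp (f := fun u => (0 : R, F u)) (g := fun p : R * R => Num.sqrt p.2)) => //.
exact: (c1_pair (c1_cst _ _) Fc).
Qed.

Lemma line_is_derive (V : normedModType R) (g : V -> R) (u v : V) :
  differentiable g u -> is_derive (0 : R) 1 (fun t : R => g (u + t *: v)) ('d g u v).
Proof.
move=> gd.
have Ld : differentiable (fun t : R => u + t *: v) (0 : R).
  apply: c1_diff; apply: c1D; first exact: c1_cst.
  by apply: c1_scale; exact: c1_id.
have L0 : u + (0 : R) *: v = u by rewrite scale0r addr0.
have L1 : 'd (fun t : R => u + t *: v) (0 : R) 1 = v.
  have D : is_diff (0 : R) (fun t : R => u + t *: v) (fun t : R => 0 + t *: v).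
    exact: (is_diffD (is_diff_cst u (0 : R)) (is_diff_scalel (0 : R) v)).
  by rewrite (diff_val (is_diff_def := D)) /= add0r scale1r.
have gd' : differentiable g (u + (0 : R) *: v) by rewrite L0.
have H : differentiable (g \o (fun t : R => u + t *: v)) (0 : R) by exact: differentiable_comp.
split; first exact: diff_derivable.
by rewrite deriveE// (diff_comp Ld gd') /= L1 L0.
Qed.

Lemma line_deriv (V : normedModType R) (g : V -> R) (u v : V) (l : R) :
  differentiable g u -> is_derive (0 : R) 1 (fun t : R => g (u + t *: v)) l ->
  'd g u v = l.
Proof. by move=> gd; exact: der_unique (line_is_derive v gd). Qed.

Lemma coord_deriv m n (V : normedModType R) (F : V -> 'M[R]_(m, n)) (u v : V) i j :
  differentiable F u -> ('d F u v) i j = 'd (fun w => F w i j) u v.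
Proof.
move=> Fd; pose p := fun y : 'M[R]_(m, n) => y i j.
have pd (y : 'M[R]_(m, n)) : differentiable p y by apply: c1_diff; exact: c1_coord.
rewrite (_ : (fun w => F w i j) = p \o F)// (diff_comp Fd (pd _)) /=.
apply/esym; apply: (line_deriv (pd _)).
rewrite (_ : (fun t => p (F u + t *: 'd F u v)) = fun t : R => F u i j + t * 'd F u v i j); last first.
  by apply/funext => t; rewrite /p !mxE.
apply: is_derive_eq (derD (derC (F u i j) 0) (derM (derI 0) (derC ('d F u v i j) 0))) _.
by rewrite mul1r mulr0 addr0 add0r.
Qed.

Lemma der_dot_line c q X t : is_derive t 1 (fun t => dot c (q + t *: X)) (dot c X).
Proof.
rewrite (_ : (fun t => _) = fun t : R => dot c q + t * dot c X); last first.
  by apply/funext => s; rewrite dotDr dotZr.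
apply: is_derive_eq (derD (derC (dot c q) t) (derM (derI t) (derC (dot c X) t))) _.
by ring.
Qed.

Definition dir x : E3 := (enorm x)^-1 *: x.

Lemma enorm1 q : S2 q -> enorm q = 1.
Proof. by rewrite /enorm => ->; rewrite sqrtr1. Qed.

Lemma enorm_gt0 x : (0 < enorm x) = (x != 0).
Proof. by rewrite sqrtr_gt0 dot_gt0. Qed.

Lemma enorm_sqr x : enorm x ^+ 2 = dot x x.
Proof. by rewrite sqr_sqrtr// dot_ge0. Qed.

Lemma dir_id q : S2 q -> dir q = q.
Proof. by move=> qq; rewrite /dir enorm1// invr1 scale1r. Qed.

Lemma S2_dir x : x != 0 -> S2 (dir x).
Proof.
rewrite -enorm_gt0 => x0; rewrite /S2 /= !dot_simpl -enorm_sqr.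
by field; rewrite gt_eqF.
Qed.

Lemma S2_neq0 q : S2 q -> q != 0.
Proof. by move=> qq; rewrite -dot_gt0 qq ltr01. Qed.

Lemma near_neq0 q : q != 0 -> \forall y \near q, y != 0.
Proof.
move=> q0; have N : {for q, continuous (fun y : E3 => `|y|)} by exact: norm_continuous.
have q1 : 0 < `|q| by rewrite normr_gt0.
apply: filterS (cont_near N q1) => y; apply: contraTneq => ->.
by rewrite normr0 sub0r normrN normr_id ltxx.
Qed.

Lemma dir_c1 q : q != 0 -> c1 dir q.
Proof.
move=> q0; have d1 : c1 (fun y : E3 => dot y y) q by exact: (dot_c1 (c1_id _) (c1_id _)).
have d2 : c1 (fun y : E3 => enorm y) q by apply: c1_sqrt; rewrite ?dot_gt0.
have d3 : c1 (fun y : E3 => (enorm y)^-1) q.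
  by apply: c1V d2; rewrite gt_eqF// enorm_gt0.
exact: (c1_scaler d3 (c1_id _)).
Qed.

Lemma dir_deriv q X : S2 q -> dot q X = 0 -> 'd dir q X = X.
Proof.
move=> qq qX; apply/rowP => i.
have q0 := S2_neq0 qq.
rewrite coord_deriv; last exact: c1_diff (dir_c1 q0).
apply: line_deriv.
  apply: c1_diff; apply: (c1_comp (g := fun y : E3 => y 0 i) (dir_c1 q0)).
  exact: c1_coord.
have nq : dot (q + (0 : R) *: X) (q + (0 : R) *: X) = 1 by rewrite scale0r addr0.
have D1 : is_derive (0 : R) 1 (fun t : R => dot (q + t *: X) (q + t *: X)) 0.
  rewrite (_ : (fun t => _) = fun t : R => 1 + t * (t * dot X X)); last first.
    by apply/funext => t; rewrite !dot_simpl (dotC X q) qX qq; ring.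
  apply: is_derive_eq (derD (derC 1 0) (derM (derI 0) (derM (derI 0) (derC (dot X X) 0)))) _.
  by ring.
have D2 : is_derive (0 : R) 1 (fun t : R => (enorm (q + t *: X))^-1) 0.
  have s0 : 0 < dot (q + (0 : R) *: X) (q + (0 : R) *: X) by rewrite nq.
  have D := der_comp (f := Num.sqrt) (g := fun t : R => dot (q + t *: X) (q + t *: X))
    (is_derive1_sqrt s0) D1.
  have e0 : enorm (q + (0 : R) *: X) != 0 by rewrite gt_eqF// enorm_gt0 -dot_gt0.
  by apply: is_derive_eq (derV (f := fun t : R => enorm (q + t *: X)) e0 D) _; rewrite mulr0 oppr0 mul0r.
rewrite (_ : (fun t => _) = fun t : R => (enorm (q + t *: X))^-1 * (q 0 i + t * X 0 i)); last first.
  by apply/funext => t; rewrite /dir !mxE.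
apply: is_derive_eq (derM D2 (derD (derC (q 0 i) 0) (derM (derI 0) (derC (X 0 i) 0)))) _.
by rewrite scale0r addr0 enorm1// invr1; ring.
Qed.

Lemma near_dir q (P : set E3) : S2 q -> (\forall y \near q, S2 y -> P y) ->
  \forall y \near q, P (dir y).
Proof.
move=> qq H.
have dc : dir y @[y --> q] --> q.
  by rewrite -[X in _ --> X](dir_id qq); exact: c1_cont (dir_c1 (S2_neq0 qq)).
have := dc _ H; apply: filterS2 (near_neq0 (S2_neq0 qq)) => y y0; apply.
exact: S2_dir.
Qed.

(** [radial u] is [G] composed with [dir] near [q], and the differential of [dir] fixes tangent
    vectors. Hence any ambient extension computes intrinsic derivatives. *)
Lemma radial_deriv (W : normedModType R) (u G : E3 -> W) q : S2 q ->
  differentiable G q -> (\forall y \near q, S2 y -> u y = G y) ->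
  differentiable (radial u) q /\
  forall X, dot q X = 0 -> 'D_X (radial u) q = 'd G q X.
Proof.
move=> qq Gd uG.
have dd := c1_diff (dir_c1 (S2_neq0 qq)).
have Gd' : differentiable G (dir q) by rewrite dir_id.
have D : is_diff q (G \o dir) ('d (G \o dir) q).
  by apply: differentiableP; exact: differentiable_comp.
have D' : is_diff q (radial u) ('d (G \o dir) q).
  by apply: near_eq_diff D; apply: filterS (near_dir qq uG) => y /= <-.
split; first exact: ex_diff.
move=> X qX; rewrite deriveE; last exact: ex_diff.
rewrite (diff_val (is_diff_def := D')).
rewrite (diff_comp dd Gd') [LHS]/= (dir_deriv qq qX) (dir_id qq).
by [].
Qed.

Lemma grad_deriv (u G : E3 -> R) q : S2 q ->
  differentiable G q -> (\forall y \near q, S2 y -> u y = G y) ->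
  forall X, dot (grad u q) X = 'd G q (tproj q X).
Proof.
move=> qq Gd uG X; have [_ D] := @radial_deriv R^o u G q qq Gd uG.
rewrite {1}/dot.
have -> : tproj q X = \sum_(i < 3) X 0 i *: tproj q (delta_mx 0 i).
  rewrite /tproj; under eq_bigr do rewrite scalerBr scalerA.
  rewrite sumrB -scaler_suml; congr (_ - _ *: _).
    by rewrite [LHS]row_sum_delta.
  by rewrite {1}/dot; apply: eq_bigr => i _; rewrite (dotC _ q) dot_delta.
rewrite linear_sum; apply: eq_bigr => i _.
rewrite mxE D; last exact: tproj_orth.
by rewrite linearZ mulrC.
Qed.

Lemma grad_eq (u G : E3 -> R) q v : S2 q ->
  differentiable G q -> (\forall y \near q, S2 y -> u y = G y) ->
  (forall X, 'd G q X = dot v X) -> grad u q = tproj q v.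
Proof.
move=> qq Gd uG Gv; apply/rowP => i.
by rewrite -!dot_delta (grad_deriv qq Gd uG) Gv tproj_sym.
Qed.

Lemma tprojZ q k x : tproj q (k *: x) = k *: tproj q x.
Proof. by rewrite /tproj dotZl scalerBr scalerA. Qed.

Lemma axial_c1 (phi : R -> R) c q : c1 phi (1 - dot c q) ->
  c1 (fun y => phi (1 - dot c y)) q.
Proof.
move=> pc; have d1 : c1 (fun y : E3 => dot c y) q by exact: (dot_c1 (c1_cst c _) (c1_id _)).
have d2 : c1 (fun y : E3 => 1 - dot c y) q by exact: (c1B (c1_cst (1 : R) _) d1).
exact: (c1_comp d2 pc).
Qed.

Lemma axial_line (phi : R -> R) c q X l : is_derive (1 - dot c q) 1 phi l ->
  is_derive (0 : R) 1 (fun t : R => phi (1 - dot c (q + t *: X))) (- l * dot c X).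
Proof.
move=> pl; have pl' : is_derive (1 - dot c (q + (0 : R) *: X)) 1 phi l.
  by rewrite scale0r addr0.
apply: is_derive_eq (der_comp (f := phi) (g := fun t : R => 1 - dot c (q + t *: X)) pl'
  (derB (derC 1 0) (der_dot_line c q X 0))) _.
by ring.
Qed.

Lemma grad_axial (u : E3 -> R) (phi : R -> R) c q l : S2 q ->
  c1 phi (1 - dot c q) -> is_derive (1 - dot c q) 1 phi l ->
  (\forall y \near q, S2 y -> u y = phi (1 - dot c y)) ->
  differentiable (radial u : E3 -> R^o) q /\ grad u q = - l *: tproj q c.
Proof.
move=> qq pc pl up; have Gc := c1_diff (axial_c1 pc).
split; first by have [] := @radial_deriv R^o u _ q qq Gc up.
rewrite -tprojZ; apply: (grad_eq qq Gc up) => X.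
by rewrite (line_deriv Gc (axial_line X pl)) dotZl.
Qed.

(** Differentiating the ambient extension of the gradient also yields a term along [q]; it is
    normal, so the tangential projection removes it. *)
Lemma hess_axial (u : E3 -> R) (psi : R -> R) c q m : S2 q ->
  c1 psi (1 - dot c q) -> is_derive (1 - dot c q) 1 psi m ->
  (\forall y \near q, S2 y -> grad u y = - psi (1 - dot c y) *: tproj y c) ->
  differentiable (radial (grad u)) q /\
  hess u q = \matrix_(i, j) (m * (tproj q c 0 i * tproj q c 0 j) +
    psi (1 - dot c q) * dot c q * ((i == j)%:R - q 0 i * q 0 j)).
Proof.
move=> qq pc pm gp.
pose Gr y := - psi (1 - dot c y) *: (c - dot c y *: y).
have cq : c1 (fun y : E3 => dot c y) q by exact: (dot_c1 (c1_cst c _) (c1_id _)).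
have Gc : c1 Gr q.
  exact: (c1_scaler (c1N (axial_c1 pc)) (c1B (c1_cst c _) (c1_scaler cq (c1_id _)))).
have [rd D] := radial_deriv qq (c1_diff Gc) gp.
split; first exact: rd.
have dG X : 'd Gr q X = (m * dot c X) *: tproj q c +
    ((psi (1 - dot c q) * dot c X) *: q + (psi (1 - dot c q) * dot c q) *: X).
  apply/rowP => j; rewrite (coord_deriv _ _ _ (c1_diff Gc)).
  apply: line_deriv.
    apply: c1_diff; apply: (c1_comp (g := fun y : E3 => y 0 j) Gc); exact: c1_coord.
  rewrite (_ : (fun t => _) = fun t : R => - psi (1 - dot c (q + t *: X)) *
     (c 0 j - dot c (q + t *: X) * (q 0 j + t * X 0 j))); last first.
    by apply/funext => t; rewrite /Gr !mxE.
  have D1 := der_dot_line c q X 0.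
  have D2 := derD (derC (q 0 j) 0) (derM (derI 0) (derC (X 0 j) 0)).
  apply: is_derive_eq (derM (derN (axial_line X pm))
    (derB (derC (c 0 j) 0) (derM D1 D2))) _.
  by rewrite /tproj !mxE scale0r addr0; ring.
apply/matrixP => i j; rewrite [LHS]mxE [RHS]mxE /covd tproj2// D; last exact: tproj_orth.
rewrite dG !dotDl !dotZl tproj_orth// mulr0 add0r -mulrA.
congr (_ * _ + _ * _).
  by rewrite tproj2// -!tproj_sym !dot_delta.
rewrite tproj2// -tproj_sym dot_delta /tproj !mxE eqxx /=.
by rewrite (dotC _ q) dot_delta eq_sym.
Qed.

Lemma deriv_gt0_near (phi : R -> R) (l : R) : is_derive (0 : R) 1 phi l -> 0 < l ->
  exists2 d : R, 0 < d & forall t, 0 < t -> t < d -> phi 0 < phi t.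
Proof.
move=> pl l0.
have pd : differentiable phi (0 : R) by apply/derivable1_diffP; exact: ex_derive.
have d1 : 'd phi (0 : R) 1 = l by rewrite -deriveE//; exact: derive_val.
have l2 : 0 < l / 2 by rewrite divr_gt0.
have /near_realP[d d0 dP] := is_diff_small (differentiableP pd) l2.
exists d => // t t0 td; have := dP t; rewrite subr0 gtr0_norm// => /(_ td).
have -> : 'd phi (0 : R) t = t * l.
  by rewrite -d1 -[t in LHS]mulr1 -[t * 1]/(t *: (1 : R)) linearZ.
rewrite ler_norml => /andP[h _]; move: h.
have : 0 < t * l by rewrite mulr_gt0.
by lra.
Qed.

Lemma half_lt (d t : R) : 0 < d -> t <= d / 2 -> t < d.
Proof. by lra. Qed.

(** * Spherical caps: connectedness, closure and outward normal *)

Definition cap c k : set E3 := [set x | S2 x /\ k < dot c x].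

Definition arc c x t : E3 := dir ((1 - t) *: x + t *: c).

Lemma arc0 c x : S2 x -> arc c x 0 = x.
Proof. by move=> xx; rewrite /arc subr0 scale1r scale0r addr0 dir_id. Qed.

Lemma arc1 c x : S2 c -> arc c x 1 = c.
Proof. by move=> cc; rewrite /arc subrr scale1r scale0r add0r dir_id. Qed.

Lemma arc_sqr c x t : S2 c -> S2 x ->
  dot ((1 - t) *: x + t *: c) ((1 - t) *: x + t *: c) =
    1 - 2 * (t * (1 - t)) * (1 - dot c x).
Proof. by move=> cc xx; rewrite !dot_simpl (dotC x c) cc xx; ring. Qed.

Lemma arc_neq0 c x t : S2 c -> S2 x -> -1 < dot c x -> (1 - t) *: x + t *: c != 0.
Proof.
move=> cc xx cx; rewrite -dot_gt0 arc_sqr//.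
have /andP[_ cx1] := S2_dot_le cc xx.
have : t * (1 - t) <= 1 / 4 by have := sqr_ge0 (t - 1 / 2); rewrite expr2; lra.
by nra.
Qed.

Lemma arc_cont c x t : S2 c -> S2 x -> -1 < dot c x ->
  {for t, continuous (arc c x)}.
Proof.
move=> cc xx cx; apply: (cont_comp (f := dir)).
  by apply: c1_cont; apply: dir_c1; exact: arc_neq0.
apply: c1_cont; apply: c1D; apply: c1_scale; last exact: c1_id.
exact: (c1B (c1_cst (1 : R) _) (c1_id _)).
Qed.

(** The product with [c] increases along the arc towards [c]. Cases arise because a cap may exceed a
    hemisphere, and normalizing the chord makes a negative product more negative. *)
Lemma arc_cap c x k t : S2 c -> S2 x -> -1 < k -> k < 1 -> k <= dot c x ->
  0 <= t <= 1 -> k < dot c x \/ 0 < t -> cap c k (arc c x t).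
Proof.
move=> cc xx k1 k2 kx /andP[]; rewrite le_eqVlt => /predU1P[<- _|t0 t1 _].
  by case; rewrite ?ltxx// arc0.
have /andP[_ u1] := S2_dot_le cc xx.
have um : -1 < dot c x by exact: lt_le_trans kx.
have n0 := arc_neq0 t cc xx um.
split; first exact: S2_dir.
rewrite /arc /dir dotZr; set v := (1 - t) *: x + t *: c in n0 *.
have v0 : 0 < enorm v by rewrite enorm_gt0.
rewrite mulrC ltr_pdivlMr//.
have r2 := arc_sqr t cc xx; rewrite -/v -enorm_sqr in r2.
have -> : dot c v = (1 - t) * dot c x + t by rewrite /v !dot_simpl cc; ring.
set u := dot c x in kx u1 um r2 *.
set r := enorm v in v0 r2 *.
have m0 : 0 <= t * (1 - t) by rewrite mulr_ge0 ?subr_ge0// ltW.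
move: u1; rewrite le_eqVlt => /predU1P[uE|u1].
  have r1 : r = 1.
    by apply/eqP; rewrite -(@eqrXn2 _ 2)// ?ltW// expr1n r2 uE; apply/eqP; ring.
  by rewrite uE r1; lra.
have ku : k * r <= u * r by rewrite ler_pM2r.
apply: le_lt_trans ku _.
have [A0|A0] := leP 0 ((1 - t) * u + t).
- have [un|up] := ltP u 0.
    by apply: lt_le_trans A0; rewrite nmulr_rlt0.
  have r_le1 : r <= 1.
    rewrite -(@ler_sqr _ r 1) ?nnegrE ?ler01 ?(ltW v0)// expr1n r2 gerBl.
    by apply: mulr_ge0; [exact: mulr_ge0|rewrite subr_ge0 ltW].
  have ur : u * r <= u by rewrite ler_piMr.
  have : 0 < t * (1 - u) by rewrite mulr_gt0// subr_gt0.
  by lra.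
(* Both sides are negative here, so their squares are compared; the difference factors through
   [1 - u ^ 2]. *)
- have un : u < 0 by nra.
  rewrite -ltrN2 -(@ltr_sqr _ (- _)) ?nnegrE; last 2 first.
  + by rewrite oppr_ge0 ltW.
  + by rewrite oppr_ge0 mulr_le0_ge0// ltW.
  rewrite !sqrrN exprMn r2.
  have : 0 < (1 - u ^+ 2) * t * - (2 * (1 - t) * u + t).
    by rewrite !mulr_gt0 ?subr_gt0 ?oppr_gt0 ?expr2//; nra.
  by rewrite !expr2; lra.
Qed.

Lemma cap_connected c k : S2 c -> -1 < k -> k < 1 -> connected (cap c k).
Proof.
move=> cc k1 k2.
have -> : cap c k = \bigcup_(x in cap c k) (arc c x @` `[0, 1]).
  apply/seteqP; split => [x Ax|y [x Ax [t tI <-]]].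
    exists x => //; exists 0; first by rewrite /= in_itv /= lexx ler01.
    by rewrite arc0//; case: Ax.
  have [xx kx] := Ax; move: tI; rewrite /= in_itv /= => t01.
  by apply: arc_cap => //; [exact: ltW|left].
apply: bigcup_connected.
  exists c => x Ax; exists 1; first by rewrite /= in_itv /= lexx ler01.
  by rewrite arc1.
move=> x [xx kx]; apply: connected_continuous_connected.
  exact: segment_connected.
by apply: continuous_subspaceT => t; apply: arc_cont => //; exact: lt_trans kx.
Qed.

Lemma closure_ge (T : topologicalType) (phi : T -> R) (A : set T) (v : T) k :
  {for v, continuous phi} -> (forall u, A u -> k <= phi u) -> closure A v -> k <= phi v.
Proof.
move=> pc Ak Ax; rewrite leNgt; apply/negP => xk.
have [u [/Ak ku uk]] := Ax _ (pc _ (near_ltr xk)).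
by move: uk; rewrite /= ltNge ku.
Qed.

Lemma closure_cap c k : S2 c -> -1 < k -> k < 1 ->
  closure (cap c k) = [set x | S2 x /\ k <= dot c x].
Proof.
move=> cc k1 k2; apply/seteqP; split => [x Ax|x [xx kx]].
  have xc : {for x, continuous (fun y : E3 => dot y y)} by apply: dot_cont; exact: cvg_id.
  have cxc : {for x, continuous (fun y : E3 => dot c y)}.
    by apply: (dot_cont (F := fun=> c)); [exact: cst_continuous|exact: cvg_id].
  split; last by apply: (closure_ge cxc _ Ax) => y [_ /ltW].
  apply/eqP; rewrite eq_le; apply/andP; split.
    rewrite -lerN2; apply: (closure_ge (contN xc) _ Ax) => y [yy _].
    by rewrite /= yy.
  by apply: (closure_ge xc _ Ax) => y [yy _]; rewrite yy.
(* A boundary point is the limit, as [t] decreases to 0, of points of its arc to the center, which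
   lie in the open cap. *)
move=> B xB; have cx : -1 < dot c x by exact: lt_le_trans kx.
have ac : arc c x t @[t --> (0 : R)] --> x.
  by rewrite -[X in _ --> X](arc0 c xx); exact: arc_cont.
have /near_realP[d d0 dP] := ac _ xB.
pose t := Num.min (d / 2) 1.
have t0 : 0 < t by rewrite lt_min divr_gt0// ltr01.
have t1 : t <= 1 by rewrite ge_min lexx orbT.
have td : t <= d / 2 by rewrite ge_min lexx.
exists (arc c x t); split; last by apply: dP; rewrite subr0 gtr0_norm//; lra.
by apply: arc_cap => //; [rewrite ltW|right].
Qed.

Lemma bdry_cap c k : S2 c -> -1 < k -> k < 1 ->
  bdry (cap c k) = [set x | S2 x /\ dot c x = k].
Proof.
move=> cc k1 k2; rewrite /bdry closure_cap//; apply/seteqP; split => x.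
  move=> [[xx kx] nx]; split => //; apply/eqP; rewrite eq_le kx andbT leNgt.
  by apply/negP => kx'; apply: nx.
by move=> [xx cx]; split; [rewrite /= cx|move=> [_]; rewrite cx ltxx].
Qed.

Lemma orthogonal_unit c : S2 c -> exists2 e, S2 e & dot c e = 0.
Proof.
move=> cc.
have [i ci] : exists i : 'I_3, tproj c (delta_mx 0 i) != 0.
  apply: contrapT => n.
  (* Otherwise the identity matrix would be the rank-one matrix of products of coordinates of [c],
     which two diagonal entries and an off-diagonal one refute. *)
  have H i j : (i == j)%:R = c 0 i * c 0 j.
    have /eqP : tproj c (delta_mx 0 i) == 0 by apply: contrapT => h; apply: n; exists i; exact/negP.
    move/rowP/(_ j); rewrite /tproj !mxE eqxx /= (dotC _ c) dot_delta eq_sym.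
    by move/subr0_eq.
  have := H 0 0; have := H 1 1; have := H 0 1; rewrite !eqxx /= => h1 h2 h3.
  have : (c 0 0 * c 0 1) ^+ 2 = 1 by rewrite exprMn !expr2 -h2 -h3 mulr1.
  by rewrite -h1 expr0n /= => /eqP; rewrite eq_sym oner_eq0.
exists (dir (tproj c (delta_mx 0 i))); first exact: S2_dir.
by rewrite /dir dotZr tproj_orth// mulr0.
Qed.

Lemma bdry_cap_neq0 c k : S2 c -> -1 < k -> k < 1 -> bdry (cap c k) !=set0.
Proof.
move=> cc k1 k2; rewrite bdry_cap//; have [e ee ce] := orthogonal_unit cc.
have k3 : 0 <= 1 - k ^+ 2 by rewrite expr2; nra.
exists (k *: c + Num.sqrt (1 - k ^+ 2) *: e); split.
  rewrite /S2 /= !dot_simpl cc ee ce (dotC e c) ce.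
  have := sqr_sqrtr k3; rewrite expr2 => h.
  by rewrite !mulr1 !mulr0 addr0 add0r h expr2; ring.
by rewrite !dot_simpl cc ce mulr1 mulr0 addr0.
Qed.

Lemma defining_cap c k q : S2 c -> -1 < k -> k < 1 -> S2 q -> dot c q = k ->
  defining_function (cap c k) q (fun x => k - dot c x).
Proof.
move=> cc k1 k2 qq cq.
have Gc x : c1 (fun x : E3 => k - dot c x) x.
  exact: (c1B (c1_cst k _) (dot_c1 (c1_cst c _) (c1_id _))).
have D x v : 'D_v (fun x : E3 => k - dot c x : R^o) x = - dot c v.
  rewrite deriveE; last exact: c1_diff (Gc x).
  apply: (line_deriv (c1_diff (Gc x))).
  apply: is_derive_eq (derB (derC k 0) (der_dot_line c x v 0)) _.
  by rewrite sub0r.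
split.
- exists setT, (fun x => k - dot c x); split => //; first exact: openT.
  split=> [x _|v]; first exact: c1_diff (Gc x).
  rewrite (_ : 'D_v _ = cst (- dot c v)); last by apply/funext => x; exact: D.
  split=> [x _|w]; first exact: differentiable_cst.
  rewrite (_ : 'D_w _ = cst 0); last by apply/funext => x; exact: derive_cst.
  by move=> x _; exact: cst_continuous.
- have -> : grad (fun x => k - dot c x) q = tproj q (- c).
    have nE : \forall y \near q, S2 y -> k - dot c y = k - dot c y by near=> y.
    apply: (grad_eq qq (c1_diff (Gc q)) nE).
    move=> X; rewrite dotNl -(D q X) deriveE//; exact: c1_diff (Gc q).
  rewrite -dot_gt0 -scaleN1r tprojZ dotZl dotZr tproj_sqr// cq.
  by rewrite mulrA mulrNN !mul1r expr2; nra.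
- near=> x; have xx : S2 x by near: x; exact: withinT.
  by rewrite subr_lt0; split => [[]//|]; split.
Unshelve. all: by end_near. Qed.

(* Moving from [q] in a tangent direction [X] with [dot c X > 0] enters the cap,
   where any defining function is negative. *)
Lemma defining_deriv_le0 c k q rho X : S2 c -> S2 q -> dot c q = k ->
  defining_function (cap c k) q rho -> dot q X = 0 -> 0 < dot c X ->
  dot (grad rho q) X <= 0.
Proof.
move=> cc qq cq [[U [G [Uo Uq [Gd _] Gr]]] _ near_rho] qX cX.
have rG : \forall y \near q, S2 y -> rho y = G y.
  have := open_nbhs_nbhs (conj Uo Uq); apply: filterS => y Uy yy.
  by rewrite Gr.
have Gdq := Gd q Uq.
rewrite (grad_deriv qq Gdq rG) tproj_id; last by rewrite dotC.
rewrite leNgt; apply/negP => l0.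
have dd := dir_c1 (S2_neq0 qq).
have Gd' : differentiable G (dir q) by rewrite dir_id.
have Hd : differentiable (G \o dir) q := differentiable_comp (c1_diff dd) Gd'.
have HX : 'd (G \o dir) q X = 'd G q X.
  by rewrite (diff_comp (c1_diff dd) Gd') [LHS]/= (dir_deriv qq qX) (dir_id qq).
have D1 := line_is_derive X Hd; rewrite HX in D1.
have Kc : c1 (fun y => dot c (dir y)) q by exact: (dot_c1 (c1_cst c _) dd).
have Ac : c1 (fun y : E3 => dot c y) q by exact: (dot_c1 (c1_cst c _) (c1_id _)).
have D2 := line_is_derive X (c1_diff Kc).
have KX : 'd (fun y => dot c (dir y)) q X = dot c X.
  have Ad' : differentiable (fun y : E3 => dot c y) (dir q) by rewrite dir_id//; exact: c1_diff Ac.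
  have := diff_comp (c1_diff dd) Ad' => /(congr1 (fun h => h X)).
  rewrite [RHS]/= (dir_deriv qq qX) (dir_id qq) => E.
  apply: etrans E _; apply: (line_deriv (c1_diff Ac)); exact: der_dot_line.
rewrite KX in D2.
have [d1 d10 d1P] := deriv_gt0_near D1 l0.
have [d2 d20 d2P] := deriv_gt0_near D2 cX.
have q0 : q + (0 : R) *: X = q by rewrite scale0r addr0.
have lc : {for (0 : R), continuous (fun t : R => q + t *: X)}.
  apply: c1_cont; apply: c1D; first exact: c1_cst.
  by apply: c1_scale; exact: c1_id.
have lc' : q + t *: X @[t --> (0 : R)] --> q by rewrite -[X in _ --> X]q0; exact: lc.
have n1 := lc' _ (near_dir qq (near_rho : \forall y \near q, S2 y -> _)).
have n2 := lc' _ (near_dir qq rG).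
have n3 := lc' _ (near_neq0 (S2_neq0 qq)).
have /near_realP[d3 d30 d3P] : \forall t \near (0 : R),
    [/\ cap c k (dir (q + t *: X)) <-> rho (dir (q + t *: X)) < 0,
      rho (dir (q + t *: X)) = G (dir (q + t *: X)) & q + t *: X != 0].
  by near=> t; split; near: t.
pose t := Num.min (d1 / 2) (Num.min (d2 / 2) (d3 / 2)).
have t0 : 0 < t by rewrite !lt_min !divr_gt0.
have t1 : t <= d1 / 2 by rewrite ge_min lexx.
have t2 : t <= d2 / 2 by rewrite !ge_min lexx orbT.
have t3 : t <= d3 / 2 by rewrite !ge_min lexx !orbT.
have [c1' c2' c3'] := d3P t ltac:(by rewrite subr0 gtr0_norm//; exact: half_lt t3).
have rq : 0 <= rho q.
  rewrite leNgt; apply/negP => /((nbhs_singleton (near_rho : \forall y \near q, S2 y -> _)) qq).2.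
  by case=> _; rewrite cq ltxx.
have : rho (dir (q + t *: X)) < 0.
  apply/c1'; split; first exact: S2_dir.
  have := d2P t t0; rewrite q0 dir_id// cq; apply; exact: half_lt t2.
rewrite c2' ltNge => /negP; apply.
have := d1P t t0; rewrite /= q0 dir_id//.
rewrite -(nbhs_singleton rG qq) => h; apply: le_trans rq _; apply: ltW; apply: h; exact: half_lt t1.
Unshelve. all: by end_near. Qed.

(** The normal may come from any defining function. Its gradient [g] is nonpositive on all
    directions entering the cap; a component [X] of [g] orthogonal to [tc], tilted slightly inwards,
    would contradict this. So [g] is a negative multiple of [tc]. *)
Lemma outward_normal_cap c k q eta : S2 c -> -1 < k -> k < 1 -> S2 q -> dot c q = k ->
  outward_normal (cap c k) q eta ->
  eta = - (Num.sqrt (1 - k ^+ 2))^-1 *: tproj q c.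
Proof.
move=> cc k1 k2 qq cq [rho dr ->]; have [_ g0 _] := dr.
set g := grad rho q in g0 *; set tc := tproj q c.
have H X : dot q X = 0 -> 0 < dot c X -> dot g X <= 0.
  exact: defining_deriv_le0 cc qq cq dr.
have k3 : 0 < 1 - k ^+ 2 by rewrite expr2; nra.
have tt : dot tc tc = 1 - k ^+ 2 by rewrite tproj_sqr// cq.
have qtc : dot q tc = 0 by exact: tproj_orth.
have ctc : dot c tc = 1 - k ^+ 2 by rewrite -tt tproj2.
have gq : dot q g = 0.
  have [[U [G [Uo Uq [Gd _] Gr]]] _ _] := dr.
  have rG : \forall y \near q, S2 y -> rho y = G y.
    have := open_nbhs_nbhs (conj Uo Uq); apply: filterS => y Uy yy.
    by rewrite Gr.
  rewrite dotC (grad_deriv qq (Gd q Uq) rG) /tproj qq scale1r subrr.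
  exact: linear0.
have cE X : dot q X = 0 -> dot c X = dot tc X.
  by move=> qX; rewrite tproj_sym tproj_id// dotC.
clearbody tc g.
pose mu := dot g tc / (1 - k ^+ 2).
have [X XE] : exists X, X = g - mu *: tc by exists (g - mu *: tc).
have qX : dot q X = 0 by rewrite XE !dot_simpl gq qtc mulr0 subrr.
have tX : dot tc X = 0.
  by rewrite XE !dot_simpl tt /mu divfK ?gt_eqF// (dotC tc g) subrr.
have cX : dot c X = 0 by rewrite cE.
have gX : dot g X = dot X X.
  by rewrite XE !dot_simpl tt (dotC tc g) /mu; field; rewrite gt_eqF.
have gtc : dot g tc <= 0 by apply: H => //; rewrite ctc.
have XX : dot X X = 0.
  apply/eqP; rewrite eq_le dot_ge0 andbT -gX leNgt; apply/negP => gX0.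
  have e0 : 0 < 1 - dot g tc by lra.
  (* Then [dot g (X + e *: tc)] equals [dot g X / 2 + e > 0]; the summand 1 keeps the denominator
     positive even if [dot g tc = 0]. *)
  pose e := dot g X / (2 * (1 - dot g tc)).
  have ep : 0 < e by rewrite divr_gt0// mulr_gt0.
  have : dot g (X + e *: tc) <= 0.
    apply: H; first by rewrite !dot_simpl qX qtc mulr0 addr0.
    by rewrite !dot_simpl cX ctc add0r mulr_gt0.
  rewrite !dot_simpl.
  have : e * (1 - dot g tc) = dot g X / 2 by rewrite /e; field; rewrite gt_eqF.
  by nra.
have gE : g = mu *: tc by apply/eqP; rewrite -subr_eq0 -XE -dot_eq0 XX.
have mu0 : mu < 0.
  rewrite lt_neqAle; apply/andP; split.
    by apply: contra g0 => /eqP m0; rewrite gE m0 scale0r.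
  by rewrite mulr_le0_ge0// invr_ge0 ltW.
have en : enorm g = - mu * Num.sqrt (1 - k ^+ 2).
  rewrite /enorm gE !dot_simpl tt mulrA -expr2 sqrtrM ?sqr_ge0// sqrtr_sqr.
  by rewrite ltr0_norm.
rewrite en gE scalerA; congr (_ *: _).
have s0 : Num.sqrt (1 - k ^+ 2) != 0 by rewrite gt_eqF// sqrtr_gt0.
by field; rewrite s0 /= lt_eqF.
Qed.
End SphereCalculus.

(** * Regularity of the Hessian at the pole *)

Section Quadratic.
Variables (R : realType) (g g1 : R -> R) (eps : R) (S : radial_system g g1 eps).
Hypothesis eps_gt0 : 0 < eps.
Hypothesis eps_lt1 : eps < 1.
Hypothesis g_der : forall x : R, is_derive x 1 g (g1 x).
Hypothesis g1_cont : continuous g1.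
Local Notation E3 := 'rV[R]_3.
Local Notation Y := (rY S).
Local Notation Z := (rZ S).
Local Notation W := (rW S).
Local Notation V := (rV S).
Local Notation Q := (rQ S).
Implicit Types (h s : R) (z w : R * E3).

(* [s (2 - s)] times the derivatives of [Q] in [h] and in [s]. *)
Definition sQh h s : R := 2 * (s - 1) * V h s - g1 (Y h s) * Z h s.
Definition sQs h s : R := (2 - g1 (Y h s)) * W h s - 4 * (1 - s) * Q h s.

Lemma dgY_jc : jc (fun h s => g1 (Y h s)).
Proof. exact: (jc_comp g1_cont (rY_jc S)). Qed.

Lemma sQh_jc : jc sQh.
Proof.
apply: jcB; last exact: (jcM dgY_jc (rZ_jc S)).
apply: jcM; last exact: rV_jc.
apply: (jc_snd (f := fun s : R => 2 * (s - 1))).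
apply: contR => s; apply: contM; first exact: contC.
by apply: contB; [exact: cvg_id|exact: contC].
Qed.

Lemma sQs_jc : jc sQs.
Proof.
apply: jcB.
  by apply: jcM; [exact: (jcB (@jcC _ 2) dgY_jc)|exact: rW_jc].
apply: jcM; last exact: rQ_jc.
apply: (jc_snd (f := fun s : R => 4 * (1 - s))).
apply: contR => s; apply: contM; first exact: contC.
by apply: contB; [exact: contC|exact: cvg_id].
Qed.

Lemma V_at0 h : V h 0 = - (g1 h / 2).
Proof.
have D : is_derive h 1 (W ^~ 0) (- (g1 h / 2)).
  rewrite (_ : W ^~ 0 = fun h => - (g h * 2^-1)); last first.
    by apply/funext => k; exact: W_at0.
  apply: is_derive_eq (derN (derM (g_der h) (derC 2^-1 h))) _.
  by rewrite mulr0 addr0.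
exact: der_unique (rW_h S h 0) D.
Qed.

(** The derivative of [Q] in [h] is [sQh] over [s (2 - s)]; as [quad] is of order [s], this
    cancellation is what makes its differential tend to 0 at the pole. *)
Lemma sQh_at0 h : sQh h 0 = 0.
Proof. by rewrite /sQh V_at0 rZ0 rY0; field. Qed.

Lemma Q_eq h s : 0 < s < 2 - eps ->
  Q h s = (2 * (s - 1) * W h s - g (Y h s)) / (s * (2 - s)).
Proof.
move=> /andP[s0 s2]; rewrite -rQ_ode//.
by field; rewrite !gt_eqF// subr_gt0; move: eps_gt0; lra.
Qed.

Lemma Q_der_h h s : 0 < s < 2 - eps ->
  is_derive h 1 (Q ^~ s) (sQh h s / (s * (2 - s))).
Proof.
move=> ss; rewrite (_ : Q ^~ s = fun h => (2 * (s - 1) * W h s - g (Y h s)) * (s * (2 - s))^-1); last first.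
  by apply/funext => k; exact: Q_eq.
apply: is_derive_eq (derM (derB (derM (derC (2 * (s - 1)) h) (rW_h S h s))
  (der_comp (f := g) (g := fun k : R => Y k s) (g_der (Y h s)) (rY_h S h s)))
  (derC (s * (2 - s))^-1 h)) _.
by rewrite /sQh mulr0 addr0 mul0r add0r.
Qed.

Lemma Q_der_s h s : 0 < s < 2 - eps ->
  is_derive s 1 (Q h) (sQs h s / (s * (2 - s))).
Proof.
move=> ss; have /andP[s0 s2] := ss.
have m0 : s * (2 - s) != 0 by rewrite mulf_neq0 ?gt_eqF// subr_gt0; move: eps_gt0; lra.
have [m1 m2] : s != 0 /\ 2 - s != 0 by move: m0; rewrite mulf_eq0 negb_or => /andP.
have D := derM (derB (derM (derM (derC 2 s) (derB (derI s) (derC 1 s))) (rW_s S h s2))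
  (der_comp (f := g) (g := Y h) (g_der (Y h s)) (rY_s S h s)))
  (derV (f := fun t : R => t * (2 - t)) m0 (derM (derI s) (derB (derC 2 s) (derI s)))).
have D' : is_derive s 1 (fun t => (2 * (t - 1) * W h t - g (Y h t)) / (t * (2 - t)))
    (sQs h s / (s * (2 - s))).
  apply: is_derive_eq D _.
  rewrite -rQ_ode// /sQs; field; rewrite m1 m2.
  by [].
apply: near_eq_is_derive D'.
have d0 : 0 < Num.min s (2 - eps - s) by rewrite lt_min s0 subr_gt0.
apply/near_realP; exists (Num.min s (2 - eps - s)) => // t.
rewrite lt_min !ltr_norml => /andP[/andP[t1 _] /andP[_ t2]].
by rewrite Q_eq//; apply/andP; split; lra.
Qed.

Lemma Q_c1 h s : 0 < s < 2 - eps -> c1 (fun p : R * R => Q p.1 p.2) (h, s).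
Proof.
move=> /andP[s0 s2].
have d0 : 0 < Num.min s (2 - eps - s) by rewrite lt_min s0 subr_gt0.
apply: (@c1_two R Q (fun h s => sQh h s / (s * (2 - s))) (fun h s => sQs h s / (s * (2 - s)))
  h s _ d0) => k t _.
rewrite lt_min !ltr_norml => /andP[/andP[t1 _] /andP[_ t2]].
have tt : 0 < t < 2 - eps by apply/andP; split; lra.
have mc : {for ((k, t) : R * R), continuous (fun q : R * R => (q.2 * (2 - q.2))^-1)}.
  apply: contV.
    by rewrite mulf_neq0 //=; [rewrite gt_eqF//; case/andP: tt|rewrite gt_eqF// subr_gt0; move: eps_gt0; lra].
  apply: contM; first exact: cvg_snd.
  by apply: contB; [exact: contC|exact: cvg_snd].
split.
- exact: Q_der_h.
- exact: Q_der_s.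
- by apply: contM => //; exact: sQh_jc.
- by apply: contM => //; exact: sQs_jc.
Qed.

Definition sig (d : E3) : R := dot d d / 2.

Lemma sig_c1 (U : normedModType R) (F : U -> E3) (u : U) : c1 F u -> c1 (fun v => sig (F v)) u.
Proof. by move=> Fc; apply: c1M (dot_c1 Fc Fc) (c1_cst _ _). Qed.

Lemma sig_gt0 d : (0 < sig d) = (d != 0).
Proof. by rewrite /sig pmulr_lgt0 ?invr_gt0// dot_gt0. Qed.

(** The part of the Euclidean Hessian of [Y h (sig d)] in which [Q] occurs, as a function of the
    height and the displacement [d] from the pole. *)
Definition quad i j z : R := Q z.1 (sig z.2) * (z.2 0 i * z.2 0 j).

Lemma coords_c1 i j z : c1 (fun z : R * E3 => z.2 0 i * z.2 0 j) z.
Proof.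
have H k : c1 (fun z : R * E3 => z.2 0 k) z.
  apply: (c1_comp (f := fun z : R * E3 => z.2) (g := fun y : E3 => y 0 k)).
    exact: c1_snd.
  exact: c1_coord.
exact: c1M (H i) (H j).
Qed.

Lemma quad_c1_off i j z : z.2 != 0 -> sig z.2 < 2 - eps -> c1 (quad i j) z.
Proof.
move=> d0 s2; apply: c1M _ (coords_c1 i j z).
apply: (c1_comp (f := fun z : R * E3 => (z.1, sig z.2)) (g := fun p : R * R => Q p.1 p.2)).
  by apply: c1_pair; [exact: c1_fst|apply: sig_c1; exact: c1_snd].
by apply: Q_c1; rewrite sig_gt0 d0.
Qed.

(** Bounds the operator norm of the differential of [quad] off the pole, and tends to 0 at it. *)
Definition quad_bound z : R :=
  2 / eps * `|sQh z.1 (sig z.2)| + (6 / eps * `|sQs z.1 (sig z.2)| + 2 * `|Q z.1 (sig z.2)|) * `|z.2|.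

Lemma quad_bound_cont h : {for ((h, 0) : R * E3), continuous quad_bound}.
Proof.
have sc : {for ((h, 0) : R * E3), continuous (fun z : R * E3 => (z.1, sig z.2))}.
  apply: cont_pair; first exact: cvg_fst.
  by apply: c1_cont; apply: sig_c1; exact: c1_snd.
have H F : jc F -> {for ((h, 0) : R * E3), continuous (fun z : R * E3 => `|F z.1 (sig z.2)|)}.
  move=> Fc; apply: (cont_comp (f := fun p : R * R => `|F p.1 p.2|)) sc.
  apply: (cont_comp (f := fun t : R => `|t|)); first exact: norm_continuous.
  exact: Fc.
apply: contD; first by apply: contM; [exact: contC|exact: (H _ sQh_jc)].
apply: contM; last first.
  apply: (cont_comp (f := fun d : E3 => `|d|)); first exact: norm_continuous.
  exact: cvg_snd.
apply: contD; first by apply: contM; [exact: contC|exact: (H _ sQs_jc)].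
by apply: contM; [exact: contC|exact: (H _ (rQ_jc S))].
Qed.

Lemma sig0 : sig 0 = 0. Proof. by rewrite /sig dot0r mul0r. Qed.

Lemma quad_bound0 h : quad_bound (h, 0) = 0.
Proof. by rewrite /quad_bound /= sig0 sQh_at0 !normr0 !mulr0 addr0. Qed.

Lemma coords_le (d : E3) i j : `|d 0 i * d 0 j| <= 2 * sig d.
Proof.
rewrite /sig mulrCA divff// mulr1.
have := coord_sqr_le d i; have := coord_sqr_le d j.
have := sqr_ge0 (d 0 i - d 0 j); have := sqr_ge0 (d 0 i + d 0 j).
by rewrite !expr2 ler_norml => *; apply/andP; split; lra.
Qed.

Lemma le_norm1 (A B : normedModType R) (z : A * B) : `|z.1| <= `|z|.
Proof. by rewrite prod_normE le_max lexx. Qed.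

Lemma le_norm2 (A B : normedModType R) (z : A * B) : `|z.2| <= `|z|.
Proof. by rewrite prod_normE le_max lexx orbT. Qed.

Lemma quad_diff_off i j z w : z.2 != 0 -> sig z.2 < 2 - eps ->
  `|'d (quad i j) z w| <= quad_bound z * `|w|.
Proof.
move=> d0 s2; have qc := quad_c1_off i j d0 s2.
set h := z.1; set d := z.2 in d0 s2 *; set s := sig d.
have ss : 0 < s < 2 - eps by rewrite sig_gt0 d0.
have [s0 s2'] := andP ss.
have e0 : 0 < 2 - s by move: eps_gt0; lra.
have D0 : is_derive (0 : R) 1 (fun t : R => h + t * w.1) (w.1).
  apply: is_derive_eq (derD (derC h 0) (derM (derI 0) (derC (w.1) 0))) _; ring.
have Dc k : is_derive (0 : R) 1 (fun t : R => d 0 k + t * w.2 0 k) (w.2 0 k).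
  apply: is_derive_eq (derD (derC (d 0 k) 0) (derM (derI 0) (derC (w.2 0 k) 0))) _; ring.
have Ds : is_derive (0 : R) 1 (fun t : R => sig (d + t *: w.2)) (dot d w.2).
  rewrite (_ : (fun t => _) = fun t : R => s + (t * dot d w.2 + t * (t * sig w.2))); last first.
    by apply/funext => t; rewrite /s /sig !dot_simpl (dotC w.2 d); field.
  apply: is_derive_eq (derD (derC s 0) (derD (derM (derI 0) (derC (dot d w.2) 0))
    (derM (derI 0) (derM (derI 0) (derC (sig w.2) 0))))) _.
  by ring.
have DQ : is_derive (0 : R) 1 (fun t : R => Q (h + t * w.1) (sig (d + t *: w.2)))
    ((sQh h s * w.1 + sQs h s * dot d w.2) / (s * (2 - s))).
  have D := @der_chain2 R Q (fun t : R => h + t * w.1) (fun t : R => sig (d + t *: w.2))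
    0 h s _ _ _ _ (c1_diff (Q_c1 h ss)) _ _ (Q_der_h h ss) (Q_der_s h ss) D0 Ds.
  apply: is_derive_eq (D _ _) _; first by rewrite mul0r addr0.
    by rewrite scale0r addr0.
  by ring.
have -> : 'd (quad i j) z w = (sQh h s * w.1 + sQs h s * dot d w.2) / (s * (2 - s)) * (d 0 i * d 0 j) +
    Q h s * (w.2 0 i * d 0 j + d 0 i * w.2 0 j).
  apply: (line_deriv (c1_diff qc)).
  rewrite (_ : (fun t => _) = fun t : R => Q (h + t * w.1) (sig (d + t *: w.2)) *
    ((d 0 i + t * w.2 0 i) * (d 0 j + t * w.2 0 j))); last first.
    by apply/funext => t; rewrite /quad /= !mxE.
  apply: is_derive_eq (derM DQ (derM (Dc i) (Dc j))) _.
  by rewrite scale0r !mul0r !addr0.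
set A := sQh h s; set B := sQs h s; set q := Q h s.
have m0 : 0 < s * (2 - s) by rewrite mulr_gt0.
have e2 : (2 - s)^-1 <= eps^-1 by rewrite lef_pV2 ?posrE//; lra.
(* The product of coordinates is at most [2 * s] and so absorbs the singular denominator of the
   derivatives of [Q]. *)
have cd : `|(d 0 i * d 0 j) / (s * (2 - s))| <= 2 / eps.
  rewrite normrM normfV (gtr0_norm m0) ler_pdivrMr//.
  apply: le_trans (coords_le d i j) _; rewrite -/s.
  rewrite (_ : 2 / eps * (s * (2 - s)) = 2 * s * ((2 - s) / eps)); last by ring.
  have e3 : 1 <= (2 - s) / eps by rewrite ler_pdivlMr// mul1r; lra.
  by rewrite ler_peMr// mulr_ge0// ltW.
have w1 := le_norm1 w; have w2 := le_norm2 w.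
have nw : 0 <= `|w| by [].
have nd : 0 <= `|d| by [].
have dw : `|dot d w.2| <= 3 * `|d| * `|w|.
  apply: le_trans (dot_le _ _) _; rewrite mulrA ler_wpM2l// mulr_ge0//.
have cw k l : `|w.2 0 k * d 0 l| <= `|w| * `|d|.
  by rewrite normrM ler_pM// ?coord_le_norm//; apply: le_trans w2; exact: coord_le_norm.
have b1 : `|(A * w.1 + B * dot d w.2) / (s * (2 - s)) * (d 0 i * d 0 j)| <=
    (`|A| * `|w| + `|B| * (3 * `|d| * `|w|)) * (2 / eps).
  rewrite mulrAC -mulrA normrM ler_pM//.
  apply: le_trans (ler_normD _ _) _; rewrite !normrM lerD// ler_wpM2l//.
have b2 : `|q * (w.2 0 i * d 0 j + d 0 i * w.2 0 j)| <= `|q| * (2 * (`|w| * `|d|)).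
  rewrite normrM ler_wpM2l//; apply: le_trans (ler_normD _ _) _.
  by rewrite mulr2n mulrDl mul1r lerD// [d 0 i * _]mulrC.
apply: le_trans (ler_normD _ _) _; apply: le_trans (lerD b1 b2) _.
rewrite /quad_bound -/h -/d -/s -/A -/B -/q le_eqVlt; apply/orP; left; apply/eqP.
by field; rewrite gt_eqF.
Qed.

Lemma cont_zero (T : topologicalType) (F : T -> R) (t : T) : F t = 0 ->
  (forall e, 0 < e -> \forall u \near t, `|F u| < e) -> {for t, continuous F}.
Proof.
move=> F0 H; apply/cvgrPdist_lt => e /H; rewrite F0; apply: filterS => u.
by rewrite sub0r normrN.
Qed.

Lemma quad_diff0 i j h : is_diff ((h, 0) : R * E3) (quad i j) (fun=> 0).
Proof.
pose Z0 : {linear (R * E3)%type -> R} := \0.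
apply: (@is_diff_of_small _ _ _ (quad i j) (h, 0) Z0); first exact: cst_continuous.
move=> e e0.
have Qc : {for ((h, 0) : R * E3), continuous (fun z : R * E3 => Q z.1 (sig z.2) * `|z.2|)}.
  apply: contM.
    apply: (cont_comp (f := fun p : R * R => Q p.1 p.2)
      (g := fun z : R * E3 => (z.1, sig z.2))); first exact: rQ_jc.
    apply: cont_pair; first exact: cvg_fst.
    by apply: c1_cont; apply: sig_c1; exact: c1_snd.
  apply: (cont_comp (f := fun d : E3 => `|d|) (g := fun z : R * E3 => z.2)); last exact: cvg_snd.
  exact: norm_continuous.
apply: filterS (cont_near Qc e0) => z; rewrite /= normr0 mulr0 subr0 => zP.
rewrite subr0 /quad /= !mxE mul0r mulr0 subr0 normrM.
have zn : `|z.2| <= `|z - (h, 0)|.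
  by apply: le_trans (le_norm2 (z - (h, 0))); rewrite /= subr0.
apply: (@le_trans _ _ (`|Q z.1 (sig z.2)| * (`|z.2| * `|z.2|))).
  by rewrite ler_wpM2l// normrM ler_pM// coord_le_norm.
rewrite mulrA ler_pM ?mulr_ge0// ltW//.
by rewrite normrM normr_id in zP.
Qed.

(* On [z.2 = 0] the function [quad] is flat, although [Q] itself need not be
   differentiable in [s] at [s = 0]. *)
Lemma quad_c1 i j z : sig z.2 < 2 - eps -> c1 (quad i j) z.
Proof.
move=> z2; have [d0|dn] := eqVneq z.2 0; last exact: quad_c1_off.
case: z d0 z2 => h _ /= -> _.
have at0 k : c1_at (quad i j) (k, 0).
  have D0 := quad_diff0 i j k.
  split=> [|v]; first exact: ex_diff.
  have Bc : {for ((k, 0, v) : (R * E3) * (R * E3)),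
      continuous (fun x : (R * E3) * (R * E3) => quad_bound x.1 * `|x.2|)}.
    apply: contM.
      apply: (cont_comp (f := quad_bound)); last exact: cvg_fst.
      exact: quad_bound_cont.
    apply: (cont_comp (f := fun d : R * E3 => `|d|)); first exact: norm_continuous.
    exact: cvg_snd.
  have sn : \forall x \near ((k, 0, v) : (R * E3) * (R * E3)), sig x.1.2 < 2 - eps.
    have sc : {for ((k, 0, v) : (R * E3) * (R * E3)), continuous
        (fun x : (R * E3) * (R * E3) => sig x.1.2)}.
      apply: (cont_comp (f := sig)); first by apply: c1_cont; apply: sig_c1; exact: c1_id.
      apply: (cont_comp (f := fun z : R * E3 => z.2)); first exact: cvg_snd.
      exact: cvg_fst.
    apply: (sc _ (near_ltr _)); rewrite /= sig0; move: eps_lt1; lra.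
  apply: cont_zero => [|e e0]; first by rewrite /= (diff_val (is_diff_def := D0)).
  have Be := cont_near Bc e0.
  near=> x.
  have xb : `|quad_bound x.1 * `|x.2| - quad_bound (k, 0) * `|v| | < e by near: x.
  have x2 : sig x.1.2 < 2 - eps by near: x.
  rewrite quad_bound0 mul0r subr0 in xb.
  have [x0|xn] := eqVneq x.1.2 0.
    have E : x.1 = (x.1.1, 0) by case: (x.1) x0 => ? ? /= ->.
    by rewrite E (diff_val (is_diff_def := quad_diff0 i j x.1.1)) normr0.
  apply: le_lt_trans (quad_diff_off i j x.2 xn x2) _.
  exact: le_lt_trans (ler_norm _) xb.
have sn : \forall y \near ((h, 0) : R * E3), sig y.2 < 2 - eps.
  have sc : {for ((h, 0) : R * E3), continuous (fun y : R * E3 => sig y.2)}.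
    apply: (cont_comp (f := sig)); first by apply: c1_cont; apply: sig_c1; exact: c1_id.
    exact: cvg_snd.
  apply: (sc _ (near_ltr _)); rewrite /= sig0; move: eps_lt1; lra.
apply: filterS sn => y y2; have [y0|yn] := eqVneq y.2 0.
  have -> : y = (y.1, 0) by case: y y0 {y2} => ? ? /= ->.
  exact: at0.
exact: nbhs_singleton (quad_c1_off i j yn y2).
Unshelve. all: by end_near. Qed.
End Quadratic.

(** * C^3 regularity of a single solution *)

Section Smoothness.
Variable R : realType.
Local Notation E3 := 'rV[R]_3.

Lemma Ck_eq (V W : normedModType R) (k : nat) (U : set V) (F G : V -> W) :
  open U -> (forall x, U x -> F x = G x) -> Ck k U F -> Ck k U G.
Proof.
move=> Uo; elim: k F G => [|k IH] F G FG /=.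
  move=> Fc x Ux; apply: near_eq_cont_at (Fc x Ux).
  by have := open_nbhs_nbhs (conj Uo Ux); apply: filterS => y /FG.
have nFG x : U x -> \forall y \near x, F y = G y.
  by move=> Ux; have := open_nbhs_nbhs (conj Uo Ux); apply: filterS => y /FG.
move=> [Fd FC]; split=> [x Ux|v].
  have D := near_eq_diff (nFG x Ux) (differentiableP (Fd x Ux)); exact: ex_diff.
apply: IH (FC v) => x Ux; exact: near_eq_derive (nFG x Ux).
Qed.

Lemma c1_Ck1 (V W : normedModType R) (U : set V) (F : V -> W) :
  (forall x, U x -> c1 F x) -> Ck 1 U F.
Proof.
move=> Fc; split=> [x Ux|v x Ux]; first exact: c1_diff (Fc x Ux).
have [_ /(_ v) dc] := nbhs_singleton (Fc x Ux).
have dc' : {for x, continuous (fun y => 'd F y v)}.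
  apply: (@continuous_comp_at _ _ _ (fun z : V * V => 'd F (z.1) (z.2)) (fun y => (y, v))) => //.
  by apply: cont_pair; [exact: cvg_id|exact: cst_continuous].
apply: near_eq_cont_at dc'.
by apply: filterS (Fc x Ux) => y [Fd _]; rewrite deriveE.
Qed.

Lemma c1_Ck_near (V W : normedModType R) (X : set V) (F G : V -> W) (x : V) :
  c1 G x -> (\forall y \near x, X y -> G y = F y) -> Ck_near 1 X F x.
Proof.
move=> Gc GF.
have n : \forall y \near x, c1 G y /\ (X y -> G y = F y).
  by near=> y; split; near: y => //; exact: c1_near.
exists [set y | c1 G y /\ (X y -> G y = F y)]°, G; split => //.
- exact: open_interior.
- by apply: c1_Ck1 => y /interior_subset[].
- by move=> y /interior_subset[_].
Unshelve. all: by end_near. Qed.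

Variables (g g1 : R -> R) (eps : R) (S : radial_system g g1 eps).
Hypothesis eps_gt0 : 0 < eps.
Hypothesis eps_lt1 : eps < 1.
Hypothesis g_der : forall x : R, is_derive x 1 g (g1 x).
Hypothesis g1_cont : continuous g1.
Variables (h : R) (c : E3).
Local Notation Y := (rY S).
Local Notation W := (rW S).
Local Notation Q := (rQ S).

Lemma shift_c1 (x : E3) : c1 (fun x => x - c) x.
Proof. exact: (c1B (c1_id _) (c1_cst c _)). Qed.

Lemma fixed_c1 (F : R -> R -> R) (x : E3) :
  c1 (fun p : R * R => F p.1 p.2) (h, sig (x - c)) ->
  c1 (fun x => F h (sig (x - c))) x.
Proof.
move=> Fc; apply: (c1_comp (f := fun x : E3 => (h, sig (x - c))) _ Fc).
exact: (c1_pair (c1_cst h _) (sig_c1 (shift_c1 x))).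
Qed.

Lemma dist_line (x v : E3) :
  is_derive (0 : R) 1 (fun t : R => sig (x + t *: v - c)) (dot (x - c) v).
Proof.
rewrite (_ : (fun t => _) = fun t : R => sig (x - c) + (t * dot (x - c) v + t * (t * sig v))); last first.
  apply/funext => t; rewrite addrAC; move: (x - c) => d.
  by rewrite /sig !dot_simpl (dotC v d); field.
apply: is_derive_eq (derD (derC (sig (x - c)) 0) (derD (derM (derI 0) (derC (dot (x - c) v) 0))
  (derM (derI 0) (derM (derI 0) (derC (sig v) 0))))) _.
by ring.
Qed.

Lemma shift_line (x v w : E3) :
  is_derive (0 : R) 1 (fun t : R => dot (x + t *: v - c) w) (dot v w).
Proof.
rewrite (_ : (fun t => _) = fun t : R => dot w (x - c + t *: v)); last first.
  by apply/funext => t; rewrite addrAC dotC.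
by rewrite dotC; exact: der_dot_line.
Qed.

Lemma line0 (x v : E3) : x + (0 : R) *: v - c = x - c.
Proof. by rewrite scale0r addr0. Qed.

(** The second directional derivatives are combinations of [quad] and [W (sig (x - c))], all C^1
    although [Q] alone may fail to be so at the pole. *)
Lemma profile_C3 : Ck 3 [set x : E3 | sig (x - c) < 2 - eps]
  (fun x => Y h (sig (x - c)) : R^o).
Proof.
set U := [set x | _].
have Uo : open U.
  apply: (@open_comp _ _ (fun x : E3 => sig (x - c)) [set t : R | t < 2 - eps]); last exact: open_lt.
  by move=> x _; apply: c1_cont; apply: sig_c1; exact: shift_c1.
have Yc x : c1 (fun x => Y h (sig (x - c))) x by apply: fixed_c1; exact: Y_c1.
have Wc x : U x -> c1 (fun x => W h (sig (x - c))) x by move=> Ux; apply: fixed_c1; exact: W_c1.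
have dc v x : c1 (fun x => dot (x - c) v) x.
  exact: (dot_c1 (shift_c1 x) (c1_cst v _)).
have D1 v : 'D_v (fun x => Y h (sig (x - c)) : R^o) = fun x => W h (sig (x - c)) * dot (x - c) v.
  apply/funext => x; rewrite deriveE; last exact: c1_diff (Yc x).
  apply: (line_deriv (c1_diff (Yc x))).
  have Yd := rY_s S h (sig (x + (0 : R) *: v - c)).
  have := der_comp (f := Y h) (g := fun t : R => sig (x + t *: v - c)) Yd (dist_line x v).
  by rewrite line0.
have Gc v x : U x -> c1 (fun x => W h (sig (x - c)) * dot (x - c) v) x.
  by move=> Ux; exact: (c1M (Wc x Ux) (dc v x)).
split=> [x _|v]; first exact: c1_diff (Yc x).
rewrite D1; split=> [x Ux|w]; first exact: c1_diff (Gc v x Ux).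
pose G x := \sum_(i < 3) \sum_(j < 3) (w 0 i * v 0 j) * quad S i j (h, x - c) +
  W h (sig (x - c)) * dot w v.
have GE x : G x = Q h (sig (x - c)) * (dot (x - c) w * dot (x - c) v) +
    W h (sig (x - c)) * dot w v.
  congr (_ + _); rewrite /quad /=; move: (x - c) => d.
  rewrite [dot d w]/dot mulr_suml mulr_sumr; apply: eq_bigr => i _.
  by rewrite /dot !mulr_sumr; apply: eq_bigr => j _; ring.
apply: (@Ck_eq _ _ _ _ G) => //.
- move=> x Ux; rewrite GE deriveE; last exact: c1_diff (Gc v x Ux).
  apply/esym; apply: (line_deriv (c1_diff (Gc v x Ux))).
  have s2 : sig (x + (0 : R) *: w - c) < 2 - eps by rewrite line0.
  have Wd := rW_s S h s2.
  have := derM (der_comp (f := W h) (g := fun t : R => sig (x + t *: w - c)) Wd (dist_line x w))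
    (shift_line x w v).
  rewrite line0 => D; apply: is_derive_eq D _; by ring.
- apply: c1_Ck1 => x Ux; apply: c1D; last exact: (c1M (Wc x Ux) (c1_cst _ _)).
  apply: c1_sum => i; apply: c1_sum => j; apply: c1M (c1_cst _ _) _.
  apply: (c1_comp (f := fun x : E3 => (h, x - c)) (g := quad S i j)).
    exact: (c1_pair (c1_cst h _) (shift_c1 x)).
  exact: quad_c1.
Qed.
End Smoothness.

(** * The family of candidate solutions *)

Section Candidates.
Variables (R : realType) (f : R -> R).
Hypothesis f_derivable : forall x : R, derivable f x 1.
Hypothesis f_C1 : continuous (derive1 f).
Hypothesis f_pos : forall x : R, 0 < x -> 0 < f x.
Hypothesis f_sub : forall x : R, 0 < x -> x * derive1 f x <= f x.
Local Notation E3 := 'rV[R]_3.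
Local Notation T := (E3 * E3 * R^o)%type.
Implicit Types (p : T) (x y q c X : E3) (n : nat) (h s : R).

Local Notation Y n := (rY (sys f_C1 n)).
Local Notation W n := (rW (sys f_C1 n)).
Local Notation Q n := (rQ (sys f_C1 n)).
Local Notation reg n := (reg (bound R n) (sys f_C1 n)).
Local Notation N := (@paramN R).

Definition grad_sq p : R := dot p.1.2 p.1.2.
Definition height_of p : R := height f_C1 p.2 (grad_sq p).
Definition depth_of p : R := depth f_C1 p.2 (grad_sq p).

Definition profile_slope h s : R := W (xget 0%N [set n | reg n h s]) h s.

Lemma profile_slopeE n h s : reg n h s -> 0 <= s -> profile_slope h s = W n h s.
Proof.
move=> rs s0; rewrite /profile_slope; case: xgetP => [m _ rm|/(_ n)]; last by case.
have [_ _ <-] := reg_mono (leq_maxl m n) rm s0.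
by have [_ _ <-] := reg_mono (leq_maxr m n) rs s0.
Qed.

(* The gradient at [q] of [Y h (1 - dot c x)] is [- W *: tproj q c], and
   [dot c q = 1 - s]. *)
Definition center p : E3 :=
  (1 - depth_of p) *: p.1.1 - (profile_slope (height_of p) (depth_of p))^-1 *: p.1.2.

Definition Om p : set E3 := cap (center p) (1 - radius f_C1 (height_of p)).

Definition sol_fun p x : R := profile f_C1 (height_of p) (1 - dot (center p) x).

Lemma paramN_ge0 p : N p -> [/\ 0 <= p.2, 0 <= grad_sq p & (p.2 : R, grad_sq p) != (0, 0)].
Proof.
move=> [_ a0 ne]; split=> //; first exact: dot_ge0.
apply: contra ne => /eqP[E1 E2]; apply/eqP; congr (_, _); last exact: E1.
by apply/eqP; rewrite -dot_eq0; apply/eqP.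
Qed.

Lemma param_sol p : N p -> sol f_C1 p.2 (grad_sq p) (height_of p) (depth_of p).
Proof. by move=> /paramN_ge0[a0 b0 ne]; exact: sol_height. Qed.

Lemma center_dot p : N p -> dot (center p) p.1.1 = 1 - depth_of p.
Proof.
move=> [[qq qw] _ _]; rewrite /center !dot_simpl qq (dotC _ p.1.1) qw.
by rewrite mulr1 mulr0 subr0.
Qed.

Lemma center_tproj p : N p ->
  tproj p.1.1 (center p) = - (profile_slope (height_of p) (depth_of p))^-1 *: p.1.2.
Proof.
move=> Np; rewrite /tproj center_dot//.
by rewrite /center addrAC subrr sub0r scaleNr.
Qed.

(** As [q] and [w] are orthogonal and [s (2 - s) W ^ 2 = |w| ^ 2], the squared length is
    [(1 - s) ^ 2 + s (2 - s) = 1]. *)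
Lemma center_S2 p : N p -> S2 (center p).
Proof.
move=> Np; have [n [s0 rs _ gs]] := param_sol Np.
have [[qq qw] _ _] := Np.
have Wn : W n (height_of p) (depth_of p) != 0 by rewrite lt_eqF// (reg_W rs).
rewrite /S2 /= /center (profile_slopeE rs s0) !dot_simpl qq (dotC _ p.1.1) qw -/(grad_sq p) -gs gradsqE.
by field.
Qed.

Lemma height_of_gt0 p : N p -> 0 < height_of p.
Proof. by move=> /param_sol[n [_ [h0 _ _ _] _ _]]. Qed.

Lemma cap_height p : N p ->
  -1 < 1 - radius f_C1 (height_of p) /\ 1 - radius f_C1 (height_of p) < 1.
Proof.
move=> /height_of_gt0 h0; have /andP[r0 r2] := rim_gt0 (rim_radius f_derivable f_C1 f_pos h0).
by split; lra.
Qed.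

Lemma Om_closure p : N p ->
  closure (Om p) = [set x | S2 x /\ 1 - radius f_C1 (height_of p) <= dot (center p) x].
Proof.
by move=> Np; have [k1 k2] := cap_height Np; apply: closure_cap => //; exact: center_S2.
Qed.

Lemma Om_bdry p : N p ->
  bdry (Om p) = [set x | S2 x /\ dot (center p) x = 1 - radius f_C1 (height_of p)].
Proof.
by move=> Np; have [k1 k2] := cap_height Np; apply: bdry_cap => //; exact: center_S2.
Qed.

(** A single truncation index serves the whole closed cap, namely one that sees its rim. *)
Lemma closure_regular p : N p -> exists n,
  [/\ 0 < height_of p < bound R n, Y n (height_of p) (radius f_C1 (height_of p)) = 0,
      reg n (height_of p) (radius f_C1 (height_of p)) &
      forall x, closure (Om p) x -> [/\ S2 x, 0 <= 1 - dot (center p) x,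
        1 - dot (center p) x <= radius f_C1 (height_of p) & reg n (height_of p) (1 - dot (center p) x)]].
Proof.
move=> Np; have [n [s0 rs Ys]] := rim_radius f_derivable f_C1 f_pos (height_of_gt0 Np).
exists n; split => //; first by have [] := reg_pos_lt rs.
move=> x; rewrite Om_closure// => -[xx kx].
have /andP[_ cx] := S2_dot_le (center_S2 Np) xx.
have sr : 1 - dot (center p) x <= radius f_C1 (height_of p) by lra.
by split => //; [rewrite subr_ge0|exact: reg_le rs sr].
Qed.

Lemma rim_pos n h s t : reg n h s -> Y n h s = 0 -> 0 <= t -> t <= s -> 0 <= Y n h t.
Proof.
move=> rs Ys t0; rewrite le_eqVlt => /predU1P[->|ts]; first by rewrite Ys.
have ps : pos (sys f_C1 n) h s by apply: reg_pos rs _; rewrite Ys.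
by apply/ltW/ps; rewrite t0.
Qed.

(** [reg] lets the depth pass the rim, but [Y] still decreases there, so the value at the base point
    would be negative, against [a >= 0]. *)
Lemma basepoint_closure p : N p -> closure (Om p) p.1.1.
Proof.
move=> Np; rewrite Om_closure//= center_dot//; have [[qq _] a0 _] := Np; split => //.
rewrite lerD2l lerN2 leNgt; apply/negP => rlt.
have [n [s0 rs Ys _]] := param_sol Np.
have [m [r0 rr Yr]] := rim_radius f_derivable f_C1 f_pos (height_of_gt0 Np).
have [rs' Ys' _] := reg_mono (leq_maxl n m) rs s0.
have [_ Yr' _] := reg_mono (leq_maxr n m) rr r0.
have [_ _ _ Wn] := rs'.
have : Y (maxn n m) (height_of p) (depth_of p) < Y (maxn n m) (height_of p) (radius f_C1 (height_of p)).
  apply: (deriv_lt0_gt (df := W (maxn n m) (height_of p)) rlt) => [x _|x /andP[x1 x2]].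
    exact: rY_s.
  by apply: Wn; rewrite (le_trans r0 (ltW x1)) ltW.
by rewrite Yr' Yr Ys' Ys ltNge a0.
Qed.

(** Height and depth depend on [w] through its squared length only, which is smooth also at [w = 0].
    The extensions are C^1 in the ambient space, across the boundary [a = 0] of the parameters. *)
Lemma center_c1 p0 : N p0 -> exists (H : T -> R) (C : T -> E3),
  [/\ c1 H p0, c1 C p0 & \forall p \near p0, N p -> height_of p = H p /\ center p = C p].
Proof.
move=> Np; have [n sn] := param_sol Np; have [a0 b0 ne] := paramN_ge0 Np.
have [H [S [Hc Sc H0 S0 HS]]] := sol_c1 f_derivable f_pos f_sub a0 sn.
pose par p : R * R := (p.2 : R, grad_sq p).
have wc : c1 (fun p : T => p.1.2) p0.
  by apply: (c1_comp_fst (f := fun z : E3 * E3 => z.2)); exact: c1_snd.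
have qc : c1 (fun p : T => p.1.1) p0.
  by apply: (c1_comp_fst (f := fun z : E3 * E3 => z.1)); exact: c1_fst.
have pc : c1 par p0 by exact: (c1_pair (c1_snd p0) (dot_c1 wc wc)).
have Hpc : c1 (fun p => H (par p)) p0 by exact: (c1_comp pc Hc).
have Spc : c1 (fun p => S (par p)) p0 by exact: (c1_comp pc Sc).
have [s0 [h0 hM s2 Wn0] _ _] := sn.
have Wc : c1 (fun p => W n (H (par p)) (S (par p))) p0.
  apply: (c1_comp (f := fun p => (H (par p), S (par p))) (g := fun z : R * R => W n z.1 z.2)).
    exact: (c1_pair Hpc Spc).
  by rewrite /par /grad_sq H0 S0; exact: W_c1.
have Wn : W n (H (par p0)) (S (par p0)) != 0.
  by rewrite /par /grad_sq H0 S0 lt_eqF// Wn0// s0 lexx.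
have nS : \forall p \near p0, 0 <= grad_sq p -> sol_at f_C1 n p.2 (grad_sq p) (H (par p)) (S (par p)).
  have pcc : par p @[p --> p0] --> ((p0.2 : R, grad_sq p0) : R * R) by exact: (c1_cont pc).
  exact: (pcc _ HS).
exists (fun p => H (par p)), (fun p => (1 - S (par p)) *: p.1.1 -
  (W n (H (par p)) (S (par p)))^-1 *: p.1.2); split; first exact: Hpc.
  apply: c1B; first exact: (c1_scaler (c1B (c1_cst (1 : R) _) Spc) qc).
  have Vc : c1 (fun p => (W n (H (par p)) (S (par p)))^-1) p0.
    exact: (c1V (f := fun p => W n (H (par p)) (S (par p))) Wn Wc).
  exact: (c1_scaler Vc wc).
apply: filterS nS => p sp /paramN_ge0[pa pb pne].
have sp' := sp pb.
have [tE dE] : height f_C1 p.2 (grad_sq p) = H (par p) /\ depth f_C1 p.2 (grad_sq p) = S (par p).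
  by apply: height_eq => //; exists n.
rewrite /center /height_of /depth_of tE dE; split => //.
by have [sp0 rp _ _] := sp'; rewrite (profile_slopeE rp sp0).
Qed.

Lemma regular_near n p0 x0 : N p0 -> S2 x0 -> reg n (height_of p0) (1 - dot (center p0) x0) ->
  \forall z \near ((p0, x0) : T * E3), N z.1 -> S2 z.2 ->
    reg n (height_of z.1) (1 - dot (center z.1) z.2).
Proof.
move=> Np Sx r0; have [H [C [Hc Cc HC]]] := center_c1 Np.
have [HE CE] := nbhs_singleton HC Np.
have s0 : 0 <= 1 - dot (center p0) x0.
  by have /andP[_] := S2_dot_le (center_S2 Np) Sx; rewrite subr_ge0.
have [d d0 dP] := reg_open r0 s0.
have Hz : {for ((p0, x0) : T * E3), continuous (fun z : T * E3 => H z.1)}.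
  by apply: (cont_comp (f := H)); [exact: c1_cont|exact: cvg_fst].
have Cz : {for ((p0, x0) : T * E3), continuous (fun z : T * E3 => 1 - dot (C z.1) z.2)}.
  apply: contB; first exact: contC.
  apply: dot_cont; last exact: cvg_snd.
  by apply: (continuous_comp_at (f := C)); [exact: c1_cont|exact: cvg_fst].
have n1 := cont_near Hz d0.
have n2 := cont_near Cz d0.
have n3 : \forall z \near ((p0, x0) : T * E3), N z.1 -> height_of z.1 = H z.1 /\ center z.1 = C z.1.
  exact: (@cvg_fst _ _ (nbhs p0) (nbhs x0) _ _ HC).
near=> z => Nz Sz.
have [-> ->] : height_of z.1 = H z.1 /\ center z.1 = C z.1 by move: Nz; near: z.
apply: dP.
- by rewrite HE; near: z.
- by rewrite CE; near: z.
Unshelve. all: by end_near. Qed.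

Lemma sol_fun_near n p x : N p -> S2 x -> reg n (height_of p) (1 - dot (center p) x) ->
  \forall y \near x, S2 y -> reg n (height_of p) (1 - dot (center p) y) /\
    sol_fun p y = Y n (height_of p) (1 - dot (center p) y).
Proof.
move=> Np Sx r0.
have s0 y : S2 y -> 0 <= 1 - dot (center p) y.
  by move=> Sy; have /andP[_] := S2_dot_le (center_S2 Np) Sy; rewrite subr_ge0.
have H := regular_near Np Sx r0.
have pc : {for x, continuous (fun y : E3 => ((p, y) : T * E3))}.
  by apply: cont_pair; [exact: cst_continuous|exact: cvg_id].
have pcc : ((p, y) : T * E3) @[y --> x] --> ((p, x) : T * E3) by exact: pc.
have pH : \forall y \near x, N p -> S2 y -> reg n (height_of p) (1 - dot (center p) y).
  exact: (pcc _ H).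
apply: filterS pH => y Hy Sy; have r := Hy Np Sy; split => //; exact: profileE r (s0 y Sy).
Qed.

Lemma section_c1 (F : R -> R -> R) h s : c1 (fun p : R * R => F p.1 p.2) (h, s) ->
  c1 (F h) s.
Proof.
move=> Fc; apply: (c1_comp (f := fun s : R => (h, s)) _ Fc).
exact: (c1_pair (c1_cst h _) (c1_id _)).
Qed.

Lemma sol_fun_grad n p x : N p -> S2 x -> reg n (height_of p) (1 - dot (center p) x) ->
  [/\ sol_fun p x = Y n (height_of p) (1 - dot (center p) x),
      differentiable (radial (sol_fun p) : E3 -> R^o) x &
      grad (sol_fun p) x = - W n (height_of p) (1 - dot (center p) x) *: tproj x (center p)].
Proof.
move=> Np Sx r0; have nr := sol_fun_near Np Sx r0.
have nE : \forall y \near x, S2 y -> sol_fun p y = Y n (height_of p) (1 - dot (center p) y).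
  by apply: filterS nr => y h /h[].
split; first exact: (nbhs_singleton nE Sx).
- by have [] := grad_axial Sx (section_c1 (Y_c1 (sys f_C1 n) _ _)) (rY_s (sys f_C1 n) _ _) nE.
- by have [] := grad_axial Sx (section_c1 (Y_c1 (sys f_C1 n) _ _)) (rY_s (sys f_C1 n) _ _) nE.
Qed.

Lemma sol_fun_hess n p x : N p -> S2 x -> reg n (height_of p) (1 - dot (center p) x) ->
  differentiable (radial (grad (sol_fun p))) x /\
  hess (sol_fun p) x = \matrix_(i, j)
    (Q n (height_of p) (1 - dot (center p) x) * (tproj x (center p) 0 i * tproj x (center p) 0 j) +
     W n (height_of p) (1 - dot (center p) x) * dot (center p) x * ((i == j)%:R - x 0 i * x 0 j)).
Proof.
move=> Np Sx r0; have [_ _ s2 _] := r0.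
apply: (hess_axial Sx (section_c1 (W_c1 (sys f_C1 n) _ s2)) (rW_s (sys f_C1 n) _ s2)).
apply: filterS (sol_fun_near Np Sx r0) => y h Sy.
by have [_ _] := sol_fun_grad Np Sy (h Sy).1.
Qed.

Lemma sol_fun_lap n p x : N p -> S2 x -> reg n (height_of p) (1 - dot (center p) x) ->
  lap (sol_fun p) x = - cutoff f n (Y n (height_of p) (1 - dot (center p) x)).
Proof.
move=> Np Sx r0; have [_ _ s2 _] := r0; have [_ hE] := sol_fun_hess Np Sx r0.
rewrite /lap hE /mxtrace.
under eq_bigr do rewrite mxE eqxx.
rewrite big_split -!mulr_sumr /= sumrB sumr_const card_ord -/(dot x x) Sx.
rewrite -/(dot (tproj x (center p)) (tproj x (center p))) tproj_sqr//; last exact: center_S2.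
have := rQ_ode (sys f_C1 n) (height_of p) s2.
set c := dot _ _; set Wv := W n _ _; set Qv := Q n _ _; set gv := cutoff f n _ => ode.
have -> : Qv * (1 - c ^+ 2) = (1 - c) * (2 - (1 - c)) * Qv by ring.
by rewrite ode; ring.
Qed.

(** The height of [p0] and the depth of [x] solve the problem posed by the data at [x], so
    uniqueness returns them. The center is recovered as [(dot c x) *: x] plus its tangential part,
    which the gradient determines. *)
Lemma param_eq p0 x : N p0 -> closure (Om p0) x ->
  let p := (x, grad (sol_fun p0) x, sol_fun p0 x) in
  height_of p = height_of p0 /\ center p = center p0.
Proof.
move=> Np cx p; have [n [_ Yr rr /(_ x cx)[Sx s0 sr rs]]] := closure_regular Np.
have [VE _ gE] := sol_fun_grad Np Sx rs.
set s := 1 - dot (center p0) x in s0 sr rs VE gE.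
have cS := center_S2 Np.
have sol1 : sol f_C1 (sol_fun p0 x) (dot (grad (sol_fun p0) x) (grad (sol_fun p0) x)) (height_of p0) s.
  exists n; split => //; rewrite gE dotZl dotZr tproj_sqr// gradsqE /s; ring.
have a0 : 0 <= sol_fun p0 x by rewrite VE; exact: rim_pos rr Yr s0 sr.
have [tE dE] := height_eq f_derivable f_pos f_sub a0 sol1.
have tE' : height_of p = height_of p0 by exact: tE.
have dE' : depth_of p = s by exact: dE.
split => //.
have -> : center p = (1 - s) *: x - (W n (height_of p0) s)^-1 *: grad (sol_fun p0) x.
  by rewrite /center tE' dE' (profile_slopeE rs s0).
rewrite gE.
have Wn : W n (height_of p0) s != 0 by rewrite lt_eqF// (reg_W rs).
have -> : 1 - s = dot (center p0) x by rewrite /s; ring.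
rewrite scalerA mulrN mulVf// scaleN1r opprK.
by rewrite /tproj addrC subrK.
Qed.

Local Notation radius := (radius f_C1).

Lemma dot_affine_cont c x : {for x, continuous (fun y : E3 => dot c y)}.
Proof. by apply: (dot_cont (F := fun=> c)); [exact: cst_continuous|exact: cvg_id]. Qed.

Lemma Om_domain p : N p -> domain (Om p).
Proof.
move=> Np; have [k1 k2] := cap_height Np.
have cS := center_S2 Np.
split.
- exists [set x | 1 - radius (height_of p) < dot (center p) x].
    apply: (@open_comp _ _ (fun x : E3 => dot (center p) x) [set t : R | 1 - radius (height_of p) < t]).
      by move=> x _; exact: dot_affine_cont.
    exact: open_gt.
  by apply/seteqP; split => x [].
- exact: cap_connected.
- exact: bdry_cap_neq0.
- move=> q; rewrite (Om_bdry Np) => -[qq cq].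
  by exists (fun x => 1 - radius (height_of p) - dot (center p) x); exact: defining_cap.
Qed.

Lemma S2_closed : closed (@S2 R).
Proof.
apply: (@closed_comp _ _ (fun x : E3 => dot x x) [set t : R | t = 1]); last exact: closed_eq.
by move=> x _; apply: dot_cont; exact: cvg_id.
Qed.

Lemma S2_compact : compact (@S2 R).
Proof.
apply: bounded_closed_compact; last exact: S2_closed.
exists 1; split => // M M1 x xx; apply: le_trans (ltW M1).
rewrite -[`|x|]/(mx_norm x) mx_normrE; apply: bigmax_le => // -[i j] _ /=.
have := coord_sqr_le x j; rewrite xx (ord1 i) => h.
by rewrite -(@ler_sqr _ _ 1) ?nnegrE// expr1n real_normK// num_real.
Qed.

Lemma compact_pos_lb (K : set E3) (phi : E3 -> R) : closed K -> K `<=` @S2 R ->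
  continuous phi -> (forall x, K x -> 0 < phi x) ->
  exists2 m, 0 < m & forall x, K x -> m <= phi x.
Proof.
move=> Kc KS pc pK; have [->|/set0P K0] := eqVneq K set0; first by exists 1.
have Kk : compact K by exact: subclosed_compact Kc S2_compact KS.
have [x xK xP] := EVT_min_rV K0 Kk (continuous_subspaceT pc).
exists (phi x); first by apply: pK; rewrite inE in xK.
by move=> y Ky; apply: xP; rewrite inE.
Qed.

Definition excess p x : R := dot (center p) x - (1 - radius (height_of p)).

(** The estimate is uniform over the sphere by the Cauchy-Schwarz inequality. *)
Lemma excess_near p0 (e : R) : N p0 -> 0 < e -> \forall p \near p0, N p ->
  forall x, S2 x -> `|excess p x - excess p0 x| < e.
Proof.
move=> Np e0; have [H [C [Hc Cc HC]]] := center_c1 Np.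
have [H0 C0] := nbhs_singleton HC Np.
have e2 : 0 < e / 2 by rewrite divr_gt0.
have h0 : 0 < height_of p0 by exact: height_of_gt0.
have rc : {for p0, continuous (fun p => radius (H p))}.
  apply: (cont_comp (f := radius)); last exact: c1_cont.
  by rewrite -H0; exact: radius_cont.
have Dc : {for p0, continuous (fun p => dot (C p - C p0) (C p - C p0))}.
  have D : c1 (fun p => C p - C p0) p0 by exact: (c1B Cc (c1_cst _ _)).
  exact: (c1_cont (dot_c1 D D)).
have n1 := cont_near rc e2.
have n2 := cont_near Dc (exprn_gt0 2 e2).
near=> p => Npp x xx.
have [tE cE] : height_of p = H p /\ center p = C p by move: Npp; near: p.
have b1 : `|radius (H p) - radius (H p0)| < e / 2 by near: p.
have b2 : `|dot (C p - C p0) (C p - C p0) - dot (C p0 - C p0) (C p0 - C p0)| < (e / 2) ^+ 2.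
  by near: p.
rewrite subrr dot0r subr0 in b2.
have b3 : `|dot (C p - C p0) x| < e / 2.
  rewrite -(@ltr_sqr _ _ (e / 2)) ?nnegrE// ?(ltW e2)// real_normK ?num_real//.
  apply: le_lt_trans (dot_cs _ _) _; rewrite xx mulr1.
  exact: le_lt_trans (ler_norm _) b2.
rewrite /excess tE cE H0 C0.
have -> : dot (C p) x - (1 - radius (H p)) - (dot (C p0) x - (1 - radius (H p0))) =
    dot (C p - C p0) x + (radius (H p) - radius (H p0)) by rewrite dotBl; ring.
by apply: le_lt_trans (ler_normD _ _) _; lra.
Unshelve. all: by end_near. Qed.

(** On the sphere, [excess p] is positive exactly on [Om p]. For [p0] it is bounded below by some
    [m1 > 0] on the compact set [K] and above by some [- m2 < 0] off [U]; uniform closeness keeps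
    both signs. *)
Lemma Om_continuous : continuous_family N Om.
Proof.
move=> p0 Np K U Kc KS KOm [D Do UE] cU.
have ec p : continuous (excess p).
  by move=> x; apply: contB; [exact: dot_affine_cont|exact: contC].
have [m1 m10 m1P] : exists2 m, 0 < m & forall x, K x -> m <= excess p0 x.
  by apply: compact_pos_lb => // x /KOm[_]; rewrite subr_gt0.
have [m2 m20 m2P] : exists2 m, 0 < m & forall x, (@S2 R `&` ~` D) x -> m <= - excess p0 x.
  apply: compact_pos_lb.
  - by apply: closedI; [exact: S2_closed|exact: open_closedC].
  - by move=> x [].
  - by move=> x; apply: contN; exact: ec.
  - move=> x [xx xD]; rewrite oppr_gt0 ltNge; apply/negP => ex.
    have : U x by apply: cU; rewrite (Om_closure Np); split => //; rewrite -subr_ge0.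
    by rewrite UE => -[].
have n1 := excess_near Np m10; have n2 := excess_near Np m20.
near=> p.
have Npp : N p by near: p; exact: withinT.
have e1 x : S2 x -> `|excess p x - excess p0 x| < m1.
  by move: x; apply: (_ : N p -> _) Npp; near: p; exact: cvg_within.
have e2 x : S2 x -> `|excess p x - excess p0 x| < m2.
  by move: x; apply: (_ : N p -> _) Npp; near: p; exact: cvg_within.
split=> x.
- move=> Kx; have xx := KS x Kx; split => //; rewrite -subr_gt0 -/(excess p x).
  by have := e1 x xx; have := m1P x Kx; rewrite ltr_norml => ? /andP[]; lra.
- move=> [xx]; rewrite -subr_gt0 -/(excess p x) => ex.
  rewrite UE; split => //; apply: contrapT => xD.
  have := e2 x xx; have := m2P x (conj xx xD); rewrite ltr_norml => ? /andP[]; lra.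
Unshelve. all: by end_near. Qed.

Lemma sol_fun_OEP p : N p -> exists2 alpha, alpha < 0 & OEP f alpha (Om p) (sol_fun p).
Proof.
move=> Np; have [n [/andP[h0 hM] Yr rr rP]] := closure_regular Np.
have [k1 k2] := cap_height Np.
have cS := center_S2 Np.
set k := 1 - radius (height_of p) in k1 k2.
have r_gt0 : 0 < radius (height_of p) by move: k2; rewrite /k; lra.
have k3 : 0 < 1 - k ^+ 2 by rewrite expr2; nra.
have Wr : W n (height_of p) (radius (height_of p)) < 0 by apply: reg_W rr _; exact: ltW.
have inner q : Om p q -> [/\ S2 q, reg n (height_of p) (1 - dot (center p) q),
    0 <= 1 - dot (center p) q & 0 < Y n (height_of p) (1 - dot (center p) q)].
  move=> Oq; have [qq s0 sr rq] := rP q (subset_closure Oq).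
  split => //; have ps : pos (sys f_C1 n) (height_of p) (radius (height_of p)).
    by apply: reg_pos rr _; rewrite Yr.
  by apply: ps; rewrite s0 /=; case: Oq => _; rewrite /k; lra.
(* The gradient at the rim is [- W *: tproj q c], and [tproj q c] has length [Num.sqrt (1 - k ^+ 2)]
   and points inwards. *)
exists (W n (height_of p) (radius (height_of p)) * Num.sqrt (1 - k ^+ 2)).
  by rewrite nmulr_rlt0// sqrtr_gt0.
split.
- move=> q /inner[qq rq s0 Yq].
  rewrite (sol_fun_lap Np qq rq).
  have [-> _ _] := sol_fun_grad Np qq rq.
  rewrite cutoffE ?addNr// (ltW Yq) /=.
  exact: le_trans (reg_Y_le rq s0) (ltW hM).
- move=> q /inner[qq rq _ Yq].
  by have [-> _ _] := sol_fun_grad Np qq rq.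
- move=> q qb; have [qq s0 sr rq] := rP q qb.1.
  move: qb; rewrite (Om_bdry Np) => -[_ cq].
  have [-> _ _] := sol_fun_grad Np qq rq.
  by rewrite cq opprB addrCA subrr addr0.
- move=> q eta qb /outward_normal_cap H; have [qq s0 sr rq] := rP q qb.1.
  move: qb; rewrite (Om_bdry Np) => -[_ cq].
  have [_ _ ->] := sol_fun_grad Np qq rq.
  rewrite (H cS k1 k2 qq cq) dotZl dotZr tproj_sqr// cq -/k.
  have -> : 1 - k = radius (height_of p) by rewrite /k; ring.
  have := sqr_sqrtr (ltW k3); set r := Num.sqrt _ => rE; rewrite -rE.
  have r0 : r != 0 by rewrite gt_eqF// sqrtr_gt0.
  by field.
Qed.

Lemma cutoff_cont n : continuous (cutoff1 f n).
Proof. exact: cutoff1_cont. Qed.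

Lemma relopen_near (U : topologicalType) (X A : set U) : A `<=` X ->
  (forall u, A u -> \forall v \near u, X v -> A v) -> relopen X A.
Proof.
move=> AX H; exists [set y | X y -> A y]°; first exact: open_interior.
apply/seteqP; split => [x Ax|x [/interior_subset h /h]]//.
by split; [exact: H|exact: AX].
Qed.

(** The neighbourhood [B] required of a smooth family: [reg] is an open condition and holds slightly
    beyond the rim of each cap. *)
Definition reg_dom : set (T * E3) := [set z | [/\ N z.1, S2 z.2 &
  exists n, reg n (height_of z.1) (1 - dot (center z.1) z.2)]].

Lemma R_c1 (phi phi1 : R -> R) (t : R) : (forall t : R, is_derive t 1 phi (phi1 t)) ->
  continuous phi1 -> c1 phi t.
Proof.
move=> pd pc; have H : c1 (fun p : R * R => phi p.2) (0, t).
  apply: (@c1_two R (fun _ s => phi s) (fun _ _ => 0) (fun _ s => phi1 s) 0 t 1) => // h s _ _.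
  split; first exact: derC.
  - exact: pd.
  - exact: contC.
  - by apply: (cont_comp (f := phi1)); [exact: pc|exact: cvg_snd].
apply: (c1_comp (f := fun s : R => (0 : R, s)) _ H).
exact: (c1_pair (c1_cst (0 : R) _) (c1_id _)).
Qed.

(** With [d = c - x] and depth [s], [tproj x c = d + s x]. Expanding [Q] times the products of its
    coordinates leaves [quad] and terms that contain [Q] only through [s Q], all of them C^1. *)
Lemma jet_c1 p0 x0 : N p0 -> closure (Om p0) x0 ->
  Ck_near 1 reg_dom (jet2 sol_fun) (p0, x0).
Proof.
move=> Np cx; have [n [_ _ _ /(_ x0 cx)[Sx s0 _ r0]]] := closure_regular Np.
have [H [C [Hc Cc HC]]] := center_c1 Np.
have [H0 C0] := nbhs_singleton HC Np.
have Sc := center_S2 Np.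
have nr := regular_near Np Sx r0.
have [_ _ s2 _] := r0.
pose z0 : T * E3 := (p0, x0).
have Hz : c1 (fun z : T * E3 => H z.1) z0 by exact: (c1_comp_fst (p := z0) (f := H) Hc).
have Cz : c1 (fun z : T * E3 => C z.1) z0 by exact: (c1_comp_fst (p := z0) (f := C) Cc).
have xz : c1 (fun z : T * E3 => z.2) z0 by exact: c1_snd.
have Cxz : c1 (fun z : T * E3 => dot (C z.1) z.2) z0 by exact: dot_c1 Cz xz.
have sz : c1 (fun z : T * E3 => 1 - dot (C z.1) z.2) z0 by exact: c1B (c1_cst (1 : R) _) Cxz.
have Yz : c1 (fun z : T * E3 => Y n (H z.1) (1 - dot (C z.1) z.2)) z0.
  apply: (c1_comp (f := fun z : T * E3 => (H z.1, 1 - dot (C z.1) z.2))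
    (g := fun q : R * R => Y n q.1 q.2)); first exact: (c1_pair Hz sz).
  exact: Y_c1.
have Wz : c1 (fun z : T * E3 => W n (H z.1) (1 - dot (C z.1) z.2)) z0.
  apply: (c1_comp (f := fun z : T * E3 => (H z.1, 1 - dot (C z.1) z.2))
    (g := fun q : R * R => W n q.1 q.2)); first exact: (c1_pair Hz sz).
  by apply: W_c1; rewrite /= -C0.
have dz : c1 (fun z : T * E3 => C z.1 - z.2) z0 by exact: c1B Cz xz.
pose sg (z : T * E3) := sig (C z.1 - z.2).
have sgz : c1 sg z0 by exact: sig_c1 dz.
have sg0 : sg z0 = 1 - dot (center p0) x0.
  by rewrite /sg /sig -C0 S2_dist.
(* The equation expresses [s Q] by [W], [Y] and the cut-off [f]; this is C^1 even at the pole. *)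
pose sQ (z : T * E3) := (2 * (1 - dot (C z.1) z.2 - 1) * W n (H z.1) (1 - dot (C z.1) z.2) -
  cutoff f n (Y n (H z.1) (1 - dot (C z.1) z.2))) / (2 - (1 - dot (C z.1) z.2)).
have sQz : c1 sQ z0.
  apply: c1M.
    apply: c1B; first by apply: c1M Wz; apply: c1M (c1_cst _ _) _; exact: c1B sz (c1_cst _ _).
    apply: (c1_comp Yz); apply: (R_c1 _ (fun t => cutoff_der f_C1 n t)).
    exact: cutoff1_cont.
  apply: c1V; last exact: c1B (c1_cst _ _) sz.
  rewrite /= -C0 gt_eqF// subr_gt0; apply: lt_trans s2 _.
  by rewrite gtrBl; exact: margin_gt0.
pose G1 (z : T * E3) : E3 := - W n (H z.1) (1 - dot (C z.1) z.2) *: (C z.1 - dot (C z.1) z.2 *: z.2).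
have G1c : c1 G1 z0 by exact: c1_scaler (c1N Wz) (c1B Cz (c1_scaler Cxz xz)).
have coord (F : T * E3 -> E3) i : c1 F z0 -> c1 (fun z => F z 0 i) z0.
  by move=> Fc; apply: (c1_comp (g := fun y : E3 => y 0 i) Fc); exact: c1_coord.
pose G2 i j (z : T * E3) : R := quad (sys f_C1 n) i j (H z.1, C z.1 - z.2) +
  sQ z * ((C z.1 - z.2) 0 i * z.2 0 j + (C z.1 - z.2) 0 j * z.2 0 i) +
  (1 - dot (C z.1) z.2) * sQ z * (z.2 0 i * z.2 0 j) +
  W n (H z.1) (1 - dot (C z.1) z.2) * dot (C z.1) z.2 * ((i == j)%:R - z.2 0 i * z.2 0 j).
have G2c i j : c1 (G2 i j) z0.
  have di k := coord _ k dz; have xi k := coord _ k xz.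
  apply: c1D; last first.
    exact: c1M (c1M Wz Cxz) (c1B (c1_cst _ _) (c1M (xi i) (xi j))).
  apply: c1D; last exact: c1M (c1M sz sQz) (c1M (xi i) (xi j)).
  apply: c1D; last exact: c1M sQz (c1D (c1M (di i) (xi j)) (c1M (di j) (xi i))).
  apply: (c1_comp (f := fun z : T * E3 => (H z.1, C z.1 - z.2)) (g := quad (sys f_C1 n) i j)).
    exact: c1_pair Hz dz.
  apply: (quad_c1 (sys f_C1 n) (margin_gt0 _ n) (margin_lt1 _ n) (cutoff_der f_C1 n) (@cutoff_cont n)).
  by rewrite /= -/(sg z0) sg0.
have Gc : c1 (fun z => (Y n (H z.1) (1 - dot (C z.1) z.2) : R^o,
    (z.2, G1 z, \matrix_(i < 3, j < 3) G2 i j z))) z0.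
  exact: c1_pair Yz (c1_pair (c1_pair xz G1c) (c1_mx (fun i j => G2c i j))).
have nC : \forall z \near z0, N z.1 -> height_of z.1 = H z.1 /\ center z.1 = C z.1.
  exact: (@cvg_fst _ _ (nbhs p0) (nbhs x0) _ _ HC).
apply: (c1_Ck_near Gc); near=> z => -[Nz Sz _].
have [tE cE] : height_of z.1 = H z.1 /\ center z.1 = C z.1 by move: Nz; near: z.
have rz : reg n (height_of z.1) (1 - dot (center z.1) z.2).
  by apply: (_ : N z.1 -> S2 z.2 -> _) Nz Sz; near: z.
have [VE _ gE] := sol_fun_grad Nz Sz rz.
have [_ hE] := sol_fun_hess Nz Sz rz.
have [_ _ z2 _] := rz.
have Scz := center_S2 Nz.
rewrite /jet2 VE gE hE /G1 -tE -cE; congr (_, (_, _, _)).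
apply/matrixP => i j; rewrite !mxE /G2 /quad /= -tE -cE.
have -> : sig (center z.1 - z.2) = 1 - dot (center z.1) z.2 by rewrite /sig S2_dist.
have -> : sQ z = (1 - dot (center z.1) z.2) * Q n (height_of z.1) (1 - dot (center z.1) z.2).
  rewrite /sQ -tE -cE -rQ_ode//; field; rewrite gt_eqF// subr_gt0; apply: lt_trans z2 _.
  by rewrite gtrBl; exact: margin_gt0.
by rewrite !mxE; ring.
Unshelve. all: by end_near. Qed.

Lemma sol_fun_C3 p q : N p -> closure (Om p) q ->
  Ck_near 3 (closure (Om p)) (sol_fun p : E3 -> R^o) q.
Proof.
move=> Np cq; have [n [_ _ _ rP]] := closure_regular Np.
have Sc := center_S2 Np.
have sE x : S2 x -> sig (x - center p) = 1 - dot (center p) x.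
  by move=> xx; rewrite /sig S2_dist// dotC.
exists [set x : E3 | sig (x - center p) < 2 - margin R n],
  (fun x => Y n (height_of p) (sig (x - center p)) : R^o); split.
- apply: (@open_comp _ _ (fun x : E3 => sig (x - center p)) [set t : R | t < 2 - margin R n]); last exact: open_lt.
  by move=> x _; apply: c1_cont; apply: sig_c1; exact: shift_c1.
- by have [qq _ _ [_ _ s2 _]] := rP q cq; rewrite /= sE.
- exact: (profile_C3 (sys f_C1 n) (margin_gt0 _ n) (margin_lt1 _ n) (cutoff_der f_C1 n) (@cutoff_cont n)).
- move=> y _ cy; have [yy s0 _ ry] := rP y cy.
  by rewrite /sol_fun (profileE ry s0) sE.
Qed.

Lemma sol_fun_smooth : smooth_family N Om sol_fun.
Proof.
split; first by move=> p q; exact: sol_fun_C3.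
have B_dom p q : N p -> closure (Om p) q -> reg_dom (p, q).
  move=> Np cq; have [n [_ _ _ /(_ q cq)[qq _ _ rq]]] := closure_regular Np.
  by split => //; exists n.
exists reg_dom; split.
- apply: relopen_near => [z [] //|[p x] [/= Np xx [n r0]]].
  apply: filterS (regular_near Np xx r0) => z rz [Nz zz].
  by split => //; exists n; exact: rz.
- by move=> [p q] [Np cq]; exact: B_dom.
- move=> p q [/= Np qq [n rq]].
  have [_ d1 _] := sol_fun_grad Np qq rq.
  by have [d2 _] := sol_fun_hess Np qq rq.
- by move=> [p q] [Np cq]; exact: jet_c1.
Qed.

Lemma sol_fun_at p : N p -> sol_fun p p.1.1 = p.2 /\ grad (sol_fun p) p.1.1 = p.1.2.
Proof.
move=> Np; have [n [s0 rs Ys _]] := param_sol Np.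
have [[qq _] _ _] := Np.
have sE : 1 - dot (center p) p.1.1 = depth_of p by rewrite center_dot//; ring.
have rq : reg n (height_of p) (1 - dot (center p) p.1.1) by rewrite sE.
have [-> _ ->] := sol_fun_grad Np qq rq.
rewrite sE Ys center_tproj// (profile_slopeE rs s0) scalerA mulrNN mulfV ?scale1r//.
by rewrite lt_eqF// (reg_W rs).
Qed.
End Candidates.

Theorem proposition3p11 (R : realType) (f : R -> R)
  (f_derivable : forall x : R, derivable f x 1)
  (f_C1 : continuous (derive1 f))
  (f_pos : forall x : R, 0 < x -> 0 < f x)
  (f_sub : forall x : R, 0 < x -> x * derive1 f x <= f x) :
  admits_candidate_solutions f.
Proof.
exists (Om f_C1), (sol_fun f_C1); split.
- by move=> p; exact: Om_domain.
- exact: Om_continuous.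
- exact: sol_fun_smooth.
- by move=> p; exact: sol_fun_OEP.
- split.
    move=> q w a Np; have [V1 V2] := sol_fun_at f_derivable f_C1 f_pos f_sub Np.
    by split => //; apply: (@basepoint_closure R f _ f_C1 _ _ (q, w, a)).
  move=> p0 Np q cq p.
  have [tE cE] := param_eq f_derivable f_pos f_sub Np cq.
  split; first by rewrite /Om [height_of _ _]tE [center _ _]cE.
  by move=> x _; rewrite /sol_fun [height_of _ _]tE [center _ _]cE.
Qed.
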